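(* Let $u$ be the solution of the time fractional parabolic problem described in the context, let $U_{\mathcal R}$ be the linear space-time reconstruction of the fully discrete L1 finite element approximation $(U_h^n)_{n=0}^N$, let $\rho(t):=u(t)-U_{\mathcal R}(t)$, and assume $\rho(0)\in D(\mathcal A)$. Fix any $\theta\in(0,\pi/2)$ and put $\varphi=\max(0,\pi-(\pi-\theta)/\alpha)$, $C_{\alpha,\varphi}=\frac1\pi(\cos\varphi)^{\alpha-1}\Gamma(1-\alpha)$. Then for $t\in I_n$, $n\ge1$, $$\|\rho(t)\|\le\|\rho(0)\|+\frac{1}{\sin\theta}C_{\alpha,\varphi}\int_0^t(t-\tau)^{\alpha-1}\Big(\|\partial^\alpha_t U_{\mathcal R}-\bar\partial^\alpha_kU_h^n\|+\|\mathcal AU_{\mathcal R}-\mathcal A_h^nU_h^n\|+\|f_h^n-f\|+\|\mathcal A\rho(0)\|\Big)d\tau,$$ where inside the integral the functions are evaluated at $\tau$ and the superscript $n$ denotes the index with $\tau\in I_n$.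
   Context: Problem. $\alpha\in(0,1)$, $T<\infty$, $\Omega\subset\mathbb R^d$ is a bounded convex polygonal domain. $\partial_t^\alpha$ is the Caputo derivative $\partial_t^\alpha v(t)=\int_0^t\omega_{1-\alpha}(t-s)v'(s)\,ds$ with $\omega_\gamma(t)=t^{\gamma-1}/\Gamma(\gamma)$. The operator is $\mathcal Au=-\nabla\cdot(A(x)\nabla u)$, symmetric positive definite with smooth matrix $A$, with domain $D(\mathcal A)=\{v\in H_0^1(\Omega):\mathcal Av\in L^2(\Omega)\}$, and $a(\varphi,\chi)=\langle A\nabla\varphi,\nabla\chi\rangle$ on $H_0^1(\Omega)$. Here $\langle\cdot,\cdot\rangle$ and $\|\cdot\|$ are the $L^2(\Omega)$ inner product and norm, and $\|\cdot\|_1$ is the $H^1(\Omega)$ norm. The form $a$ is coercive and continuous: $a(\varphi,\varphi)\ge\eta\|\varphi\|_1^2$ and $|a(\varphi,\chi)|\le\beta\|\varphi\|_1\|\chi\|_1$ for all $\varphi,\chi\in H_0^1(\Omega)$, with $\eta,\beta>0$. With $f\in C(0,T;L^2(\Omega))$, the function $u\in C^1(0,T;H_0^1(\Omega))$ solves $\langle\partial_t^\alpha u,\varphi\rangle+a(u,\varphi)=\langle f,\varphi\rangle$ for all $\varphi\in H^1_0(\Omega)$, $t\in(0,T]$, with $u(0)=u_0$. Discretization. $0=t_0<t_1<\dots<t_N=T$, $I_n=(t_{n-1},t_n]$, $k_n=t_n-t_{n-1}$. $\{\mathcal T_n\}_{n=0}^N$ are conforming shape-regular triangulations of $\Omega$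 (possibly changing with $n$), and $V_0^n\subset H_0^1(\Omega)$ is the space of continuous functions vanishing on $\partial\Omega$ that are polynomials of degree at most $r$ ($r\ge1$) on each $K\in\mathcal T_n$. $P_0^n$ is the $L^2$-projection onto $V_0^n$; $\Pi_j^i:V_0^j\to V_0^i$ are suitable projections or interpolants. The discrete elliptic operator $\mathcal A_h^n:H_0^1\to V_0^n$ is $\langle\mathcal A_h^nv,\varphi_h\rangle=a(v,\varphi_h)$ for all $\varphi_h\in V_0^n$. L1 scheme. $\bar\partial U_h^j=(U_h^j-\Pi_{j-1}^jU_h^{j-1})/k_j$, $a_j(t)=\frac{1}{\Gamma(2-\alpha)}[(t-t_{j-1})^{1-\alpha}-(t-t_j)^{1-\alpha}]$, $\bar\partial_k^\alpha U_h^n=\sum_{j=1}^na_j(t_n)\Pi_j^n\bar\partial U_h^j$. Given $U_h^0\in V_0^0$, $U_h^n\in V_0^n$ satisfies $\bar\partial_k^\alpha U_h^n+\mathcal A_h^nU_h^n=f_h^n$, where $f_h^n=P_0^nf(t_n)$, $n=1,\dots,N$. Reconstruction. The elliptic reconstruction $\mathcal R^n:V_0^n\to H_0^1$ is defined by $a(\mathcal R^nv,\varphi)=\langle\mathcal A_h^nv,\varphi\rangle$ for all $\varphi\in H_0^1$. With $\ell_{n,0}(t)=(t-t_{n-1})/k_n$ and $\ell_{n,-1}(t)=(t_n-t)/k_n$, the linear space-time reconstruction is $U_{\mathcal R}(t)=\ell_{n,-1}(t)\mathcal R^{n-1}U_h^{n-1}+\ell_{n,0}(t)\mathcal R^nU_h^n$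 for $t\in I_n$. *)

(* Defs.v *)
From HB Require Import structures.
From mathcomp Require Import all_boot all_order all_algebra.
From mathcomp Require Import all_classical all_reals all_analysis.

Set Implicit Arguments.
Unset Strict Implicit.
Unset Printing Implicit Defensive.
Import Order.TTheory GRing.Theory Num.Theory.
Import numFieldNormedType.Exports.

Local Open Scope classical_set_scope.
Local Open Scope ring_scope.

(* Lebesgue measure on R^d, on the sigma-algebra generated by the coordinates
   (which is the Borel one), as the d-fold product of [lebesgue_measure]. *)

Definition rV_display : measure_display.
Proof. exact: measure_tuple_display default_measure_display. Qed.

Section measurable_rV.
Context {R : realType}.
Variable n : nat.

Definition rV_coord (i : 'I_n) (x : 'rV[R]_n) : measurableTypeR R := x ord0 i.

Let rV_set0 : g_sigma_preimage rV_coord set0.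
Proof. exact: sigma_algebra0. Qed.

Let rV_setC B : g_sigma_preimage rV_coord B -> g_sigma_preimage rV_coord (~` B).
Proof. exact: sigma_algebraC. Qed.

Let rV_bigcup (F : (set 'rV[R]_n)^nat) :
  (forall k, g_sigma_preimage rV_coord (F k)) ->
  g_sigma_preimage rV_coord (\bigcup_k (F k)).
Proof. exact: sigma_algebra_bigcup. Qed.

HB.instance Definition _ := @isMeasurable.Build rV_display 'rV[R]_n
  (g_sigma_preimage rV_coord) rV_set0 rV_setC rV_bigcup.

Lemma measurable_rV_coord i : measurable_fun [set: 'rV[R]_n] (rV_coord i).
Proof.
move=> _ Y mY; rewrite setTI; apply: sub_sigma_algebra => /=.
rewrite -bigcup_seq/=; exists i => /=; first by rewrite mem_index_enum.
by exists Y => //; rewrite setTI.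
Qed.

Lemma measurable_fun_rVP d (T : measurableType d) (f : T -> 'rV[R]_n) :
  (forall i, measurable_fun [set: T] (rV_coord i \o f)) ->
  measurable_fun [set: T] f.
Proof.
move=> mf.
suff : preimage_set_system [set: T] f (g_sigma_preimage rV_coord)
    `<=` measurable.
  by move=> sub _ A mA; apply: sub; exists A.
rewrite -g_sigma_preimage_comp.
apply: smallest_sub; first exact: sigma_algebra_measurable.
rewrite -bigcup_seq/=; apply: bigcup_sub => i _ A [B mB <-].
exact: mf.
Qed.

End measurable_rV.

Section lebesgue_rV.
Context {R : realType}.
Local Notation mu1 := (@lebesgue_measure R).

Definition rV_cons n (p : measurableTypeR R * 'rV[R]_n) : 'rV[R]_n.+1 :=
  row_mx (const_mx p.1 : 'rV[R]_1) p.2.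

Definition rV_uncons n (x : 'rV[R]_n.+1) : measurableTypeR R * 'rV[R]_n :=
  (x ord0 ord0, \row_i x ord0 (lift ord0 i)).

Lemma rV_consK n : cancel (@rV_cons n) (@rV_uncons n).
Proof.
case=> a y; congr (_, _) => /=.
  by rewrite mxE; case: splitP => // j _; rewrite mxE.
apply/rowP => i; rewrite !mxE; case: splitP => [[[]]//|j /= ].
by rewrite /bump /= add1n add1n => -[] /val_inj ->.
Qed.

Lemma measurable_rV_cons n : measurable_fun [set: _] (@rV_cons n).
Proof.
apply: measurable_fun_rVP => i.
have [->|[j ->]] : i = ord0 \/ exists j, i = lift ord0 j.
  by case: (unliftP ord0 i) => [j ->|->]; [right; exists j|left].
- rewrite [X in measurable_fun _ X](_ : _ = fst)//.
  by apply/funext => p; have /(congr1 fst) := rV_consK p.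
- rewrite [X in measurable_fun _ X](_ : _ = rV_coord j \o snd).
    exact: measurableT_comp (measurable_rV_coord j) measurable_snd.
  apply/funext => p; have /(congr1 snd)/rowP/(_ j) := rV_consK p.
  by rewrite mxE.
Qed.

Lemma measurable_rV_uncons n : measurable_fun [set: _] (@rV_uncons n).
Proof.
apply: measurable_fun_pair; first exact: (measurable_rV_coord ord0).
apply: measurable_fun_rVP => i.
rewrite [X in measurable_fun _ X](_ : _ = rV_coord (lift ord0 i)).
  exact: measurable_rV_coord.
by apply/funext => x; rewrite /= /rV_coord mxE.
Qed.

Section step.
Variables (n : nat) (m : {sigma_finite_measure set 'rV[R]_n -> \bar R}).

Definition lebesgue_rV_step : set 'rV[R]_n.+1 -> \bar R :=
  pushforward (mu1 \x m)%E (@rV_cons n).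

Let step0 : lebesgue_rV_step set0 = 0%E.
Proof. by rewrite /lebesgue_rV_step /pushforward preimage_set0 measure0. Qed.

Let step_ge0 B : (0 <= lebesgue_rV_step B)%E.
Proof. exact: (measure_ge0 (mu1 \x m)%E). Qed.

Let step_sigma_additive : semi_sigma_additive lebesgue_rV_step.
Proof.
have mC B : measurable B -> measurable (@rV_cons n @^-1` B).
  by move=> mB; rewrite -[X in measurable X]setTI; exact: measurable_rV_cons.
move=> F mF tF mUF; rewrite /lebesgue_rV_step /pushforward preimage_bigcup.
apply: (@measure_semi_sigma_additive _ _ _ (mu1 \x m)%E).
- move=> k; apply: mC; exact: mF.
- apply/trivIsetP => /= i j _ _ ij; rewrite -preimage_setI.
  by move/trivIsetP : tF => /(_ _ _ _ _ ij) ->//; rewrite preimage_set0.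
- by rewrite -preimage_bigcup; apply: mC.
Qed.

HB.instance Definition _ := isMeasure.Build _ _ _ lebesgue_rV_step
  step0 step_ge0 step_sigma_additive.

Lemma lebesgue_rV_step_sigma_finite : sigma_finite setT lebesgue_rV_step.
Proof.
have /sigma_finiteP[F [FT ndF Foo]] := sigma_finiteT mu1.
have /sigma_finiteP[G [GT ndG Goo]] := sigma_finiteT m.
exists (fun k => @rV_uncons n @^-1` (F k `*` G k)).
  rewrite -preimage_bigcup (_ : \bigcup_k _ = setT) ?preimage_setT//.
  rewrite -setXTT FT GT predeqE => -[x y]; split => [[k _ []/= ? ?]|].
    by split; exists k.
  move=> [/= [k _ Fx] [l _ Gy]]; exists (maxn k l) => //; split.
    by move: x Fx; exact/subsetPset/ndF/leq_maxl.
  by move: y Gy; exact/subsetPset/ndG/leq_maxr.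
move=> k; have [mF Fk] := Foo k; have [mG Gk] := Goo k; split.
  by rewrite -[X in measurable X]setTI; apply: measurable_rV_uncons => //;
    exact: measurableX.
rewrite /lebesgue_rV_step /pushforward -comp_preimage.
rewrite (_ : _ \o _ = id); last by apply/funext; exact: rV_consK.
rewrite preimage_id product_measure1E//.
by rewrite lte_mul_pinfty// ge0_fin_numE.
Qed.

HB.instance Definition _ :=
  Measure_isSigmaFinite.Build _ _ _ lebesgue_rV_step
    lebesgue_rV_step_sigma_finite.

End step.

Fixpoint lebesgue_rV d : {sigma_finite_measure set 'rV[R]_d -> \bar R} :=
  match d with
  | 0%N => (\d_ (0 : 'rV[R]_0))
  | d'.+1 => lebesgue_rV_step (lebesgue_rV d')
  end.

End lebesgue_rV.

Section functions_on_Omega.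
Context {R : realType} (d : nat).
Implicit Types (v w f g : 'rV[R]_d -> R) (Omega : set 'rV[R]_d).
Local Notation mu := (@lebesgue_rV R d).

(* Elements of L^2(Omega) and of H^1_0(Omega) are represented by functions on
   the whole space, of which only the a.e. class on Omega matters. *)

Definition L2 Omega v : Prop := v \_ Omega \in Lfun mu 2%:E.

Definition L2dot Omega v w : R := \int[mu]_(x in Omega) (v x * w x).

Definition L2norm Omega v : R := fine ('N[mu]_2%:E[EFin \o (v \_ Omega)])%E.

Definition partial (i : 'I_d) f : 'rV[R]_d -> R :=
  fun x => 'D_(delta_mx ord0 i) f x.

Definition smooth_on (W : set 'rV[R]_d) f : Prop :=
  forall (s : seq 'I_d) x, W x ->
    {for x, continuous (foldr partial f s)} /\
    forall i, derivable (foldr partial f s) x (delta_mx ord0 i).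

Definition test_function Omega f : Prop :=
  smooth_on setT f /\
  exists K, [/\ compact K, K `<=` Omega & forall x, ~ K x -> f x = 0].

(* v belongs to the closure of the test functions in the H^1 norm, with (weak)
   gradient G *)
Definition is_grad Omega v (G : 'I_d -> 'rV[R]_d -> R) : Prop :=
  [/\ L2 Omega v, forall i, L2 Omega (G i)
    & exists f : nat -> 'rV[R]_d -> R,
      [/\ forall k, test_function Omega (f k),
          L2norm Omega (f k - v) @[k --> \oo] --> (0 : R)
        & forall i,
          L2norm Omega (partial i (f k) - G i) @[k --> \oo] --> (0 : R)]].

Definition H10 Omega v : Prop := exists G, is_grad Omega v G.

Definition grad Omega v : 'I_d -> 'rV[R]_d -> R :=
  xget (fun _ _ => 0) (is_grad Omega v).

Definition H1norm Omega v : R :=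
  Num.sqrt (L2norm Omega v ^+ 2 + \sum_(i < d) L2norm Omega (grad Omega v i) ^+ 2).

Section elliptic.
Variables (Omega : set 'rV[R]_d) (A : 'rV[R]_d -> 'M[R]_d).

(* the L^2 product of A G and H, for vector fields G and H *)
Definition flux_dot (G H : 'I_d -> 'rV[R]_d -> R) : R :=
  \int[mu]_(x in Omega) \sum_(i < d) \sum_(j < d) A x i j * G j x * H i x.

Definition aform v w : R := flux_dot (grad Omega v) (grad Omega w).

(* - div (A grad v) = w in the sense of distributions on Omega *)
Definition is_elliptic v w : Prop :=
  L2 Omega w /\ forall f, test_function Omega f ->
    flux_dot (grad Omega v) (partial^~ f) = L2dot Omega w f.

Definition elliptic_op v : 'rV[R]_d -> R := xget (fun=> 0) (is_elliptic v).

Definition elliptic_dom v : Prop :=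
  H10 Omega v /\ exists w, is_elliptic v w.

Definition elliptic_spd : Prop :=
  (forall v w, elliptic_dom v -> elliptic_dom w ->
     L2dot Omega (elliptic_op v) w = L2dot Omega v (elliptic_op w)) /\
  (forall v, elliptic_dom v -> L2norm Omega v != 0 ->
     0 < L2dot Omega (elliptic_op v) v).

End elliptic.

End functions_on_Omega.

Section functions_of_time.
Context {R : realType} (d : nat).
Implicit Types (Omega : set 'rV[R]_d) (v f u : R -> 'rV[R]_d -> R).

Definition Gamma (x : R) : R :=
  \int[@lebesgue_measure R]_(s in `]0, +oo[) (s `^ (x - 1) * expR (- s)).

Definition omega (gamma t : R) : R := t `^ (gamma - 1) / Gamma gamma.

(* [nm] stands for L2norm Omega or H1norm Omega *)
Definition norm_derive (nm : ('rV[R]_d -> R) -> R) v (t : R)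
    (w : 'rV[R]_d -> R) : Prop :=
  nm (h^-1 *: (v (t + h) - v t) - w) @[h --> 0^'] --> (0 : R).

Definition norm_continuous (nm : ('rV[R]_d -> R) -> R) (I : set R) v : Prop :=
  forall t, I t -> nm (v s - v t) @[s --> within I (nbhs t)] --> (0 : R).

(* w is the L^2-valued Bochner integral
     \int_0^t omega (1 - alpha) (t - s) v'(s) ds,
   characterized by its products with the elements of L^2, for v continuous
   and differentiable but at finitely many points; the exceptional points are
   needed by the time reconstruction below. *)
Definition is_caputo (alpha : R) Omega v (t : R) (w : 'rV[R]_d -> R) : Prop :=
  [/\ L2 Omega w,
      forall s, 0 <= s <= t -> L2 Omega (v s),
      norm_continuous (L2norm Omega) `[0, t] v
    & exists (v' : R -> 'rV[R]_d -> R) (E : seq R),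
      [/\ forall s, 0 < s < t -> L2 Omega (v' s),
          forall s, 0 < s < t -> s \notin E ->
            norm_derive (L2norm Omega) v s (v' s),
          (@lebesgue_measure R).-integrable `]0, t[
            (fun s => (omega (1 - alpha) (t - s) * L2norm Omega (v' s))%:E)
        & forall g, L2 Omega g ->
            (@lebesgue_measure R).-integrable `]0, t[
              (fun s => (omega (1 - alpha) (t - s) * L2dot Omega (v' s) g)%:E) /\
            L2dot Omega w g =
              \int[@lebesgue_measure R]_(s in `]0, t[)
                (omega (1 - alpha) (t - s) * L2dot Omega (v' s) g)]].

Definition caputo (alpha : R) Omega v (t : R) : 'rV[R]_d -> R :=
  xget (fun=> 0) (is_caputo alpha Omega v t).

(* f is in C(0,T;L^2): continuity is only required on the open interval *)
Definition C0_L2 Omega (T : R) f : Prop :=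
  (forall t, 0 <= t <= T -> L2 Omega (f t)) /\
  norm_continuous (L2norm Omega) `]0, T[ f.

(* u is in C^1(0,T;H^1_0): continuous differentiability is only required on the
   open interval; at the end points, L^2 continuity gives a meaning to the
   initial condition and to u(T). *)
Definition C1_H10 Omega (T : R) u : Prop :=
  [/\ forall t, 0 <= t <= T -> H10 Omega (u t),
      norm_continuous (L2norm Omega) `[0, T] u
    & exists u' : R -> 'rV[R]_d -> R,
      [/\ forall t, 0 < t < T -> H10 Omega (u' t),
          forall t, 0 < t < T -> norm_derive (H1norm Omega) u t (u' t)
        & norm_continuous (H1norm Omega) `]0, T[ u']].

Definition fractional_solution (alpha T : R) Omega (A : 'rV[R]_d -> 'M[R]_d)
    f (u0 : 'rV[R]_d -> R) u : Prop :=
  [/\ C1_H10 Omega T u,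
      L2norm Omega (u 0 - u0) = 0
    & forall t, 0 < t <= T ->
      (exists w, is_caputo alpha Omega u t w) /\
      forall phi, H10 Omega phi ->
        L2dot Omega (caputo alpha Omega u t) phi + aform Omega A (u t) phi
        = L2dot Omega (f t) phi].

End functions_of_time.

Section finite_elements.
Context {R : realType} (d : nat).

Definition convex_polytopal_domain (Omega : set 'rV[R]_d) : Prop :=
  [/\ Omega !=set0, bounded_set Omega
    & exists (m : nat) (nu : 'M[R]_(m, d)) (b : 'cV[R]_m),
      Omega = [set x | forall i, (nu *m x^T) i ord0 < b i ord0]].

(* A simplex is the matrix whose rows are its d + 1 vertices. *)
Definition simplex := 'M[R]_(d.+1, d).

Definition nondegenerate (K : simplex) : bool :=
  row_free (row_mx (const_mx 1 : 'cV[R]_d.+1) K).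

Definition face (K : simplex) (I : {set 'I_d.+1}) : set 'rV[R]_d :=
  [set x | exists l : 'rV[R]_d.+1,
    [/\ forall i, 0 <= l ord0 i, \sum_i l ord0 i = 1,
        forall i, i \notin I -> l ord0 i = 0 & x = l *m K]].

Definition hull (K : simplex) : set 'rV[R]_d := face K [set: 'I_d.+1].

(* the empty set of vertices gives the empty face *)
Definition conforming_triangulation (Omega : set 'rV[R]_d) (Th : seq simplex) :=
  [/\ forall K, K \in Th -> nondegenerate K,
      closure Omega = \bigcup_(K in [set` Th]) hull K
    & forall K L, K \in Th -> L \in Th -> exists I J : {set 'I_d.+1},
        hull K `&` hull L = face K I /\ hull K `&` hull L = face L J].

Definition euclid_norm (x : 'rV[R]_d) : R :=
  Num.sqrt (\sum_(i < d) x ord0 i ^+ 2).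

(* the diameter of K is at most sigma times the radius of some ball in K *)
Definition shape_regular (sigma : R) (K : simplex) : Prop :=
  exists (x : 'rV[R]_d) (rho : R),
    [/\ 0 < rho,
        [set y | euclid_norm (y - x) < rho] `<=` hull K
      & forall i j, euclid_norm (row i K - row j K) <= sigma * rho].

Definition poly_function (r : nat) (p : 'rV[R]_d -> R) : Prop :=
  exists c : {ffun 'I_d -> 'I_r.+1} -> R, forall x,
    p x = \sum_(m : {ffun 'I_d -> 'I_r.+1} | (\sum_(i < d) m i <= r)%N)
            c m * \prod_(i < d) x ord0 i ^+ m i.

(* Finite element functions are extended by zero outside Omega; since they
   vanish on the boundary, they are continuous on the whole space. *)
Definition fe_space (Omega : set 'rV[R]_d) (r : nat) (Th : seq simplex)
    (v : 'rV[R]_d -> R) : Prop :=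
  [/\ continuous v, forall x, ~ Omega x -> v x = 0
    & forall K, K \in Th -> exists2 p, poly_function r p & forall x, hull K x -> v x = p x].

End finite_elements.

Section discretization.
Context {R : realType} (d : nat).
Variables (Omega : set 'rV[R]_d) (A : 'rV[R]_d -> 'M[R]_d).
Local Notation fct := ('rV[R]_d -> R).
Implicit Types (V : fct -> Prop).

Definition L2_projection V (P : fct -> fct) : Prop :=
  forall w, L2 Omega w ->
    V (P w) /\ forall chi, V chi -> L2dot Omega (P w) chi = L2dot Omega w chi.

Definition discrete_elliptic V (Ah : fct -> fct) : Prop :=
  forall v, H10 Omega v ->
    V (Ah v) /\
    forall chi, V chi -> L2dot Omega (Ah v) chi = aform Omega A v chi.

Definition elliptic_reconstruction V (Ah Rc : fct -> fct) : Prop :=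
  forall v, V v ->
    H10 Omega (Rc v) /\
    forall phi, H10 Omega phi -> aform Omega A (Rc v) phi = L2dot Omega (Ah v) phi.

Definition mesh (T : R) (N : nat) (t : nat -> R) : Prop :=
  [/\ t 0%N = 0, t N = T & forall n, (n < N)%N -> t n < t n.+1].

Variables (alpha : R) (N : nat) (t : nat -> R).

Definition kstep (n : nat) : R := t n - t n.-1.

(* the n such that t n.-1 < s <= t n, if 0 < s <= t N; and 1 if s = 0 *)
Definition mesh_index (s : R) : nat := maxn 1 (\sum_(j < N) (t j < s)%R)%N.

(* [Pi j n] is the operator from the j-th to the n-th finite element space *)
Variables (Pi : nat -> nat -> fct -> fct) (U : nat -> fct).

Definition diffq (j : nat) : fct := (kstep j)^-1 *: (U j - Pi j.-1 j (U j.-1)).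

Definition L1_weight (j : nat) (s : R) : R :=
  ((s - t j.-1) `^ (1 - alpha) - (s - t j) `^ (1 - alpha)) / Gamma (2 - alpha).

Definition L1_derive (n : nat) : fct :=
  \sum_(1 <= j < n.+1) L1_weight j (t n) *: Pi j n (diffq j).

Definition L1_scheme (Ah : nat -> fct -> fct) (fh : nat -> fct)
    (V : nat -> fct -> Prop) : Prop :=
  (forall n, (n <= N)%N -> V n (U n)) /\
  (forall n, (1 <= n <= N)%N -> L1_derive n + Ah n (U n) = fh n).

Definition space_time_reconstruction (Rc : nat -> fct -> fct) (s : R) : fct :=
  let n := mesh_index s in
  ((t n - s) / kstep n) *: Rc n.-1 (U n.-1) +
  ((s - t n.-1) / kstep n) *: Rc n (U n).

End discretization.

(* Main.v *)
Require Import Defs.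
From HB Require Import structures.
From mathcomp Require Import all_boot all_order all_algebra.
From mathcomp Require Import all_classical all_reals all_analysis.
From mathcomp Require Import measurable_realfun.
From mathcomp Require Import ring lra.
Set Implicit Arguments.
Unset Strict Implicit.
Unset Printing Implicit Defensive.
Import Order.TTheory GRing.Theory Num.Theory.
Import numFieldNormedType.Exports.

(** The error is estimated by an energy argument, in place of resolvent bounds
    for the solution operator.

    Write [rho = u - UR], and [D] for the Caputo derivative.  On each mesh cell
    [UR] interpolates elliptic reconstructions, so that
    [a(UR, phi) = <AUR, phi>] with [AUR] the interpolant of the functions
    [A_h U].  Subtracting this from the equation of [u] tested with [rho(tau)],
    and using [L1 + A_h U_h = f_h], gives
      [<D rho, rho> + a(rho, rho) = - <g1 + g2 + g3, rho>],
    where the [g_i] are the three residuals of the theorem.  The term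
    [a(rho, rho)] is nonnegative, hence [<D rho, rho> <= G ||rho||], where [G]
    is the sum of norms in the theorem.

    Let [b = sqrt (eps^2 + ||rho||^2)].  As [b] is a convex function of [rho]
    and the kernel [(tau - s)^(-al)] is increasing in [s], the fractional
    derivative of [b] is at most [<D rho, rho> / b <= G]
    ([abel_weighted_derivative_le0] applied to the gap between [b] and its
    tangent at [rho(tau)]).  Integrating against [(t - tau)^(al - 1)] undoes
    the fractional derivative ([abel_inversion]) up to the factor
    [B(1 - al, al)], which is at least [pi] ([beta_ge_pi]).  Letting [eps] tend
    to [0] yields [fractional_energy_estimate], with constant
    [Gamma(1 - al) / pi]; the constant of the theorem is larger
    ([sector_constant_ge]).

    Two points take most of the work.  First, the reconstruction identity is
    about elements of [H10], so that finite element functions must be shown to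
    lie in [H10], defined as a closure of the test functions
    ([fe_space_H10]).  A finite element function is continuous, Lipschitz along
    coordinate lines and locally polynomial off a null union of hyperplanes;
    contracting it towards an interior point of the convex domain makes its
    support compact in the domain, and mollifying the result gives test
    functions that converge to it together with their gradients.  Second, [UR]
    is differentiable in time only between mesh points, and the Caputo
    derivative is specified by duality, so that calculus along the path [rho]
    is carried out with finitely many exceptional times. *)

Local Open Scope classical_set_scope.
Local Open Scope ring_scope.

(** * Integration of real functions *)

Section real_integrable.
Context d (T : measurableType d) (R : realType).
Variables (mu : {measure set T -> \bar R}) (D : set T).
Hypothesis mD : measurable D.
Implicit Types f g : T -> R.

Lemma le_integrableR f g : measurable_fun D f ->
  (forall x, D x -> `|f x| <= `|g x|) ->
  mu.-integrable D (EFin \o g) -> mu.-integrable D (EFin \o f).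
Proof.
by move=> mf fg; apply: le_integrable => //; exact/measurable_EFinP.
Qed.

Lemma integrableRZl k f : mu.-integrable D (EFin \o f) ->
  mu.-integrable D (EFin \o (fun x => k * f x)).
Proof. by move=> /(integrableZl mD k); apply: eq_integrable. Qed.

Lemma integrableRD f g :
  mu.-integrable D (EFin \o f) -> mu.-integrable D (EFin \o g) ->
  mu.-integrable D (EFin \o (fun x => f x + g x)).
Proof. by move=> /(integrableD mD) /[apply]; apply: eq_integrable. Qed.

Lemma integrableRB f g :
  mu.-integrable D (EFin \o f) -> mu.-integrable D (EFin \o g) ->
  mu.-integrable D (EFin \o (fun x => f x - g x)).
Proof. by move=> /(integrableB mD) /[apply]; apply: eq_integrable. Qed.

Lemma Rintegral_bigsum (I : Type) (s : seq I) (F : I -> T -> R) :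
  (forall i, mu.-integrable D (EFin \o F i)) ->
  mu.-integrable D (EFin \o (fun x => \sum_(i <- s) F i x)) /\
  \int[mu]_(x in D) (\sum_(i <- s) F i x) = \sum_(i <- s) \int[mu]_(x in D) (F i x).
Proof.
move=> iF; elim: s => [|i s [IH1 IH2]].
  under [X in integrable _ _ X]eq_fun do rewrite /= big_nil.
  rewrite big_nil; split; first exact: integrable0.
  by under eq_Rintegral do rewrite big_nil; rewrite /Rintegral integral0.
have E : (fun x => \sum_(j <- i :: s) F j x) = (fun x => F i x + \sum_(j <- s) F j x).
  by apply/funext => x; rewrite big_cons.
rewrite E big_cons -IH2; split; last by rewrite RintegralD.
exact: integrableRD.
Qed.

End real_integrable.

Section calculus_with_exceptional_points.
Context {R : realType}.
Local Notation mu := (@lebesgue_measure R).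
Implicit Types (E : seq R) (a b c x : R).

(** Induction on the list [E] of exceptional points: a property of intervals that is
    stable under juxtaposition need only be checked on intervals free of them. *)
Lemma interval_split_ind (P : R -> R -> Prop) E :
  (forall a b, a < b -> (forall x, a < x < b -> x \notin E) -> P a b) ->
  (forall a c b, a < c < b -> P a c -> P c b -> P a b) ->
  forall a b, a < b -> P a b.
Proof.
move=> P0 Pcat; elim: E P0 => [|e E IH] P0; first by move=> a b ab; exact: P0.
apply: IH => a b ab Eab.
have [aeb|aeb] := boolP (a < e < b); last first.
  apply: P0 => // x axb; rewrite inE negb_or Eab// andbT.
  by apply: contraNneq aeb => <-.
have /andP[ae eb] := aeb.
apply: (Pcat _ e) => //; apply: P0 => // x /andP[x1 x2]; rewrite inE negb_or.
  by rewrite lt_eqF//= Eab// x1 (lt_trans x2).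
by rewrite gt_eqF//= Eab// x2 (lt_trans ae).
Qed.

Lemma derive0_exceptional_cst (f : R -> R) E a b : a < b ->
  {within `[a, b], continuous f} ->
  (forall x, a < x < b -> x \notin E -> is_derive x 1 f 0) ->
  f b = f a.
Proof.
move=> ab0 cf df.
apply: (@interval_split_ind (fun a' b' => a <= a' -> b' <= b -> f b' = f a') E
  _ _ a b ab0 (lexx a) (lexx b)).
- move=> a' b' ab' nE aa' bb'.
  have dfab x : x \in `]a', b'[ -> is_derive x 1 f 0.
    rewrite in_itv/= => xab; apply: df (nE _ xab).
    by case/andP: xab => x1 x2; rewrite (le_lt_trans aa')// (lt_le_trans x2).
  have cfab : {within `[a', b'], continuous f}.
    apply: continuous_subspaceW cf => z /=; rewrite !in_itv/= => /andP[z1 z2].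
    by rewrite (le_trans aa')// (le_trans z2).
  have [c _] := @MVT R f (fun=> 0) a' b' ab' dfab cfab.
  by rewrite mul0r => /eqP; rewrite subr_eq0 => /eqP.
- move=> a' c' b' /andP[ac cb] IH1 IH2 aa' bb'.
  by rewrite IH2 ?IH1// ?(le_trans _ bb')// ?(le_trans aa')// ltW.
Qed.

(** The difference between [F] and the primitive of [f] is continuous and has zero
    derivative off [E], hence is constant. *)
Lemma FTC_exceptional (F f : R -> R) E a b : a < b ->
  {within `[a, b], continuous F} ->
  mu.-integrable `]a, b[ (EFin \o f) ->
  (forall x, a < x < b -> x \notin E ->
     is_derive x 1 F (f x) /\ {for x, continuous f}) ->
  \int[mu]_(x in `]a, b[) f x = F b - F a.
Proof.
move=> ab cF intf dF.
pose g := f \_ `]a, b[.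
have intg : mu.-integrable setT (EFin \o g).
  by rewrite /g -restrict_EFin; apply/(integrable_mkcond _ _).1.
have intgS (I : set R) : measurable I -> mu.-integrable I (EFin \o g).
  by move=> mI; apply: integrableS intg.
pose Phi := parameterized_integral mu a ^~ g.
have cPhi : {within `[a, b], continuous Phi}.
  by apply: parameterized_integral_continuous; [exact: ltW|exact: intgS].
have Phia : Phi a = 0.
  by rewrite /Phi /parameterized_integral set_itv1 Rintegral_set1.
have Phib : Phi b = \int[mu]_(x in `]a, b[) f x.
  rewrite /Phi /parameterized_integral /g -Rintegral_mkcondr.
  congr (Rintegral _ _ _); apply/seteqP; split => x /=; first by case.
  by move=> xab; split => //; exact: subset_itv_oo_cc.
suff H : F b - Phi b = F a - Phi a by rewrite -Phib -[LHS](subKr (F b)) H Phia subr0.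
apply: (@derive0_exceptional_cst (fun x => F x - Phi x) E a b ab).
  by move=> x; apply: continuousB; [exact: cF|exact: cPhi].
move=> x axb xE.
have [dFx cfx] := dF _ axb xE.
have /andP[ax xb] := axb.
have near_g : \forall z \near x, g z = f z.
  near=> z; rewrite /g patchE mem_set//= in_itv/=; apply/andP; split.
    by near: z; exact: lt_nbhsr.
  by near: z; exact: lt_nbhsl.
have cg : {for x, continuous g}.
  rewrite /prop_for /continuous_at.
  have -> : g x = f x by exact: nbhs_singleton near_g.
  apply: cvg_trans cfx; apply: near_eq_cvg.
  by near=> z; apply/esym; near: z; exact: near_g.
have [dPhi ePhi] := @continuous_FTC1 R g (BLeft a) x b xb (intgS _ (measurable_itv _)) ax cg.
have -> : 0 = f x - g x.
  by rewrite (nbhs_singleton near_g) subrr.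
apply: is_deriveB.
rewrite -ePhi derive1E; exact: derivableP.
Unshelve. all: by end_near. Qed.

End calculus_with_exceptional_points.

Section affine_change_of_variable.
Context {R : realType}.
Local Notation mu := (@lebesgue_measure R).
Local Open Scope ereal_scope.

Lemma measurable_affine (c d : R) :
  measurable_fun [set: measurableTypeR R]
    (fun x => c * x + d : measurableTypeR R)%R.
Proof. by apply: measurable_funD => //; exact: measurable_funM. Qed.

(** Lebesgue measure and the rescaled image measure agree on intervals, which
    determine a measure. *)
Lemma ge0_integral_affine (c d : R) (f : R -> \bar R) : c != 0%R ->
  measurable_fun [set: R] f -> (forall x, 0 <= f x) ->
  \int[mu]_x f x = `|c|%:E * \int[mu]_x f (c * x + d)%R.
Proof.
move=> c0 mf f0.
have c_ge0 : (0 <= `|c|)%R by [].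
pose phi : measurableTypeR R -> measurableTypeR R := (fun x => c * x + d)%R.
have mphi : measurable_fun setT phi by exact: measurable_affine.
pose push : {measure set (measurableTypeR R) -> \bar R} :=
  measure_function_pushforward__canonical__measure_function_Measure mu mphi.
pose m' := mscale (NngNum c_ge0) push.
have lebI (x y : R) (b0 b1 : bool) :
    lebesgue_measure ([set` Interval (BSide b0 x) (BSide b1 y)] : set R) =
    (if (x < y)%R then (y - x)%R%:E else 0).
  by rewrite lebesgue_measure_itv/= lte_fin -EFinB.
have mE A : measurable A -> mu A = m' A.
  apply: lebesgue_measure_unique => //= _ [[a b]] _ <-.
  rewrite /m' /mscale/= /pushforward lebesgue_measure_itv/= lte_fin.
  have [cp|cn] : (0 < c \/ c < 0)%R.
    by move: c0; rewrite neq_lt => /orP[]; [right|left].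
  - have -> : phi @^-1` `]a, b] = `]((a - d) / c)%R, ((b - d) / c)%R]%classic.
      apply/seteqP; split => x /=; rewrite !in_itv/= /phi => /andP[].
        by rewrite ltr_pdivrMr// ler_pdivlMr// ltrBlDr lerBrDr (mulrC x) => -> ->.
      by rewrite ltr_pdivrMr// ler_pdivlMr// ltrBlDr lerBrDr (mulrC x) => -> ->.
    transitivity (`|c|%:E * (if ((a - d) / c < (b - d) / c)%R then
        ((b - d) / c - (a - d) / c)%R%:E else 0)); last by congr (_ * _); exact/esym/lebI.
    rewrite ltr_pM2r ?invr_gt0// ltrD2r.
    case: ifPn => _; last by rewrite mule0.
    rewrite -!EFinB -EFinM; congr EFin.
    by rewrite -mulrBl mulrC (gtr0_norm cp) divfK// opprB addrA subrK.
  - have -> : phi @^-1` `]a, b] = `[((b - d) / c)%R, ((a - d) / c)%R[%classic.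
      apply/seteqP; split => x /=; rewrite !in_itv/= /phi => /andP[].
        by rewrite ltr_ndivlMr// ler_ndivrMr// ltrBlDr lerBrDr (mulrC x) => -> ->.
      by rewrite ltr_ndivlMr// ler_ndivrMr// ltrBlDr lerBrDr (mulrC x) => -> ->.
    transitivity (`|c|%:E * (if ((b - d) / c < (a - d) / c)%R then
        ((a - d) / c - (b - d) / c)%R%:E else 0)); last by congr (_ * _); exact/esym/lebI.
    rewrite ltr_nM2r ?invr_lt0// ltrD2r.
    case: ifPn => _; last by rewrite mule0.
    rewrite -!EFinB -EFinM; congr EFin.
    rewrite -mulrBl mulrC (ltr0_norm cn) mulrN divfK// opprB.
    by ring.
have -> : \int[mu]_x f x = \int[m']_x f x.
  by apply: eq_measure_integral => A mA _; exact: mE.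
rewrite ge0_integral_mscale// -/phi ge0_integral_pushforward//=.
Qed.

Lemma ge0_integral_reflect01 (f : R -> \bar R) :
  measurable_fun [set: R] f -> (forall x, 0 <= f x) ->
  \int[mu]_(x in `]0%R, 1%R[) f (1 - x)%R = \int[mu]_(x in `]0%R, 1%R[) f x.
Proof.
move=> mf f0.
rewrite [RHS]integral_mkcond [LHS]integral_mkcond.
rewrite (@ge0_integral_affine (-1) 1 (f \_ _)).
- rewrite normrN1 mul1e; apply: eq_integral => x _.
  rewrite !patchE mulN1r addrC; congr (if _ then _ else _).
  by apply/idP/idP; rewrite !inE/= !in_itv/= => /andP[? ?]; apply/andP; split; lra.
- by rewrite oppr_eq0 oner_eq0.
- by apply/(measurable_restrictT _ _).1 => //; exact: measurable_funS mf.
- by move=> x; rewrite patchE; case: ifP.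
Qed.

Lemma ge0_integral_rescale01 (a b : R) (f : R -> \bar R) : (a < b)%R ->
  measurable_fun [set: R] f -> (forall x, 0 <= f x) ->
  \int[mu]_(x in `]a, b[) f x =
  (b - a)%:E * \int[mu]_(x in `]0%R, 1%R[) f ((b - a) * x + a)%R.
Proof.
move=> ab mf f0; have ba0 : (0 < b - a)%R by rewrite subr_gt0.
rewrite [LHS]integral_mkcond [in RHS]integral_mkcond.
rewrite (@ge0_integral_affine (b - a)%R a (f \_ _)).
- rewrite gtr0_norm//; congr (_ * _); apply: eq_integral => x _.
  rewrite !patchE; congr (if _ then _ else _).
  apply/idP/idP; rewrite !inE/= !in_itv/= => /andP[h1 h2]; apply/andP; split.
  + by rewrite ltrDr pmulr_rgt0 in h1.
  + by rewrite -(ltr_pM2l ba0) mulr1 -(ltrD2r a) subrK.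
  + by rewrite ltrDr pmulr_rgt0.
  + by rewrite -ltrBrDr gtr_pMr.
- by rewrite gt_eqF.
- by apply/(measurable_restrictT _ _).1 => //; exact: measurable_funS mf.
- by move=> x; rewrite patchE; case: ifP.
Qed.

End affine_change_of_variable.

(** * The beta integral with exponents summing to one *)

Section beta_integral.
Context {R : realType}.
Local Notation mu := (@lebesgue_measure R).
Variable al : R.
Hypothesis al01 : 0 < al < 1.

Definition beta_weight (x : R) : R := x `^ (- al) * (1 - x) `^ (al - 1).

Lemma beta_weight_ge0 x : 0 <= beta_weight x.
Proof. by rewrite mulr_ge0// powR_ge0. Qed.

Lemma measurable_powR_affine (p c d : R) :
  measurable_fun [set: R] (fun x => (c * x + d) `^ p).
Proof.
apply: (@measurableT_comp _ _ _ _ _ _ (fun x => x `^ p) _ (fun x => c * x + d)).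
  exact: measurable_powR.
by apply: measurable_funD => //; exact: measurable_funM.
Qed.

Lemma measurable_powR_sub (p c : R) :
  measurable_fun [set: R] (fun x => (c - x) `^ p).
Proof.
by under eq_fun do rewrite addrC -mulN1r; exact: measurable_powR_affine.
Qed.

Lemma measurable_beta_weight : measurable_fun [set: R] beta_weight.
Proof.
by apply: measurable_funM; [exact: measurable_powR|exact: measurable_powR_sub].
Qed.

Lemma is_derive_powR (p x : R) : 0 < x ->
  is_derive x 1 (fun y => y `^ p) (p * x `^ (p - 1)).
Proof.
move=> x0; have xI : x \in `]0, +oo[ by rewrite in_itv/= x0.
have <- := powR_derive1 p xI; rewrite derive1E.
by apply: derivableP; exact: derivable_powR.
Qed.

Lemma continuous_powR_gt0 (p x : R) : 0 < x ->
  {for x, continuous (fun y => y `^ p)}.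
Proof.
move=> x0; apply: differentiable_continuous; apply/derivable1_diffP.
by apply: derivable_powR; rewrite in_itv/= x0.
Qed.

Lemma within_continuous_integrable_oo (a b : R) (f : R -> R) :
  {within `[a, b], continuous f} -> mu.-integrable `]a, b[ (EFin \o f).
Proof.
move=> cf; have icc : mu.-integrable `[a, b] (EFin \o f).
  by apply: continuous_compact_integrable => //; exact: segment_compact.
apply: (integrableS _ _ _ icc) => //; exact: subset_itv_oo_cc.
Qed.

Lemma integrable_measurable (D : set R) (f : R -> R) :
  mu.-integrable D (EFin \o f) -> measurable_fun D f.
Proof. by move=> /(measurable_int mu) mf; apply/measurable_EFinP. Qed.

(** Monotone convergence along the intervals from [1 / (n + 1)] to [1], where the
    fundamental theorem of calculus applies. *)
Lemma integral_powR01_fin (p : R) : -1 < p ->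
  (\int[mu]_(x in `]0%R, 1%R[) (x `^ p)%:E < +oo)%E.
Proof.
move=> p1; have p10 : 0 < p + 1 by lra.
pose I n : set R := `]n.+1%:R^-1, 1%R[%classic.
have mI n : measurable (I n) by exact: measurable_itv.
have IU : `]0%R, 1%R[%classic = \bigcup_n I n.
  apply/seteqP; split => x /=.
    rewrite in_itv/= => /andP[x0 x1]; exists (Num.truncn x^-1) => //=.
    rewrite /I/= in_itv/= x1 andbT invf_plt ?posrE//.
    exact: truncnS_gt.
  move=> [n _]; rewrite /I/= !in_itv/= => /andP[nx x1]; rewrite x1 andbT.
  by rewrite (lt_trans _ nx).
have mf i : measurable_fun (I i) (fun x : R => (x `^ p)%:E).
  by apply/measurable_EFinP; apply: measurable_funTS; exact: measurable_powR.
have ndI : nondecreasing_seq I.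
  move=> m n mn; rewrite subsetEset => x; rewrite /I/= !in_itv/=.
  move=> /andP[h ->]; rewrite andbT (le_lt_trans _ h)//.
  by rewrite lef_pV2 ?posrE// ler_nat.
have bnd n : (\int[mu]_(x in I n) (x `^ p)%:E <= ((p + 1)^-1)%:E)%E.
  have [->|n0] := eqVneq n 0%N.
    by rewrite /I invr1 set_itv_ge ?bnd_simp// integral_set0 lee_fin invr_ge0 ltW.
  have n1 : n.+1%:R^-1 < 1 :> R by rewrite invf_lt1// ltr1n ltnS lt0n.
  have cpow q : {within `[n.+1%:R^-1, 1%R], continuous (fun x : R => x `^ q)}.
    move=> x; apply: continuous_in_subspaceT => y; rewrite inE/= in_itv/=.
    move=> /andP[y0 _]; apply: continuous_powR_gt0.
    by rewrite (lt_le_trans _ y0).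
  have ip := within_continuous_integrable_oo (cpow p).
  have := @FTC_exceptional R (fun x => (p + 1)^-1 * x `^ (p + 1)) (fun x => x `^ p)
    [::] _ _ n1 _ ip.
  rewrite /Rintegral => H.
  rewrite -(fineK (integrable_fin_num _ ip))// lee_fin H.
  - rewrite powR1 mulr1 gerBl mulr_ge0 ?powR_ge0// invr_ge0 ltW//.
  - move=> x; apply: continuous_in_subspaceT => y; rewrite inE/= in_itv/=.
    move=> /andP[y0 _]; apply: cvgM; first exact: cvg_cst.
    by apply: continuous_powR_gt0; rewrite (lt_le_trans _ y0).
  - move=> x /andP[x0 _] _; have {}x0 : 0 < x by rewrite (lt_trans _ x0).
    split; last exact: continuous_powR_gt0.
    have := @is_derive_powR (p + 1) x x0; rewrite addrK => dp.
    have -> : x `^ p = (p + 1)^-1 *: ((p + 1) * x `^ p).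
      by rewrite /GRing.scale/= mulKf// gt_eqF.
    exact: is_deriveZ.
rewrite IU; apply: (@le_lt_trans _ _ ((p + 1)^-1)%:E); last by rewrite ltry.
have cvgI : (\int[mu]_(x in I i) (x `^ p)%:E @[i --> \oo] -->
    \int[mu]_(x in \bigcup_i I i) (x `^ p)%:E)%E.
  apply: ge0_nondecreasing_set_cvg_integral => // i x _.
  by rewrite lee_fin powR_ge0.
rewrite -(cvg_lim _ cvgI)//; apply: lime_le.
  by apply/cvg_ex; eexists; exact: cvgI.
by apply: nearW.
Qed.

(** The beta function at [(1 - al, al)], that is [pi / sin (pi al)]. *)
Definition beta : \bar R := (\int[mu]_(x in `]0%R, 1%R[) (beta_weight x)%:E)%E.

Lemma beta_fin : (beta < +oo)%E.
Proof.
have mEF (D : set R) (f : R -> R) : measurable_fun [set: R] f ->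
    measurable_fun D (EFin \o f).
  by move=> mf; apply/measurable_EFinP; exact: measurable_funTS.
have m1 := @measurable_powR R (- al).
have m2 := measurable_powR_sub (al - 1) 1.
(* On each half of the interval one of the two factors is at most 2. *)
have leb x : x \in `]0%R, 1%R[ ->
    beta_weight x <= 2 * (x `^ (- al) + (1 - x) `^ (al - 1)).
  rewrite in_itv/= => /andP[x0 x1]; have /andP[al0 al1] := al01.
  have inv_le2 (y q : R) : 2^-1 <= y <= 1 -> -1 <= q <= 0 -> y `^ q <= 2.
    move=> /andP[y2 y1] /andP[q1 q0]; have y0 : 0 < y by lra.
    rewrite -(opprK q) powRN -[leRHS]invrK lef_pV2 ?posrE ?powR_gt0//.
    apply: (le_trans y2); apply: ger1_powR; [|lra].
    by rewrite y0 y1.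
  rewrite /beta_weight.
  have p1 := powR_ge0 x (- al); have p2 := powR_ge0 (1 - x) (al - 1).
  have [xh|xh] := leP x 2^-1.
    have := @inv_le2 (1 - x) (al - 1).
    have -> : 2^-1 <= 1 - x <= 1 by apply/andP; split; lra.
    have -> : -1 <= al - 1 <= 0 by apply/andP; split; lra.
    move=> /(_ erefl erefl) h; rewrite (le_trans (ler_wpM2l p1 h))//; lra.
  have := @inv_le2 x (- al).
  have -> : 2^-1 <= x <= 1 by apply/andP; split; lra.
  have -> : -1 <= - al <= 0 by apply/andP; split; lra.
  move=> /(_ erefl erefl) h; rewrite (le_trans (ler_wpM2r p2 h))//; lra.
apply: (@le_lt_trans _ _ (\int[mu]_(x in `]0%R, 1%R[)
    (2%:E * ((x `^ (- al))%:E + ((1 - x) `^ (al - 1))%:E)))%E).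
  apply: ge0_le_integral; first by [].
  - by move=> x _; rewrite lee_fin beta_weight_ge0.
  - exact: mEF measurable_beta_weight.
  - apply: measurable_funeM; apply: emeasurable_funD; exact: mEF.
  - by move=> x xI; rewrite -EFinD -EFinM lee_fin leb.
rewrite ge0_integralZl//; last 2 first.
- by apply: emeasurable_funD; exact: mEF.
- by move=> x _; rewrite -EFinD lee_fin addr_ge0// powR_ge0.
rewrite lte_mul_pinfty//.
rewrite ge0_integralD//; try by [exact: mEF|move=> x _; rewrite lee_fin powR_ge0].
have /andP[al0 al1] := al01.
apply: lte_add_pinfty; first by apply: integral_powR01_fin; lra.
rewrite (@ge0_integral_reflect01 R (fun x => (x `^ (al - 1))%:E)).
- by apply: integral_powR01_fin; lra.
- by apply/measurable_EFinP; exact: measurable_powR.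
- by move=> x; rewrite lee_fin powR_ge0.
Qed.

(** The arithmetic-geometric mean inequality: the product of the two weights does not
    depend on [al]. *)
Lemma beta_weight_symm_ge x : 0 < x < 1 ->
  2 / Num.sqrt (x * (1 - x)) <= beta_weight x + beta_weight (1 - x).
Proof.
move=> /andP[x0 x1]; have y0 : 0 < 1 - x by rewrite subr_gt0.
set p := beta_weight x; set q := beta_weight (1 - x).
have pq : p * q = (x * (1 - x))^-1.
  rewrite /p /q /beta_weight subKr mulrACA -!powRM ?ltW//.
  rewrite (mulrC (1 - x) x) -powRD; last first.
    by apply/implyP => _; rewrite mulf_neq0 ?gt_eqF.
  by rewrite addrA addNr add0r powR_inv1// mulr_ge0 ?ltW.
have p0 : 0 <= p by exact: beta_weight_ge0.
have q0 : 0 <= q by exact: beta_weight_ge0.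
have xy0 : 0 < x * (1 - x) by rewrite mulr_gt0.
rewrite -(@ler_pXn2r _ 2)// ?nnegrE ?addr_ge0 ?divr_ge0 ?sqrtr_ge0//.
rewrite expr_div_n (sqr_sqrtr (ltW xy0)) -pq.
by have := sqr_ge0 (p - q); nra.
Qed.

Lemma continuous_arcsine_density (x : R) : 0 < x < 1 ->
  {for x, continuous (fun z : R => (Num.sqrt (z * (1 - z)))^-1)}.
Proof.
move=> /andP[x0 x1]; have xx0 : 0 < x * (1 - x) by rewrite mulr_gt0 ?subr_gt0.
apply: continuousV; first by rewrite gt_eqF// sqrtr_gt0.
apply: (@continuous_comp _ _ _ (fun z : R => z * (1 - z)) Num.sqrt).
  by apply: continuousM => //; apply: continuousB => //; exact: cst_continuous.
exact: sqrt_continuous.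
Qed.

Lemma arcsine_density_integrable (c d : R) : 0 < c -> d < 1 ->
  mu.-integrable `]c, d[ (EFin \o (fun z : R => (Num.sqrt (z * (1 - z)))^-1)).
Proof.
move=> c0 d1.
apply: within_continuous_integrable_oo => x; apply: continuous_in_subspaceT => z.
rewrite inE/= in_itv/= => /andP[z0 z1]; apply: continuous_arcsine_density.
by apply/andP; split; lra.
Qed.

Lemma sin_lt1_acute (y : R) : 0 < y < pi / 2 -> 0 < sin y < 1.
Proof.
move=> /andP[y0 ypi].
have sy0 : 0 < sin y by apply: sin_gt0_pi; rewrite y0/=; have := pi_gt0 R; lra.
have cy0 : 0 < cos y by apply: cos_gt0_pihalf; rewrite ypi andbT; lra.
by rewrite sy0/=; have := cos2Dsin2 y; have := cy0; nra.
Qed.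

(** The end points stay away from 0 and 1, where the integrand is unbounded; the total
    mass [pi] is reached as [y] tends to [pi / 2]. *)
Lemma integral_arcsine (y : R) : 0 < y < pi / 2 ->
  \int[mu]_(x in `](1 - sin y) / 2, (1 + sin y) / 2[)
     (Num.sqrt (x * (1 - x)))^-1 = 2 * y.
Proof.
move=> yI; have /andP[y0 ypi] := yI; have /andP[sy0 sy1] := sin_lt1_acute yI.
have cd : (1 - sin y) / 2 < (1 + sin y) / 2 by lra.
have dasin (x : R) : 0 < x < 1 -> is_derive x 1 (fun z => asin (2 * z - 1))
    (Num.sqrt (x * (1 - x)))^-1.
  move=> /andP[x0 x1].
  have h : is_derive x 1 (fun z : R => 2 * z - 1) 2.
    by apply: is_derive_eq; rewrite /GRing.scale/=; ring.
  have xx : -1 < 2 * x - 1 < 1 by apply/andP; split; lra.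
  have := @is_derive1_comp R asin (fun z : R => 2 * z - 1) x _ _ (is_derive1_asin xx) h.
  move=> H; apply: is_derive_eq H _.
  have -> : 1 - (2 * x - 1) ^+ 2 = 2 ^+ 2 * (x * (1 - x)) by ring.
  by rewrite sqrtrM// sqrtr_sqr ger0_norm// invfM mulrAC mulVf// mul1r.
(* The primitive [asin (2 z - 1)] takes the values [y] and [- y] at the end points. *)
rewrite (@FTC_exceptional R (fun z => asin (2 * z - 1)) _ [::])//.
- have -> : 2 * ((1 + sin y) / 2) - 1 = sin y by field.
  have -> : 2 * ((1 - sin y) / 2) - 1 = sin (- y) by rewrite sinN; field.
  rewrite !sinK ?in_itv/=; try by apply/andP; split; lra.
  by ring.
- move=> x; apply: continuous_in_subspaceT => z; rewrite inE/= in_itv/= => /andP[z0 z1].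
  apply: differentiable_continuous; apply/derivable1_diffP.
  have z01 : 0 < z < 1 by apply/andP; split; lra.
  exact: (@ex_derive _ _ _ _ _ _ _ (dasin _ z01)).
- by apply: arcsine_density_integrable; lra.
- move=> x /andP[z0 z1] _; have x01 : 0 < x < 1 by apply/andP; split; lra.
  by split; [exact: dasin|exact: continuous_arcsine_density].
Qed.

(** Symmetrize the weight about [1 / 2] and bound it below by the arcsine density,
    whose total mass is [pi]. *)
Lemma beta_ge_pi : (pi%:E <= beta)%E.
Proof.
have bge0 : (0 <= beta)%E.
  by apply: integral_ge0 => x _; rewrite lee_fin beta_weight_ge0.
have bfin : beta \is a fin_num by rewrite ge0_fin_numE// beta_fin.
suff ley y : 0 < y < pi / 2 -> (2 * y <= fine beta).
  rewrite -(fineK bfin) lee_fin leNgt; apply/negP => bpi.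
  have b0 : 0 <= fine beta by rewrite fine_ge0.
  have := ley ((fine beta / 2 + pi / 2) / 2).
  have -> : 0 < (fine beta / 2 + pi / 2) / 2 < pi / 2 by apply/andP; split; lra.
  by move=> /(_ erefl); lra.
move=> yI; have /andP[y0 ypi] := yI.
have /andP[sy0 sy1] := sin_lt1_acute yI.
have mbr : measurable_fun [set: R] (fun x : R => (beta_weight (1 - x))%:E).
  apply/measurable_EFinP; apply: (measurableT_comp measurable_beta_weight).
  by apply: measurable_funB => //.
have mb : measurable_fun [set: R] (EFin \o beta_weight).
  by apply/measurable_EFinP; exact: measurable_beta_weight.
have refl : (\int[mu]_(x in `]0%R, 1%R[) (beta_weight (1 - x))%:E = beta)%E.
  by apply: (@ge0_integral_reflect01 R (EFin \o beta_weight)) => // x;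
    rewrite lee_fin beta_weight_ge0.
pose c := (1 - sin y) / 2; pose d := (1 + sin y) / 2.
have bb x : 0 <= beta_weight x + beta_weight (1 - x).
  by rewrite addr_ge0 ?beta_weight_ge0.
have sumE : (\int[mu]_(x in `]0%R, 1%R[)
    (beta_weight x + beta_weight (1 - x))%:E = 2%:E * beta)%E.
  under eq_integral do rewrite EFinD.
  have bw0 x : (0 <= (beta_weight x)%:E)%E by rewrite lee_fin beta_weight_ge0.
  rewrite ge0_integralD; [|by []|by []|exact: measurable_funTS|by []|exact: measurable_funTS].
  transitivity (beta + beta)%E; first exact: (f_equal2 adde erefl refl).
  by rewrite -(fineK bfin) -EFinD -EFinM; congr EFin; ring.
suff : (2%:E * (2 * y)%:E <= 2%:E * beta)%E.
  by rewrite -(fineK bfin) -!EFinM lee_fin; lra.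
rewrite -sumE -(integral_arcsine yI) -/c -/d.
have cdS x : x \in `]c, d[ -> 0 < x < 1.
  by rewrite in_itv/= /c /d => /andP[x0 x1]; apply/andP; split; lra.
have ifd : mu.-integrable `]c, d[ (EFin \o (fun z : R => (Num.sqrt (z * (1 - z)))^-1)).
  by apply: arcsine_density_integrable; rewrite /c /d; lra.
apply: (@le_trans _ _ (\int[mu]_(x in `]c, d[) (beta_weight x + beta_weight (1 - x))%:E)%E).
  rewrite /Rintegral fineK; last exact: integrable_fin_num ifd.
  rewrite -ge0_integralZl//; last exact: (measurable_int mu ifd).
  apply: ge0_le_integral; first by [].
  - by move=> x _; rewrite -EFinM lee_fin mulr_ge0// invr_ge0 sqrtr_ge0.
  - by apply: measurable_funeM; exact: (measurable_int mu ifd).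
  - apply/measurable_EFinP; apply: measurable_funD; apply: measurable_funTS;
      exact/measurable_EFinP.
  - move=> x xI; rewrite -EFinM lee_fin.
    by apply: beta_weight_symm_ge; exact: cdS.
apply: ge0_subset_integral => //.
- apply/measurable_EFinP; apply: measurable_funD; apply: measurable_funTS;
    exact/measurable_EFinP.
- by move=> x _; rewrite lee_fin.
Qed.

End beta_integral.

(** * The Abel kernel *)

Section fractional_kernel.
Context {R : realType}.
Local Notation mu := (@lebesgue_measure R).
Variable al : R.
Hypothesis al01 : 0 < al < 1.

Lemma is_derive_abel_kernel (tau s : R) : s < tau ->
  is_derive s 1 (fun x => (tau - x) `^ (- al)) (al * (tau - s) `^ (- al - 1)).
Proof.
move=> st; have ts0 : 0 < tau - s by rewrite subr_gt0.
have h : is_derive s 1 (fun x : R => tau - x) (-1).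
  by apply: is_derive_eq; ring.
have := @is_derive1_comp R (fun x => x `^ (- al)) (fun x => tau - x) s _ _
  (is_derive_powR (- al) ts0) h.
by move=> H; apply: is_derive_eq H _; ring.
Qed.

Lemma continuous_abel_kernel (p tau s : R) : s < tau ->
  {for s, continuous (fun x => (tau - x) `^ p)}.
Proof.
move=> st; apply: (@continuous_comp _ _ _ (fun x : R => tau - x) (fun x => x `^ p)).
  by apply: continuousB => //; exact: cst_continuous.
by apply: continuous_powR_gt0; rewrite subr_gt0.
Qed.

Lemma abel_kernel_le (tau c s : R) : c <= s < tau ->
  (tau - c) `^ (- al) <= (tau - s) `^ (- al).
Proof.
move=> /andP[cs st]; have /andP[al0 _] := al01.
rewrite !powRN lef_pV2 ?posrE ?powR_gt0 ?subr_gt0// ?(le_lt_trans cs)//.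
apply: ge0_ler_powR; rewrite ?nnegrE ?subr_ge0 ?lerB//; lra.
Qed.

(** Integrate by parts on the interval from [0] to [c], with [c] below [tau].  The kernel
    increases and [psi] is nonnegative, so all terms have a sign except the boundary
    term [k c * psi c].  As [psi tau = 0] and [k c <= k s] for [s] above [c], that term is at most
    the tail of the integral of [k * |dpsi|], which vanishes as [c] tends to [tau]. *)
Lemma abel_weighted_derivative_le0 (psi dpsi : R -> R) (E : seq R) (tau : R) :
  0 < tau ->
  {within `[0, tau], continuous psi} ->
  (forall s, 0 < s < tau -> s \notin E ->
     is_derive s 1 psi (dpsi s) /\ {for s, continuous dpsi}) ->
  mu.-integrable `]0, tau[ (fun s => ((tau - s) `^ (- al) * dpsi s)%:E) ->
  (forall s, 0 <= s <= tau -> 0 <= psi s) -> psi tau = 0 ->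
  \int[mu]_(s in `]0, tau[) ((tau - s) `^ (- al) * dpsi s) <= 0.
Proof.
move=> tau0 cpsi dpsiP ikd psi0 psitau.
have /andP[al0 al1] := al01.
pose k s := (tau - s) `^ (- al).
have k0 s : 0 <= k s by exact: powR_ge0.
pose g := fun s => (k s * dpsi s) .
have ig : mu.-integrable `]0, tau[ (EFin \o g) by exact: ikd.
pose g0 := g \_ `]0, tau[.
have ig0 : mu.-integrable setT (EFin \o g0).
  by rewrite /g0 -restrict_EFin; apply/(integrable_mkcond _ _).1.
have ign0 : mu.-integrable setT (EFin \o (Num.norm \o g0)) by exact: integrable_norm.
pose A := \int[mu]_(s in `[0, tau]) `|g0 s|.
pose H c := parameterized_integral mu 0 c (Num.norm \o g0).
have Hcvg : H c @[c --> tau^'-] --> A.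
  apply: parameterized_integral_cvg_at_left => //.
  exact: (integrableS _ _ _ ign0).
have g0E (I : set R) : I `<=` `]0, tau[ ->
    \int[mu]_(s in I) g0 s = \int[mu]_(s in I) g s.
  by move=> I0; apply: eq_Rintegral => s /set_mem /I0 sI; rewrite /g0 patchE mem_set.
have split0 c (h : R -> R) : 0 < c < tau -> mu.-integrable setT (EFin \o h) ->
   \int[mu]_(s in `[0, tau]) h s =
   \int[mu]_(s in `[0, c]) h s + \int[mu]_(s in `]c, tau]) h s.
  move=> /andP[c0 ct] ih.
  rewrite -[LHS](subrK (\int[mu]_(s in `[0, c]) h s)) addrC; congr (_ + _).
  apply: Rintegral_itvB; rewrite ?bnd_simp ?ltW//.
  exact: (integrableS _ _ _ ih).
have norm_g0_ge0 s : 0 <= `|g0 s| by [].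
pose Q c := \int[mu]_(s in `]c, tau[) `|g0 s|.
have intS (I : set R) (h : R -> R) : measurable I ->
    mu.-integrable setT (EFin \o h) -> mu.-integrable I (EFin \o h).
  by move=> mI ih; apply: (integrableS _ _ _ ih).
have AHQ c : 0 < c < tau -> A - H c = Q c.
  move=> cI; rewrite /A (split0 c)// /H /parameterized_integral addrAC subrr add0r.
  by rewrite -Rintegral_itv_bndo_bndc//; exact: intS.
have ocO c : 0 < c < tau -> `]c, tau[ `<=` `]0, tau[.
  by move=> /andP[c0 _] s /=; rewrite !in_itv/= => /andP[cs ->]; rewrite (lt_trans c0).
have ocL c : 0 < c < tau -> `]0, c[ `<=` `]0, tau[.
  by move=> /andP[_ ct] s /=; rewrite !in_itv/= => /andP[-> cs]; rewrite (lt_trans cs).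
have kpsi c : 0 < c < tau -> k c * psi c <= Q c.
  move=> cI; have /andP[c0 ct] := cI.
  have ig1 : mu.-integrable `]c, tau[ (EFin \o g).
    by apply: (integrableS _ _ _ ig) => //; exact: ocO.
  have mdpsi : measurable_fun `]c, tau[ dpsi.
    have : measurable_fun `]c, tau[ (fun s => (tau - s) `^ al * g s).
      apply: measurable_funM; last exact: integrable_measurable ig1.
      by apply: measurable_funTS; exact: measurable_powR_sub.
    apply: eq_measurable_fun => s; rewrite inE/= in_itv/= => /andP[_ st].
    have tp : 0 < (tau - s) `^ al by rewrite powR_gt0// subr_gt0.
    by rewrite /g /k powRN mulVKf// gt_eqF.
  have kdle s : c < s < tau -> k c * `|dpsi s| <= `|g s|.
    move=> /andP[cs st]; rewrite /g normrM (ger0_norm (k0 s)).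
    by rewrite ler_wpM2r// abel_kernel_le// (ltW cs).
  have kc0 : 0 < k c by rewrite powR_gt0// subr_gt0.
  have idpsi : mu.-integrable `]c, tau[ (EFin \o dpsi).
    apply: (@le_integrableR _ _ _ mu _ _ _ (fun s => (k c)^-1 * g s)) => //.
    - move=> s; rewrite /= in_itv/= => sI.
      rewrite normrM gtr0_norm ?invr_gt0// mulrC ler_pdivlMr// mulrC.
      exact: kdle.
    - exact: integrableRZl.
  have FT := @FTC_exceptional R psi dpsi E c tau ct.
  have psic : psi c = - \int[mu]_(s in `]c, tau[) dpsi s.
    rewrite FT//.
    - by rewrite psitau sub0r opprK.
    - apply: continuous_subspaceW cpsi => s /=; rewrite !in_itv/= => /andP[cs ->].
      by rewrite (le_trans (ltW c0)).
    - by move=> s /andP[cs st]; apply: dpsiP; rewrite st (lt_trans c0).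
  rewrite psic mulrN -RintegralZl//.
  apply: (le_trans (ler_norm _)); rewrite normrN.
  have ikdc : mu.-integrable `]c, tau[ (EFin \o (fun s => k c * dpsi s)).
    exact: integrableRZl.
  apply: (le_trans (le_normr_Rintegral _ _)) => //.
  apply: le_Rintegral => //.
  - exact: integrable_norm.
  - exact: intS.
  - move=> s /[dup] sI; rewrite /= in_itv/= => sI'.
    rewrite /g0 patchE mem_set; last by apply: (ocO _ cI).
    by rewrite normrM gtr0_norm// kdle.
have left c : 0 < c < tau -> \int[mu]_(s in `]0, c[) g0 s <= k c * psi c.
  move=> cI; have /andP[c0 ct] := cI.
  rewrite g0E; last exact: ocL.
  have ig1 : mu.-integrable `]0, c[ (EFin \o g).
    by apply: (integrableS _ _ _ ig) => //; exact: ocL.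
  have cpsi0 : {within `[0, c], continuous psi}.
    apply: continuous_subspaceW cpsi => s /=; rewrite !in_itv/= => /andP[-> sc].
    by rewrite (le_trans sc) ?ltW.
  have cker p : {within `[0, c], continuous (fun s => (tau - s) `^ p)}.
    apply: continuous_in_subspaceT => s; rewrite inE/= in_itv/= => /andP[_ sc].
    by apply: continuous_abel_kernel; rewrite (le_lt_trans sc).
  pose dk s := al * (tau - s) `^ (- al - 1).
  have cdk : {within `[0, c], continuous (fun s => dk s * psi s)}.
    move=> s; apply: cvgM; last exact: cpsi0.
    by apply: cvgM; [exact: cvg_cst|exact: cker].
  have idk := within_continuous_integrable_oo cdk.
  have isum : mu.-integrable `]0, c[ (EFin \o (fun s => dk s * psi s + g s)).
    exact: integrableRD.
  apply: (@le_trans _ _ (\int[mu]_(s in `]0, c[) (dk s * psi s + g s))).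
    apply: le_Rintegral => // s; rewrite /= in_itv/= => /andP[s0 sc].
    rewrite lerDr mulr_ge0//; last by rewrite psi0// (ltW s0) ltW// (lt_trans sc).
    by rewrite mulr_ge0 ?powR_ge0// ltW.
  rewrite (@FTC_exceptional R (fun s => k s * psi s) _ E 0 c)//.
  - by rewrite gerBl mulr_ge0// psi0// lexx ltW.
  - by move=> s; apply: cvgM; [exact: cker|exact: cpsi0].
  - move=> s /andP[s0 sc] sE; have st := lt_trans sc ct.
    have sI : 0 < s < tau by rewrite s0.
    have [dps cdps] := dpsiP s sI sE.
    split.
      have dk1 := is_derive_abel_kernel st.
      apply: is_derive_eq (is_deriveM dk1 dps) _.
      by rewrite /GRing.scale/= /dk /g /k; ring.
    apply: cvgD; apply: cvgM => //.
    + by apply: cvgM; [exact: cvg_cst|exact: continuous_abel_kernel].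
    + apply: differentiable_continuous; apply/derivable1_diffP.
      exact: (@ex_derive _ _ _ _ _ _ _ dps).
    + exact: continuous_abel_kernel.
have step c : 0 < c < tau -> \int[mu]_(s in `[0, tau]) g0 s <= 2 * (A - H c).
  move=> cI; have /andP[c0 ct] := cI.
  rewrite (split0 c)// AHQ// mulr2n mulrDl mul1r lerD//.
    rewrite -Rintegral_itv_obnd_cbnd; last exact: intS.
    rewrite -Rintegral_itv_bndo_bndc; last exact: intS.
    by rewrite (le_trans (left _ cI))// kpsi.
  rewrite -Rintegral_itv_bndo_bndc; last exact: intS.
  apply: (le_trans (ler_norm _)).
  by apply: le_normr_Rintegral => //; exact: intS.
have -> : \int[mu]_(s in `]0, tau[) ((tau - s) `^ (- al) * dpsi s) =
    \int[mu]_(s in `[0, tau]) g0 s.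
  rewrite -Rintegral_itv_obnd_cbnd; last exact: intS.
  rewrite -Rintegral_itv_bndo_bndc; last exact: intS.
  by rewrite g0E.
have cvg0 : 2 * (A - H c) @[c --> tau^'-] --> (0 : R).
  rewrite -(mulr0 2) -(subrr A).
  by apply: cvgM; [exact: cvg_cst|apply: cvgB; [exact: cvg_cst|exact: Hcvg]].
rewrite -[leRHS](cvg_lim (@Rhausdorff R) cvg0).
apply: limr_ge; first by apply/cvg_ex; exists 0.
near=> c; apply: step; apply/andP; split; last by near: c; exact: nbhs_left_lt.
by near: c; exact: nbhs_left_gt.
Unshelve. all: by end_near. Qed.

End fractional_kernel.

Section abel_inversion.
Context {R : realType}.
Local Notation mu := (@lebesgue_measure R).
Local Notation mR := (measurableTypeR R).
Variable al : R.
Hypothesis al01 : 0 < al < 1.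

(** The two exponents add up to [-1], so that rescaling to the unit interval leaves
    no trace of its length. *)
Lemma integral_abel_kernels (s t : R) : s < t ->
  (\int[mu]_(tau in `]s, t[) ((t - tau) `^ (al - 1) * (tau - s) `^ (- al))%:E
   = beta al)%E.
Proof.
move=> st; have ts0 : 0 < t - s by rewrite subr_gt0.
rewrite (@ge0_integral_rescale01 R s t
  (fun tau => ((t - tau) `^ (al - 1) * (tau - s) `^ (- al))%:E))//.
- transitivity ((t - s)%:E * (\int[mu]_(x in `]0%R, 1%R[)
      (((t - s)^-1)%:E * (beta_weight al x)%:E)))%E.
    congr (_ * _)%E; apply: eq_integral.
    move=> x; rewrite inE/= in_itv/= => /andP[x0 x1].
    rewrite -EFinM; congr EFin; rewrite /beta_weight addrK.
    have -> : t - ((t - s) * x + s) = (t - s) * (1 - x) by ring.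
    have x10 : 0 <= 1 - x by rewrite subr_ge0 ltW.
    rewrite (powRM _ (ltW ts0) x10) (powRM _ (ltW ts0) (ltW x0)).
    rewrite mulrACA -powRD; last by apply/implyP => _; rewrite gt_eqF.
    have -> : al - 1 + - al = -1 by ring.
    by rewrite powR_inv1 ?(ltW ts0)// [(1 - x) `^ _ * _]mulrC.
  rewrite ge0_integralZl//.
  + by rewrite muleA -EFinM divff ?gt_eqF// mul1e.
  + by apply/measurable_EFinP; apply: measurable_funTS; exact: measurable_beta_weight.
  + by move=> x _; rewrite lee_fin beta_weight_ge0.
  + by rewrite lee_fin invr_ge0 ltW.
- apply/measurable_EFinP; apply: measurable_funM; first exact: measurable_powR_sub.
  by under eq_fun do rewrite -[_ - s]/(_ + - s) -[X in X + - s]mul1r;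
    exact: measurable_powR_affine.
- by move=> x; rewrite lee_fin mulr_ge0 ?powR_ge0.
Qed.

(** Exchange the order of integration: the inner integral over [tau] is the one of
    [integral_abel_kernels], whatever [s]. *)
Lemma abel_inversion (db : R -> R) (t : R) : 0 < t ->
  mu.-integrable `]0, t[ (EFin \o db) ->
  (forall tau, 0 < tau < t ->
     mu.-integrable `]0, tau[ (fun s => ((tau - s) `^ (- al) * db s)%:E)) ->
  let J tau := \int[mu]_(s in `]0, tau[) ((tau - s) `^ (- al) * db s) in
  mu.-integrable `]0, t[ (fun tau => ((t - tau) `^ (al - 1) * J tau)%:E) /\
  (\int[mu]_(tau in `]0%R, t[) ((t - tau) `^ (al - 1) * J tau)%:E
   = beta al * (\int[mu]_(s in `]0%R, t[) db s)%:E)%E.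
Proof.
move=> t0 idb ikdb J.
have betafin : beta al \is a fin_num.
  by rewrite ge0_fin_numE ?beta_fin// integral_ge0// => x _; rewrite lee_fin beta_weight_ge0.
pose D : mR -> R := db \_ `]0, t[.
have iD : mu.-integrable setT (EFin \o D).
  by rewrite /D -restrict_EFin; apply/(integrable_mkcond _ _).1.
have mD : measurable_fun setT D by exact: integrable_measurable iD.
pose w (p : mR * mR) : R :=
  if (0 < p.2) && (p.2 < p.1) && (p.1 < t)
  then (t - p.1) `^ (al - 1) * (p.1 - p.2) `^ (- al) else 0.
have w0 p : 0 <= w p by rewrite /w; case: ifP => // _; rewrite mulr_ge0 ?powR_ge0.
have mfst : measurable_fun [set: mR * mR] (fun p : mR * mR => p.1 : R) := measurable_fst.
have msnd : measurable_fun [set: mR * mR] (fun p : mR * mR => p.2 : R) := measurable_snd.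
have mw : measurable_fun [set: mR * mR] w.
  apply: measurable_fun_ifT.
  - apply: measurable_and; [apply: measurable_and|];
      apply: measurable_fun_ltr => //.
  - apply: measurable_funM.
      exact: (measurableT_comp (measurable_powR_sub (al - 1) t) mfst).
    apply: (@measurableT_comp _ _ _ _ _ _ (fun x : R => x `^ (- al))).
      exact: measurable_powR.
    exact: measurable_funB.
  - by [].
pose F (p : mR * mR) : \bar R := (w p * D p.2)%:E.
have mF : measurable_fun [set: mR * mR] F.
  apply/measurable_EFinP; apply: measurable_funM => //.
  exact: (measurableT_comp mD measurable_snd).
have wint s : 0 < s < t -> (\int[mu]_tau (w (tau, s))%:E = beta al)%E.
  move=> /andP[s0 st]; rewrite -(integral_abel_kernels st) [RHS]integral_mkcond.
  apply: eq_integral => tau _; rewrite patchE /w/= s0/=.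
  rewrite (_ : (tau \in _) = (s < tau) && (tau < t)); last first.
    by apply/idP/idP; rewrite inE/= in_itv/=.
  by case: ifP.
have iw s : 0 < s < t -> mu.-integrable setT (fun tau : mR => (w (tau, s))%:E).
  move=> sI; apply/integrableP; split.
    apply/measurable_EFinP; apply: (measurableT_comp mw).
    exact: measurable_pair2.
  rewrite (_ : (\int[mu]_x `|(w (x, s))%:E|)%E = beta al); first exact: beta_fin.
  by rewrite -(wint _ sI); apply: eq_integral => x _; rewrite gee0_abs// lee_fin.
have Fint s (c : R) : 0 < s < t ->
    (\int[mu]_tau (w (tau, s) * c)%:E = beta al * c%:E)%E.
  move=> sI; under eq_integral do rewrite EFinM.
  by rewrite integralZr ?wint//; exact: iw.
have iF : (mu \x mu)%E.-integrable setT F.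
  apply/(@integrable21ltyP _ _ _ _ _ mu mu F mF).
  rewrite (_ : (\int[mu]_y \int[mu]_x `|F (x, y)|)%E = (\int[mu]_y (beta al * `|D y|%:E))%E).
    rewrite -(fineK betafin) integralZl//; last exact: (integrable_norm iD).
    move/integrableP : iD => [_ iD1].
    apply: lte_mul_pinfty; [|by []|exact: iD1].
    rewrite lee_fin fine_ge0//.
    by rewrite integral_ge0// => x _; rewrite lee_fin beta_weight_ge0.
  apply: eq_integral => s _.
  have [sI|sI] := boolP (0 < s < t).
    rewrite -(Fint s _ sI); apply: eq_integral => tau _.
    by rewrite /F abse_EFin normrM ger0_norm.
  have Ds : D s = 0 by rewrite /D patchE memNset//= in_itv/=; exact/negP.
  rewrite Ds normr0 mule0 integral0_eq// => tau _.
  by rewrite /F/= Ds mulr0 normr0.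
have innerF tau : (\int[mu]_s F (tau, s))%E =
    ((fun tau => ((t - tau) `^ (al - 1) * J tau)%:E) \_ `]0, t[) tau.
  rewrite patchE; case: ifPn; last first.
    rewrite notin_setE/= in_itv/= => tI; apply: integral0_eq => s _.
    rewrite /F /w/=; case: ifP; last by rewrite mul0r.
    by move=> /andP[/andP[s0 st] tt]; exfalso; apply: tI; rewrite tt (lt_trans s0).
  rewrite inE/= in_itv/= => tI; have /andP[tau0 taut] := tI.
  have ik := ikdb _ tI.
  rewrite /J EFinM /Rintegral fineK; last exact: integrable_fin_num ik.
  rewrite -integralZl// [RHS]integral_mkcond.
  apply: eq_integral => s _; rewrite /F /w /D !patchE/=.
  have [sI|sI] := boolP (s \in `]0, tau[%classic).
    have := sI; rewrite inE/= in_itv/= => /andP[s0 st].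
    rewrite s0 st taut/= mem_set; last by rewrite /= in_itv/= s0 (lt_trans st).
    by rewrite -EFinM; congr EFin; rewrite mulrA.
  case: ifP; last by rewrite mul0r.
  move=> /andP[/andP[s0 st] _]; exfalso; move: sI => /negP; apply.
  by rewrite inE/= in_itv/= s0.
have := integrable_fubini_F iF; rewrite /fubini_F.
under [X in mu.-integrable setT X]eq_fun do rewrite innerF.
move=> iJ; split; first by apply/(integrable_mkcond _ _).2.
rewrite integral_mkcond; under eq_integral do rewrite -innerF.
rewrite Fubini//.
have -> : (\int[mu]_y \int[mu]_x F (x, y) = \int[mu]_y (beta al * (D y)%:E))%E.
  apply: eq_integral => s _.
  have [sI|sI] := boolP (0 < s < t); first by rewrite -(Fint s _ sI).
  have Ds : D s = 0 by rewrite /D patchE memNset//= in_itv/=; exact/negP.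
  by rewrite Ds mule0; apply: integral0_eq => tau _; rewrite /F/= Ds mulr0.
rewrite -(fineK betafin) integralZl//; congr (_ * _)%E.
rewrite /Rintegral fineK; last exact: integrable_fin_num idb.
by rewrite [RHS]integral_mkcond; apply: eq_integral => s _; rewrite /D restrict_EFin.
Qed.

End abel_inversion.

(** * The space of square integrable functions *)

Section L2_space.
Context {R : realType} {d : nat} {Omega : set 'rV[R]_d}.
Local Notation mu := (@lebesgue_rV R d).
Local Notation fct := ('rV[R]_d -> R).
Implicit Types (v w f g : fct) (a : R).
Local Notation nm := (L2norm Omega).
Local Notation "'<| v , w |>" := (L2dot Omega v w).

Let one_le2 : (1 <= 2%:E :> \bar R)%E. Proof. by rewrite lee_fin ler1n. Qed.

Lemma L2P v : L2 Omega v <->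
  measurable_fun [set: 'rV[R]_d] (v \_ Omega) /\
  mu.-integrable setT (EFin \o (fun x => (v \_ Omega) x ^+ 2)).
Proof.
split=> [Lv|[mv iv]].
  split; last exact: Lfun2_integrable_sqr.
  by move: Lv; rewrite /L2 inE => /andP[/[!inE]].
rewrite /L2 inE; apply/andP; split; rewrite inE//=.
rewrite /finite_norm unlock poweR_lty//.
move/integrableP : iv => [_]; apply: le_lt_trans.
rewrite le_eqVlt; apply/orP; left; apply/eqP.
apply: eq_integral => x _ /=.
by rewrite powR_mulrn// normrX.
Qed.

Lemma L2_lincomb a v w : L2 Omega v -> L2 Omega w -> L2 Omega (a *: v + w).
Proof.
rewrite /L2 => Lv Lw.
have [_ cl] := @Lfun_submod_closed _ _ R mu 2%:E one_le2.
have -> : (a *: v + w) \_ Omega = a *: (v \_ Omega) + w \_ Omega.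
  apply/funext => x; rewrite !fctE/= !patchE; case: ifP => // _.
  by rewrite scaler0 addr0.
exact: cl.
Qed.

Lemma L2_0 : L2 Omega 0.
Proof.
have [c0 _] := @Lfun_submod_closed _ _ R mu 2%:E one_le2.
rewrite /L2 (_ : 0 \_ Omega = 0)//.
by apply/funext => x; rewrite patchE; case: ifP.
Qed.

Lemma L2D v w : L2 Omega v -> L2 Omega w -> L2 Omega (v + w).
Proof. by move=> Lv Lw; rewrite -[v]scale1r; exact: L2_lincomb. Qed.

Lemma L2Z a v : L2 Omega v -> L2 Omega (a *: v).
Proof. by move=> Lv; rewrite -[_ *: _]addr0; apply: L2_lincomb => //; exact: L2_0. Qed.

Lemma L2N v : L2 Omega v -> L2 Omega (- v).
Proof. by move=> Lv; rewrite -scaleN1r; exact: L2Z. Qed.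

Lemma L2B v w : L2 Omega v -> L2 Omega w -> L2 Omega (v - w).
Proof. by move=> Lv Lw; apply: L2D => //; exact: L2N. Qed.

End L2_space.

(** Square integrability is a side condition of nearly all lemmas on the inner product;
    it is discharged by linearity from the hypotheses in context. *)
Ltac L2_closure := repeat first
  [assumption | exact: L2_0 | apply: L2D | apply: L2Z | apply: L2N].
#[local] Hint Extern 0 (L2 _ _) => solve [L2_closure] : core.

Section L2_dot_norm.
Context {R : realType} {d : nat} {Omega : set 'rV[R]_d}.
Local Notation mu := (@lebesgue_rV R d).
Local Notation fct := ('rV[R]_d -> R).
Implicit Types (v w f g : fct) (a : R).
Local Notation nm := (L2norm Omega).
Local Notation "'<| v , w |>" := (L2dot Omega v w).

Lemma L2dot_mkcond v w : '<|v, w|> = \int[mu]_x ((v \_ Omega) x * (w \_ Omega) x).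
Proof.
rewrite /L2dot Rintegral_mkcond; apply: eq_Rintegral => x _.
by rewrite !patchE; case: ifP => // _; rewrite mul0r.
Qed.

Lemma L2dot_integrable v w : L2 Omega v -> L2 Omega w ->
  mu.-integrable setT (EFin \o (fun x => (v \_ Omega) x * (w \_ Omega) x)).
Proof. by move=> Lv Lw; exact/Lfun1_integrable/(Lfun2_mul_Lfun1 Lv Lw). Qed.

Lemma L2dotC v w : '<|v, w|> = '<|w, v|>.
Proof. by apply: eq_Rintegral => x _; rewrite mulrC. Qed.

Lemma L2dot_lincombl a v w g : L2 Omega v -> L2 Omega w -> L2 Omega g ->
  '<|a *: v + w, g|> = a * '<|v, g|> + '<|w, g|>.
Proof.
move=> Lv Lw Lg; rewrite !L2dot_mkcond -RintegralZl//; last exact: L2dot_integrable.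
rewrite -RintegralD//; last 2 first.
- by apply: integrableRZl => //; exact: L2dot_integrable.
- exact: L2dot_integrable.
apply: eq_Rintegral => x _; rewrite !patchE !fctE/=; case: ifP => _.
  by rewrite mulrDl -mulrA.
by rewrite !mul0r mulr0 addr0.
Qed.

Lemma L2dot0l g : '<|0, g|> = 0.
Proof.
rewrite /L2dot /Rintegral integral0_eq// => x _.
by rewrite (_ : (0 : fct) x = 0) ?mul0r.
Qed.

Lemma L2dotZl a v g : L2 Omega v -> L2 Omega g -> '<|a *: v, g|> = a * '<|v, g|>.
Proof.
move=> Lv Lg; rewrite -[a *: v]addr0 L2dot_lincombl ?L2dot0l ?addr0//.
Qed.

Lemma L2dotDl v w g : L2 Omega v -> L2 Omega w -> L2 Omega g ->
  '<|v + w, g|> = '<|v, g|> + '<|w, g|>.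
Proof. by move=> ? ? ?; rewrite -[v in LHS]scale1r L2dot_lincombl// mul1r. Qed.

Lemma L2dotBl v w g : L2 Omega v -> L2 Omega w -> L2 Omega g ->
  '<|v - w, g|> = '<|v, g|> - '<|w, g|>.
Proof.
by move=> ? ? ?; rewrite addrC -scaleN1r L2dot_lincombl// mulN1r addrC.
Qed.

Lemma L2dotZr a v g : L2 Omega v -> L2 Omega g -> '<|g, a *: v|> = a * '<|g, v|>.
Proof. by move=> ? ?; rewrite L2dotC L2dotZl// L2dotC. Qed.

Lemma L2dotDr v w g : L2 Omega v -> L2 Omega w -> L2 Omega g ->
  '<|g, v + w|> = '<|g, v|> + '<|g, w|>.
Proof. by move=> ? ? ?; rewrite L2dotC L2dotDl// !(L2dotC g). Qed.

Lemma L2dotBr v w g : L2 Omega v -> L2 Omega w -> L2 Omega g ->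
  '<|g, v - w|> = '<|g, v|> - '<|g, w|>.
Proof. by move=> ? ? ?; rewrite L2dotC L2dotBl// !(L2dotC g). Qed.

Lemma L2dot_ge0 v : 0 <= '<|v, v|>.
Proof. by apply: Rintegral_ge0 => x _; rewrite -expr2 sqr_ge0. Qed.

Lemma L2norm_ge0 v : 0 <= nm v.
Proof. by rewrite fine_ge0// Lnorm_ge0. Qed.

Lemma L2norm_sqr v : L2 Omega v -> nm v ^+ 2 = '<|v, v|>.
Proof.
move=> Lv; have Lfin : ('N[mu]_2%:E[EFin \o (v \_ Omega)] < +oo)%E.
  by move: Lv; rewrite /L2 inE => /andP[_ /[!inE]].
have := @powR_Lnorm _ _ R mu (EFin \o (v \_ Omega)) 2 (negbT (gt_eqF (ltr0n _ 2))).
have -> : 'N[mu]_2%:E[EFin \o (v \_ Omega)]%E = (nm v)%:E.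
  by rewrite /L2norm fineK// ge0_fin_numE// Lnorm_ge0.
rewrite poweR_EFin powR_mulrn ?L2norm_ge0// => h.
apply: EFin_inj; rewrite h L2dot_mkcond /Rintegral fineK; last first.
  exact: integrable_fin_num (L2dot_integrable Lv Lv).
by apply: eq_integral => x _ /=; rewrite powR_mulrn// -normrX ger0_norm ?sqr_ge0// expr2.
Qed.

Lemma L2norm_sqrt v : L2 Omega v -> nm v = Num.sqrt '<|v, v|>.
Proof. by move=> Lv; rewrite -L2norm_sqr// sqrtr_sqr ger0_norm// L2norm_ge0. Qed.

Lemma L2_cauchy_schwarz v w : L2 Omega v -> L2 Omega w ->
  `|'<|v, w|>| <= nm v * nm w.
Proof.
move=> Lv Lw.
have q (a b : R) : 0 <= a ^+ 2 * nm v ^+ 2 + 2 * a * b * '<|v, w|> + b ^+ 2 * nm w ^+ 2.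
  have := L2dot_ge0 (a *: v + b *: w).
  rewrite L2dot_lincombl//.
  by rewrite !L2norm_sqr// !L2dotDr// !L2dotZl// !L2dotZr// ?(L2dotC w v); lra.
have n0 := L2norm_ge0 v; have m0 := L2norm_ge0 w.
rewrite -(@ler_pXn2r _ 2) ?nnegrE ?mulr_ge0// real_normK ?num_real// exprMn.
(* The form [q] is nonnegative.  When [nm w = 0] it is affine in its second argument,
   which forces the coefficient of that argument to vanish; otherwise use the discriminant. *)
have [w0|w0] := eqVneq (nm w) 0.
  have dvw : '<|v, w|> = 0.
    apply/eqP; apply: contraT => dn.
    have := q 1 (- (nm v ^+ 2 + 1) / (2 * '<|v, w|>)).
    rewrite w0.
    have -> : 2 * 1 * (- (nm v ^+ 2 + 1) / (2 * '<|v, w|>)) * '<|v, w|> =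
      - (nm v ^+ 2 + 1) by field.
    by rewrite expr0n/= mulr0; lra.
  by rewrite dvw expr0n/= mulr_ge0 ?sqr_ge0.
have wp : 0 < nm w ^+ 2 by rewrite exprn_gt0// lt_def w0.
have := q (nm w ^+ 2) (- '<|v, w|>).
move: wp; set W := nm w ^+ 2; set V := nm v ^+ 2; set x := '<|v, w|>.
move=> W0 h.
rewrite -subr_ge0 -(pmulr_rge0 _ W0).
by have -> : W * (V * W - x ^+ 2) = W ^+ 2 * V + 2 * W * - x * x + (- x) ^+ 2 * W by ring.
Qed.

Lemma L2dot_norm0r v w : L2 Omega v -> L2 Omega w -> nm w = 0 -> '<|v, w|> = 0.
Proof.
move=> Lv Lw w0; apply/eqP; rewrite -normr_le0.
by rewrite (le_trans (L2_cauchy_schwarz Lv Lw))// w0 mulr0.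
Qed.

Lemma L2dot_norm0l v w : L2 Omega v -> L2 Omega w -> nm v = 0 -> '<|v, w|> = 0.
Proof. by move=> ? ? ?; rewrite L2dotC; exact: L2dot_norm0r. Qed.

Lemma L2norm_triangle v w : L2 Omega v -> L2 Omega w -> nm (v + w) <= nm v + nm w.
Proof.
move=> Lv Lw; rewrite -(@ler_pXn2r _ 2) ?nnegrE ?addr_ge0 ?L2norm_ge0//.
rewrite L2norm_sqr// L2dotDl// !L2dotDr// (L2dotC w v) -!L2norm_sqr//.
have := ler_norm '<|v, w|>; have := L2_cauchy_schwarz Lv Lw; nra.
Qed.

Lemma L2normZ a v : L2 Omega v -> nm (a *: v) = `|a| * nm v.
Proof.
move=> Lv; rewrite !L2norm_sqrt// L2dotZl// L2dotZr// mulrA -expr2.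
by rewrite sqrtrM ?sqr_ge0// sqrtr_sqr.
Qed.

Lemma L2normN v : L2 Omega v -> nm (- v) = nm v.
Proof. by move=> Lv; rewrite -scaleN1r L2normZ// normrN1 mul1r. Qed.

Lemma L2norm0 : nm 0 = 0.
Proof. by rewrite L2norm_sqrt ?L2dot0l ?sqrtr0//. Qed.

Lemma L2norm_distC v w : L2 Omega v -> L2 Omega w -> nm (v - w) = nm (w - v).
Proof. by move=> Lv Lw; rewrite -L2normN// opprB. Qed.

Lemma L2norm_triangleB v w g : L2 Omega v -> L2 Omega w -> L2 Omega g ->
  nm (v - w) <= nm (v - g) + nm (g - w).
Proof.
move=> Lv Lw Lg; have -> : v - w = (v - g) + (g - w) by rewrite addrA subrK.
by apply: L2norm_triangle.
Qed.

Lemma L2norm_eq0_trans v w : L2 Omega v -> L2 Omega w -> nm (v - w) = 0 -> nm v = nm w.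
Proof.
move=> Lv Lw vw0; apply/eqP; rewrite eq_le; apply/andP; split.
  by have := L2norm_triangle (L2B Lv Lw) Lw; rewrite subrK vw0 add0r.
have := L2norm_triangle (L2B Lw Lv) Lv.
by rewrite subrK L2norm_distC// vw0 add0r.
Qed.

End L2_dot_norm.

(** * The fractional energy estimate *)

Section lower_integral.
Local Open Scope ereal_scope.
Context d (T : measurableType d) (R : realType).
Variable mu : {measure set T -> \bar R}.

(** The integral of a nonnegative function is a supremum over the simple functions below
    it, hence is monotone whatever the measurability of the larger function.  This is
    the form needed for residuals that are not known to be measurable in time. *)
Lemma ge0_le_integral_minorant (D : set T) (f g : T -> \bar R) :
  (forall x, D x -> 0 <= f x) -> (forall x, D x -> f x <= g x) ->
  \int[mu]_(x in D) f x <= \int[mu]_(x in D) g x.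
Proof.
move=> f0 fg; have g0 x : D x -> 0 <= g x.
  by move=> Dx; rewrite (le_trans (f0 _ Dx))// fg.
rewrite ge0_integralE// [leRHS]ge0_integralE//; apply: ereal_sup_le => _ [h hf <-].
exists h => // x; apply: (le_trans (hf x)).
by rewrite !patchE; case: ifPn => // /set_mem; exact: fg.
Qed.

Lemma le_integral_minorant (D : set T) (f g : T -> \bar R) : measurable D ->
  mu.-integrable D f ->
  (forall x, D x -> 0 <= g x) -> (forall x, D x -> f x <= g x) ->
  \int[mu]_(x in D) f x <= \int[mu]_(x in D) g x.
Proof.
move=> mD intf g0 fg.
apply: (@le_trans _ _ (\int[mu]_(x in D) f^\+ x)).
  apply: le_integral => //; first exact: integrable_funepos.
  by move=> x _; rewrite funeposE le_max lexx.
apply: ge0_le_integral_minorant => x Dx; first exact: funepos_ge0.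
by rewrite funeposE ge_max fg// g0.
Qed.

End lower_integral.

Section continuous_off_finite.
Context {R : realType}.
Local Notation mu := (@lebesgue_measure R).

Lemma countable_measurable_fun (C : set R) (f : R -> R) :
  countable C -> measurable_fun C f.
Proof.
move=> cC mC B _; apply: countable_measurable => //.
exact: sub_countable (subset_card_le (@subIsetl _ _ _)) cC.
Qed.

Lemma measurable_fun_continuous_off (f : R -> R) (E : seq R) (a b : R) :
  (forall s, a < s < b -> s \notin E -> {for s, continuous f}) ->
  measurable_fun `]a, b[ f.
Proof.
move=> cf.
have fE : countable ([set` E] : set R).
  by apply: finite_set_countable; exact: finite_seq.
have mE : measurable ([set` E] : set R).
  by apply: countable_measurable.
have -> : `]a, b[%classic = (`]a, b[ `\` [set` E]) `|` (`]a, b[ `&` [set` E]).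
  by rewrite setUC setUIDK.
apply/measurable_funU; [exact: measurableD|exact: measurableI|split].
- apply: subspace_continuous_measurable_fun; first exact: measurableD.
  apply: continuous_in_subspaceT => s; rewrite inE => -[/= sI sE].
  by apply: cf; [move: sI; rewrite in_itv|exact/negP].
- apply: countable_measurable_fun.
  exact: sub_countable (subset_card_le (@subIsetr _ _ _)) fE.
Qed.

End continuous_off_finite.

Section energy.
Context {R : realType} {d : nat} {Omega : set 'rV[R]_d}.
Local Notation mu := (@lebesgue_measure R).
Local Notation fct := ('rV[R]_d -> R).
Local Notation nm := (L2norm Omega).
Local Notation "'<| v , w |>" := (L2dot Omega v w).
Local Notation L2 := (L2 Omega).

Lemma cvg_L2dot (T : Type) (F : set_system T) {FF : Filter F}
    (x_ y_ : T -> fct) (x y : fct) : L2 x -> L2 y ->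
  (\forall h \near F, L2 (x_ h) /\ L2 (y_ h)) ->
  nm (x_ h - x) @[h --> F] --> (0 : R) -> nm (y_ h - y) @[h --> F] --> (0 : R) ->
  '<|x_ h, y_ h|> @[h --> F] --> '<|x, y|>.
Proof.
move=> Lx Ly Lxy cx cy; apply/subr_cvg0; apply/norm_cvg0P.
have bnd : nm (x_ h - x) * nm (y_ h - y) + nm (x_ h - x) * nm y + nm x * nm (y_ h - y)
    @[h --> F] --> (0 : R).
  rewrite -[X in _ --> X](_ : 0 * 0 + 0 * nm y + nm x * 0 = 0); last by ring.
  by apply: cvgD; [apply: cvgD; apply: cvgM => //; exact: cvg_cst|
                   apply: cvgM => //; exact: cvg_cst].
apply: (squeeze_cvgr _ (cvg_cst 0) bnd).
near=> h; rewrite normr_ge0/=.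
have [Lxh Lyh] : L2 (x_ h) /\ L2 (y_ h) by near: h.
have -> : '<|x_ h, y_ h|> - '<|x, y|> =
   '<|x_ h - x, y_ h - y|> + '<|x_ h - x, y|> + '<|x, y_ h - y|>.
  by rewrite !L2dotBl// !L2dotBr//; ring.
rewrite (le_trans (ler_normD _ _))// lerD//; last exact: L2_cauchy_schwarz.
by rewrite (le_trans (ler_normD _ _))// lerD// L2_cauchy_schwarz.
Unshelve. all: by end_near. Qed.

Section paths.
Variables (rho : R -> fct) (a b : R).
Hypothesis Lrho : forall s, a <= s <= b -> L2 (rho s).
Hypothesis crho : Defs.norm_continuous nm `[a, b] rho.

Lemma cvg_path_within (s : R) : a <= s <= b ->
  nm (rho r - rho s) @[r --> within `[a, b] (nbhs s)] --> (0 : R).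
Proof. by move=> sI; apply: crho; rewrite /= in_itv. Qed.

Lemma cvg_path (s : R) : a < s < b -> nm (rho r - rho s) @[r --> s] --> (0 : R).
Proof.
move=> sI; have sI' : a <= s <= b by case/andP: sI => /ltW-> /ltW->.
have := cvg_path_within sI'; rewrite within_interior//.
suff : `]a, b[ `<=` interior `[a, b] by apply; rewrite /= in_itv.
by rewrite -open_subsetE; [exact: subset_itvW|exact: interval_open].
Qed.

Lemma cvg_shift_path (s : R) : a < s < b ->
  nm (rho (s + h) - rho s) @[h --> (0 : R)^'] --> (0 : R).
Proof.
move=> sI; apply: cvg_within_filter.
apply: (@cvg_comp _ _ _ (fun h => s + h) (fun r => nm (rho r - rho s)) _ (nbhs s)).
  have : s + h @[h --> (0 : R)] --> s + 0.
    by apply: cvgD; [exact: cvg_cst|exact: cvg_id].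
  by rewrite addr0.
exact: cvg_path.
Qed.

Lemma is_derive_quotient (f : R -> R) (s l : R) :
  h^-1 * (f (s + h) - f s) @[h --> (0 : R)^'] --> l -> is_derive s 1 f l.
Proof.
move=> cf.
have cf' : h^-1 *: ((f \o shift s) (h *: 1) - f s) @[h --> (0 : R)^'] --> l.
  by under eq_fun do rewrite /= /GRing.scale/= mulr1 (addrC _ s).
apply: DeriveDef; first by apply/cvg_ex; exists l.
exact: (cvg_lim (@Rhausdorff R) cf').
Qed.

Lemma near_shift_itv (s : R) : a < s < b -> \forall h \near (0 : R)^', a <= s + h <= b.
Proof.
move=> /andP[as_ sb]; apply: cvg_within; near=> h; apply/andP; split.
  rewrite addrC -lerBlDr; apply/ltW; near: h; apply: lt_nbhsr.
  by rewrite subr_lt0.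
rewrite addrC -lerBrDr; apply/ltW; near: h; apply: lt_nbhsl.
by rewrite subr_gt0.
Unshelve. all: by end_near. Qed.

Lemma norm_derive_dot (v g : fct) (s : R) : a < s < b -> L2 v -> L2 g ->
  norm_derive nm rho s v -> is_derive s 1 (fun r => '<|rho r, g|>) '<|v, g|>.
Proof.
move=> sI Lv Lg dv; have sI' : a <= s <= b by case/andP: sI => /ltW-> /ltW->.
have Ls := Lrho sI'; have nI := near_shift_itv sI.
apply: is_derive_quotient.
have : '<|h^-1 *: (rho (s + h) - rho s), g|> @[h --> (0 : R)^'] --> '<|v, g|>.
  apply: (cvg_L2dot Lv Lg _ dv); last by rewrite subrr L2norm0; exact: cvg_cst.
  near=> h; have Lh : L2 (rho (s + h)) by apply: Lrho; near: h.
  by split.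
apply: cvg_trans; apply: near_eq_cvg; near=> h.
have Lh : L2 (rho (s + h)) by apply: Lrho; near: h.
by rewrite L2dotZl// L2dotBl.
Unshelve. all: by end_near. Qed.

(** The difference quotient of the squared norm is the inner product of that of [rho]
    with the sum of the two values. *)
Lemma norm_derive_dot_self (v : fct) (s : R) : a < s < b -> L2 v ->
  norm_derive nm rho s v ->
  is_derive s 1 (fun r => '<|rho r, rho r|>) (2 * '<|v, rho s|>).
Proof.
move=> sI Lv dv; have sI' : a <= s <= b by case/andP: sI => /ltW-> /ltW->.
have Ls := Lrho sI'; have nI := near_shift_itv sI.
apply: is_derive_quotient.
have : '<|h^-1 *: (rho (s + h) - rho s), rho (s + h) + rho s|> @[h --> (0 : R)^']
    --> '<|v, rho s + rho s|>.
  apply: (cvg_L2dot Lv _ _ dv) => //.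
    near=> h; have Lh : L2 (rho (s + h)) by apply: Lrho; near: h.
    by split.
  under eq_fun do rewrite opprD addrACA subrr addr0.
  exact: cvg_shift_path.
have -> : 2 * '<|v, rho s|> = '<|v, rho s + rho s|> by rewrite L2dotDr//; ring.
apply: cvg_trans; apply: near_eq_cvg; near=> h.
have Lh : L2 (rho (s + h)) by apply: Lrho; near: h.
rewrite L2dotZl// L2dotBl// !L2dotDr// (L2dotC (rho s) (rho (s + h))).
by congr (_ * _); ring.
Unshelve. all: by end_near. Qed.

Lemma within_continuous_dot_self :
  {within `[a, b], continuous (fun r => '<|rho r, rho r|>)}.
Proof.
apply/subspace_continuousP => s /=; rewrite in_itv/= => sI.
have Ls := Lrho sI.
apply: cvg_L2dot => //; try exact: cvg_path_within.
rewrite near_withinE; apply: nearW => r; rewrite /= in_itv/= => rI.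
by have Lr := Lrho rI.
Unshelve. all: by end_near. Qed.

Lemma within_continuous_dot (g : fct) : L2 g ->
  {within `[a, b], continuous (fun r => '<|rho r, g|>)}.
Proof.
move=> Lg; apply/subspace_continuousP => s /=; rewrite in_itv/= => sI.
have Ls := Lrho sI.
apply: cvg_L2dot => //; try exact: cvg_path_within.
  rewrite near_withinE; apply: nearW => r; rewrite /= in_itv/= => rI.
  by have Lr := Lrho rI.
by rewrite subrr L2norm0; exact: cvg_cst.
Unshelve. all: by end_near. Qed.

End paths.
End energy.

Section energy_inequality.
Context {R : realType} {d : nat} {Omega : set 'rV[R]_d}.
Local Notation mu := (@lebesgue_measure R).
Local Notation fct := ('rV[R]_d -> R).
Local Notation nm := (L2norm Omega).
Local Notation "'<| v , w |>" := (L2dot Omega v w).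
Local Notation L2 := (L2 Omega).

Variables (al Gam : R) (rho drho : R -> fct) (E : seq R) (t : R) (G : R -> R).
Hypothesis al01 : 0 < al < 1.
Hypothesis Gam0 : 0 < Gam.
Hypothesis t0 : 0 < t.
Hypothesis Lrho : forall s, 0 <= s <= t -> L2 (rho s).
Hypothesis crho : Defs.norm_continuous nm `[0, t] rho.
Hypothesis Ldrho : forall s, 0 < s < t -> L2 (drho s).
Hypothesis drhoP : forall s, 0 < s < t -> s \notin E ->
  norm_derive nm rho s (drho s).
Hypothesis cdrho : forall s, 0 < s < t -> s \notin E ->
  nm (drho r - drho s) @[r --> s] --> (0 : R).
Hypothesis ikdrho : forall tau, 0 < tau <= t ->
  mu.-integrable `]0, tau[ (fun s => ((tau - s) `^ (- al) * nm (drho s))%:E).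
Hypothesis G0 : forall tau, 0 < tau < t -> 0 <= G tau.
(** The error equation tested with the error itself. *)
Hypothesis key : forall tau, 0 < tau < t ->
  Gam^-1 * (\int[mu]_(s in `]0, tau[) ((tau - s) `^ (- al) * '<|drho s, rho tau|>))
  <= G tau * nm (rho tau).

(** The norm is not differentiable at the origin; its regularization [b] is. *)
Section regularized.
Variable eps : R.
Hypothesis eps0 : 0 < eps.

Let b s := Num.sqrt (eps ^+ 2 + '<|rho s, rho s|>).
Let db s := '<|drho s, rho s|> / b s.

Let N_ge0 s : 0 < eps ^+ 2 + '<|rho s, rho s|>.
Proof. by rewrite ltr_wpDr ?L2dot_ge0// exprn_gt0. Qed.

Let b_gt0 s : 0 < b s. Proof. by rewrite sqrtr_gt0. Qed.

Let b_sqr s : b s ^+ 2 = eps ^+ 2 + '<|rho s, rho s|>.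
Proof. by rewrite sqr_sqrtr// ltW. Qed.

Let itvW s : 0 < s < t -> 0 <= s <= t.
Proof. by case/andP => /ltW-> /ltW->. Qed.

Let nm_le_b s : 0 <= s <= t -> nm (rho s) <= b s.
Proof.
move=> sI; have Ls := Lrho sI.
rewrite -(@ler_pXn2r _ 2) ?nnegrE ?L2norm_ge0 ?(ltW (b_gt0 s))//.
by rewrite b_sqr L2norm_sqr// lerDr sqr_ge0.
Qed.

Let is_derive_b s : 0 < s < t -> s \notin E -> is_derive s 1 b (db s).
Proof.
move=> sI sE.
have dN : is_derive s 1 (fun r => eps ^+ 2 + '<|rho r, rho r|>) (2 * '<|drho s, rho s|>).
  rewrite -[X in is_derive _ _ _ X]add0r; apply: is_deriveD.
  exact: (norm_derive_dot_self Lrho crho sI (Ldrho sI) (drhoP sI sE)).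
have := @is_derive1_comp R Num.sqrt (fun r => eps ^+ 2 + '<|rho r, rho r|>) s _ _
  (is_derive1_sqrt (N_ge0 s)) dN.
move=> H; apply: is_derive_eq H _; rewrite /db -/(b s).
by field; rewrite gt_eqF.
Qed.

Let within_continuous_b : {within `[0, t], continuous b}.
Proof.
apply/subspace_continuousP => s sI; rewrite /b.
apply: (@cvg_comp _ _ _ (fun r => eps ^+ 2 + '<|rho r, rho r|>) Num.sqrt
  _ (nbhs (eps ^+ 2 + '<|rho s, rho s|>))); last exact: sqrt_continuous.
apply: cvgD; first exact: cvg_cst.
by have /subspace_continuousP := within_continuous_dot_self Lrho crho; apply.
Qed.

Let near_L2rho s : 0 < s < t -> \forall r \near s, L2 (rho r) /\ L2 (drho r).
Proof.
move=> /andP[s0 st]; near=> r.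
have rI : 0 < r < t.
  by apply/andP; split; near: r; [exact: lt_nbhsr|exact: lt_nbhsl].
by split; [exact: Lrho (itvW rI)|exact: Ldrho].
Unshelve. all: by end_near. Qed.

Let continuous_drho_dot g s : L2 g -> 0 < s < t -> s \notin E ->
  {for s, continuous (fun r => '<|drho r, g|>)}.
Proof.
move=> Lg sI sE; apply: cvg_L2dot => //; try exact: Ldrho.
- by apply: filterS (near_L2rho sI) => r [].
- exact: cdrho.
- by rewrite subrr L2norm0; exact: cvg_cst.
Qed.

Let continuous_db s : 0 < s < t -> s \notin E -> {for s, continuous db}.
Proof.
move=> sI sE; apply: cvgM.
  apply: cvg_L2dot; [exact: Ldrho|exact: Lrho (itvW sI)| |exact: cdrho|].
  - by apply: filterS (near_L2rho sI) => r [].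
  - exact: (cvg_path crho).
apply: cvgV; first by rewrite gt_eqF.
apply: differentiable_continuous; apply/derivable1_diffP.
exact: (@ex_derive _ _ _ _ _ _ _ (is_derive_b sI sE)).
Qed.

Let measurable_db : measurable_fun `]0, t[ db.
Proof. exact: measurable_fun_continuous_off continuous_db. Qed.

Let db_le s : 0 < s < t -> `|db s| <= nm (drho s).
Proof.
move=> sI; rewrite /db normrM normfV (gtr0_norm (b_gt0 s)) ler_pdivrMr//.
apply: (le_trans (L2_cauchy_schwarz (Ldrho sI) (Lrho (itvW sI)))).
by rewrite ler_wpM2l ?L2norm_ge0// nm_le_b// itvW.
Qed.

Let subI tau : 0 < tau <= t -> `]0, tau[ `<=` `]0, t[.
Proof.
by move=> /andP[_ tt] s /=; rewrite !in_itv/= => /andP[-> st]; rewrite (lt_le_trans st).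
Qed.

Let integrable_kernel (h : R -> R) (c tau : R) : 0 < tau <= t ->
  measurable_fun `]0, t[ h ->
  (forall s, 0 < s < t -> `|h s| <= c * nm (drho s)) ->
  mu.-integrable `]0, tau[ (fun s => ((tau - s) `^ (- al) * h s)%:E).
Proof.
move=> tI mh hle.
apply: (@le_integrableR _ _ _ mu _ _ (fun s => (tau - s) `^ (- al) * h s)
   (fun s => c * ((tau - s) `^ (- al) * nm (drho s)))) => //.
- apply: measurable_funM.
    by apply: measurable_funTS; exact: measurable_powR_sub.
  by apply: measurable_funS mh => //; exact: subI.
- move=> s sI; have {}sI : 0 < s < t by have := subI tI sI; rewrite /= in_itv.
  rewrite !normrM (ger0_norm (powR_ge0 _ _)) mulrCA ler_wpM2l ?powR_ge0//.
  apply: (le_trans (hle _ sI)); apply: (le_trans (ler_norm _)).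
  by rewrite normrM.
- by apply: integrableRZl => //; exact: ikdrho.
Qed.

Let integrable_db : mu.-integrable `]0, t[ (EFin \o db).
Proof.
have tt : 0 < t <= t by rewrite t0 lexx.
apply: (@le_integrableR _ _ _ mu _ _ _
   (fun s => t `^ al * ((t - s) `^ (- al) * nm (drho s)))) => //.
- move=> s; rewrite /= in_itv/= => sI; apply: (le_trans (db_le sI)).
  apply: le_trans (ler_norm _); rewrite mulrA ler_peMl ?L2norm_ge0//.
  have := @abel_kernel_le R al al01 t 0 s; rewrite subr0.
  have -> : 0 <= s < t by case/andP: sI => /ltW -> ->.
  move=> /(_ erefl); rewrite [t `^ - al]powRN.
  have tp : 0 < t `^ al by rewrite powR_gt0.
  by rewrite -(ler_pM2l tp) mulfV ?gt_eqF.
- by apply: integrableRZl => //; exact: ikdrho.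
Qed.

Let J tau := \int[mu]_(s in `]0, tau[) ((tau - s) `^ (- al) * db s).

(** The fractional derivative of [b] is bounded by that of [rho] tested with [rho / b],
    which the hypothesis [key] controls. *)
Let J_le tau : 0 < tau < t -> Gam^-1 * J tau <= G tau.
Proof.
move=> tI; have [tau0 taut] := andP tI.
have tI' : 0 < tau <= t by rewrite tau0 ltW.
have Lt := Lrho (itvW tI).
(* The gap between [b] and its tangent at [rho tau]; it is nonnegative by convexity. *)
pose psi s := b s - b tau - (b tau)^-1 * ('<|rho s, rho tau|> - '<|rho tau, rho tau|>).
pose h s := '<|drho s, rho tau|>.
pose dpsi s := db s - (b tau)^-1 * h s.
have subs s : 0 < s < tau -> 0 < s < t.
  by move=> /andP[-> st]; rewrite (lt_trans st).
have mh : measurable_fun `]0, t[ h.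
  by apply: (@measurable_fun_continuous_off _ _ E) => s sI sE; exact: continuous_drho_dot.
have ikdb : mu.-integrable `]0, tau[ (fun s => ((tau - s) `^ (- al) * db s)%:E).
  by apply: (@integrable_kernel db 1) => // s sI; rewrite mul1r db_le.
have ikh : mu.-integrable `]0, tau[ (fun s => ((tau - s) `^ (- al) * h s)%:E).
  apply: (@integrable_kernel h (nm (rho tau))) => // s sI.
  by rewrite mulrC; apply: L2_cauchy_schwarz => //; exact: Ldrho.
have ikbh : mu.-integrable `]0, tau[
    (EFin \o (fun s => (b tau)^-1 * ((tau - s) `^ (- al) * h s))).
  exact: integrableRZl.
have kE s : (tau - s) `^ (- al) * dpsi s =
    (tau - s) `^ (- al) * db s - (b tau)^-1 * ((tau - s) `^ (- al) * h s).
  by rewrite /dpsi; ring.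
have := @abel_weighted_derivative_le0 R al al01 psi dpsi E tau tau0.
have -> : \int[mu]_(s in `]0, tau[) ((tau - s) `^ (- al) * dpsi s) =
    J tau - (b tau)^-1 * \int[mu]_(s in `]0, tau[) ((tau - s) `^ (- al) * h s).
  under eq_Rintegral do rewrite kE.
  by rewrite RintegralB// RintegralZl.
move=> S1; have {}S1 : J tau - (b tau)^-1 *
    \int[mu]_(s in `]0, tau[) ((tau - s) `^ (- al) * h s) <= 0.
  apply: S1.
  - have cS (f : R -> R) : {within `[0, t], continuous f} -> {within `[0, tau], continuous f}.
      apply: continuous_subspaceW => s /=; rewrite !in_itv/= => /andP[-> st].
      by rewrite (le_trans st)// ltW.
    have cb := cS _ within_continuous_b.
    have cd := cS _ (within_continuous_dot Lrho crho Lt).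
    move=> s; apply: cvgB; first by apply: cvgB; [exact: cb|exact: cvg_cst].
    apply: cvgM; first exact: cvg_cst.
    by apply: cvgB; [exact: cd|exact: cvg_cst].
  - move=> s /subs sI sE; split; last first.
      apply: cvgB; first exact: continuous_db.
      by apply: cvgM; [exact: cvg_cst|exact: continuous_drho_dot].
    have d1 := is_derive_b sI sE.
    have d2 := norm_derive_dot Lrho sI (Ldrho sI) Lt (drhoP sI sE).
    have d3 : is_derive s 1 (fun s => (b tau)^-1 * ('<|rho s, rho tau|> - '<|rho tau, rho tau|>))
        ((b tau)^-1 * h s).
      have d4 : is_derive s 1 (fun s => '<|rho s, rho tau|> - '<|rho tau, rho tau|>) (h s).
        by rewrite -[h s]subr0; apply: is_deriveB.
      exact: is_deriveZ.
    have d5 : is_derive s 1 (fun s => b s - b tau) (db s).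
      by rewrite -[db s]subr0; apply: is_deriveB.
    exact: is_deriveB.
  - have := @integrableRB _ _ _ mu _ (measurable_itv `]0, tau[)
      (fun s => (tau - s) `^ (- al) * db s) _ ikdb ikbh.
    by apply: eq_integrable => // s _; rewrite /= kE.
  - move=> s sI; have {}sI : 0 <= s <= t.
      by case/andP: sI => -> st; rewrite (le_trans st)// ltW.
    have Ls := Lrho sI.
    suff : eps ^+ 2 + '<|rho s, rho tau|> <= b s * b tau.
      move=> le; have -> : psi s = (b tau)^-1 * (b s * b tau - (eps ^+ 2 + '<|rho s, rho tau|>)).
        rewrite /psi.
        have -> : '<|rho tau, rho tau|> = b tau ^+ 2 - eps ^+ 2 by rewrite b_sqr; ring.
        by field; rewrite gt_eqF.
      by rewrite mulr_ge0 ?invr_ge0 ?subr_ge0// ltW.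
    apply: (@le_trans _ _ (eps ^+ 2 + nm (rho s) * nm (rho tau))).
      by rewrite lerD2l (le_trans (ler_norm _))// L2_cauchy_schwarz.
    rewrite -(@ler_pXn2r _ 2) ?nnegrE ?addr_ge0 ?mulr_ge0 ?L2norm_ge0 ?sqr_ge0 ?(ltW (b_gt0 _)) ?(ltW eps0)//.
    rewrite exprMn !b_sqr -!L2norm_sqr//.
    have := sqr_ge0 (eps * (nm (rho s) - nm (rho tau))); nra.
  - by rewrite /psi subrr sub0r subrr mulr0 oppr0.
have K := key tI; rewrite -/h in K.
have Gi : 0 < Gam^-1 by rewrite invr_gt0.
have {}S1 := ler_wpM2l (ltW Gi) S1; rewrite mulr0 mulrBr mulrCA subr_le0 in S1.
apply: (le_trans S1).
rewrite mulrC ler_pdivrMr//; apply: (le_trans K).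
by rewrite ler_wpM2l ?G0// nm_le_b// itvW.
Qed.

(** Integrate the bound [J_le] on the fractional derivative of [b] against the
    conjugate kernel. *)
Lemma regularized_energy_estimate :
  (((Gam^-1 * (b t - b 0))%:E * beta al) <=
    \int[mu]_(tau in `]0%R, t[) ((t - tau) `^ (al - 1) * G tau)%:E)%E.
Proof.
have ikdb tau : 0 < tau < t ->
    mu.-integrable `]0, tau[ (fun s => ((tau - s) `^ (- al) * db s)%:E).
  move=> /andP[tau0 taut]; apply: (@integrable_kernel db 1) => //.
    by rewrite tau0 ltW.
  by move=> s sI; rewrite mul1r db_le.
have [iJ eJ] := abel_inversion al01 t0 integrable_db ikdb.
have FT : \int[mu]_(s in `]0, t[) db s = b t - b 0.
  apply: (@FTC_exceptional R b db E) => // s sI sE.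
  by split; [exact: is_derive_b|exact: continuous_db].
rewrite FT in eJ.
rewrite EFinM -muleA [X in (_ * X)%E]muleC -eJ -integralZl//.
apply: le_integral_minorant => //.
- exact: integrableZl.
- move=> tau; rewrite /= in_itv/= => tI.
  by rewrite lee_fin mulr_ge0 ?powR_ge0// G0.
- move=> tau; rewrite /= in_itv/= => tI.
  rewrite -EFinM lee_fin mulrCA ler_wpM2l ?powR_ge0//; exact: J_le.
Qed.

End regularized.

Theorem fractional_energy_estimate :
  ((nm (rho t))%:E <= (nm (rho 0))%:E + (Gam / pi)%:E *
    \int[mu]_(tau in `]0%R, t[) ((t - tau) `^ (al - 1) * G tau)%:E)%E.
Proof.
set I := (\int[mu]_(tau in _) _)%E.
have I0 : (0 <= I)%E.
  apply: integral_ge0 => tau; rewrite /= in_itv/= => tI.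
  by rewrite lee_fin mulr_ge0 ?powR_ge0// G0.
have tt : 0 <= t <= t by rewrite lexx ltW.
have t00 : 0 <= (0 : R) <= t by rewrite lexx ltW.
have Gp0 : 0 < Gam / pi by rewrite divr_gt0// pi_gt0.
have [->|Iy] := eqVneq I +oo%E.
  by rewrite gt0_muley ?lte_fin// addey// leey.
have Ifin : I \is a fin_num by rewrite ge0_fin_numE// ltey.
rewrite -(fineK Ifin) -EFinM -EFinD lee_fin; apply/ler_addgt0Pr => eps eps0.
have := regularized_energy_estimate eps0; rewrite -/I.
set bt := Num.sqrt _; set b0 := Num.sqrt _ => est.
have lebt : nm (rho t) <= bt.
  have Lt := Lrho tt.
  by rewrite L2norm_sqrt// ler_wsqrtr// lerDr sqr_ge0.
have leb0 : b0 <= nm (rho 0) + eps.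
  rewrite -(@ler_pXn2r _ 2) ?nnegrE ?sqrtr_ge0 ?addr_ge0 ?L2norm_ge0 ?(ltW eps0)//.
  rewrite sqr_sqrtr ?addr_ge0 ?sqr_ge0 ?L2dot_ge0// -L2norm_sqr; last exact: Lrho.
  have := L2norm_ge0 (Omega := Omega) (rho 0); nra.
suff : bt - b0 <= Gam / pi * fine I by lra.
have fI0 : 0 <= fine I by rewrite fine_ge0.
have [bneg|bpos] := leP (bt - b0) 0.
  by rewrite (le_trans bneg)// mulr_ge0// ltW.
have : ((Gam^-1 * (bt - b0))%:E * pi%:E <= I)%E.
  apply: le_trans est; apply: lee_wpmul2l; last exact: beta_ge_pi.
  by rewrite lee_fin mulr_ge0 ?invr_ge0// ltW.
rewrite -(fineK Ifin) -EFinM lee_fin => h.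
have pp := pi_gt0 R.
have := ler_wpM2l (ltW Gp0) h.
have -> // : Gam / pi * (Gam^-1 * (bt - b0) * pi) = bt - b0.
have pn : pi != 0 :> R by rewrite gt_eqF.
by rewrite -mulrA [pi^-1 * _]mulrC mulfK// mulVKf// gt_eqF.
Qed.

End energy_inequality.

(** * Lebesgue measure on row vectors *)

Section rV_topology.
Context {R : realType} {d : nat}.
Implicit Types (x y : 'rV[R]_d) (U : set 'rV[R]_d).
Local Notation mu := (@lebesgue_rV R d).

Lemma rV_norm_le x (M : R) : 0 <= M -> (`|x| <= M) = [forall i, `|x ord0 i| <= M].
Proof.
move=> M0; rewrite [X in X <= _](mx_normrE x).
apply/idP/forallP => [|h]; first move=> h i.
  apply: le_trans h; exact: (@le_bigmax _ _ _ 0 (fun ij : 'I_1 * 'I_d => `|x ij.1 ij.2|) (ord0, i)).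
by apply/bigmax_leP; split=> //= -[i j] _ /=; rewrite ord1 h.
Qed.

Lemma rV_norm_lt x (M : R) : 0 < M -> (`|x| < M) = [forall i, `|x ord0 i| < M].
Proof.
move=> M0; rewrite [X in X < _](mx_normrE x).
apply/idP/forallP => [|h]; first move=> h i.
  apply: le_lt_trans h; exact: (@le_bigmax _ _ _ 0 (fun ij : 'I_1 * 'I_d => `|x ij.1 ij.2|) (ord0, i)).
by apply/bigmax_ltP; split=> //= -[i j] _ /=; rewrite ord1 h.
Qed.

Lemma rV_coord_le x i : `|x ord0 i| <= `|x|.
Proof. by have := rV_norm_le x (normr_ge0 x); rewrite lexx => /esym/forallP. Qed.

Lemma measurable_rV_coord_preimage (i : 'I_d) (B : set R) :
  measurable B -> measurable [set x : 'rV[R]_d | B (x ord0 i)].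
Proof.
by move=> mB; rewrite -[X in measurable X]setTI; exact: measurable_rV_coord.
Qed.

Definition open_box (q r : 'I_d -> R) : set 'rV[R]_d :=
  [set x | forall i, q i < x ord0 i < r i].

Lemma measurable_open_box q r : measurable (open_box q r).
Proof.
have -> : open_box q r =
    \bigcap_(i in [set: 'I_d]) [set x : 'rV[R]_d | `]q i, r i[%classic (x ord0 i)].
  apply/seteqP; split => [x xb i _ /=|x xb i]; first by rewrite in_itv/=; exact: xb.
  by have := xb i I; rewrite /= in_itv.
apply: fin_bigcap_measurable => // i _; apply: measurable_rV_coord_preimage.
exact: measurable_itv.
Qed.

(** Boxes with rational corners form a countable basis of the topology. *)
Lemma measurable_open_rV U : open U -> measurable U.
Proof.
move=> oU.
pose b (p : {ffun 'I_d -> rat} * {ffun 'I_d -> rat}) :=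
  open_box (fun i => ratr (p.1 i)) (fun i => ratr (p.2 i)).
have -> : U = \bigcup_p (if `[< b p `<=` U >] then b p else set0).
  apply/seteqP; split=> [x Ux|x [p _]]; last by case: asboolP => // /[apply].
  have /nbhs_ballP[e /= e0 eU] := open_nbhs_nbhs (conj oU Ux).
  have /fin_all_exists[q hq] : forall i, exists q : rat,
      ratr q \in `]x ord0 i - e, x ord0 i[.
    by move=> i; apply: rat_in_itvoo; rewrite ltrBlDr ltrDl.
  have /fin_all_exists[r hr] : forall i, exists q : rat,
      ratr q \in `]x ord0 i, x ord0 i + e[.
    by move=> i; apply: rat_in_itvoo; rewrite ltrDl.
  exists ([ffun i => q i], [ffun i => r i]) => //; case: asboolP => [_|[]].
    by move=> i /=; rewrite !ffunE; move: (hq i) (hr i); rewrite !in_itv/= => /andP[_ ->] /andP[].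
  move=> y yb; apply: eU; rewrite mx_norm_ball /ball_/= rV_norm_lt//.
  apply/forallP => i; rewrite !mxE.
  move: (yb i) (hq i) (hr i); rewrite !in_itv/= !ffunE ltr_distlC.
  by move=> /andP[h1 h2] /andP[h3 h4] /andP[h5 h6]; apply/andP; split; lra.
apply: countable_bigcupT_measurable => [|p]; first exact: countableP.
by case: asboolP => // _; exact: measurable_open_box.
Qed.

Lemma measurable_closed_rV U : closed U -> measurable U.
Proof.
move=> cU; rewrite -[U]setCK; apply: measurableC.
by apply: measurable_open_rV; exact: closed_openC.
Qed.

Lemma continuous_at_measurable_rV U (f : 'rV[R]_d -> R) : open U ->
  (forall x, U x -> {for x, continuous f}) -> measurable_fun U f.
Proof.
move=> oU cf; apply: (measurability _ (RGenOpens.measurableE R)).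
move=> _ [_ [a [b ->]] <-]; apply: measurable_open_rV.
rewrite openE => x [Ux fx]; apply: filterI; first exact: open_nbhs_nbhs.
by apply: (cf x Ux); apply: open_nbhs_nbhs; split=> //; exact: interval_open.
Qed.

Lemma continuous_measurable_rV (f : 'rV[R]_d -> R) : continuous f ->
  measurable_fun setT f.
Proof. by move=> cf; apply: (@continuous_at_measurable_rV setT) => [|x _]; [exact: openT|exact: cf]. Qed.

End rV_topology.

Section rV_tonelli.
Context {R : realType}.
Local Notation mu1 := (@lebesgue_measure R).
Local Notation mu d := (@lebesgue_rV R d).
Local Open Scope ereal_scope.

Lemma rV_unconsK d : cancel (@rV_uncons R d) (@rV_cons R d).
Proof.
move=> x; apply/rowP => i; rewrite /rV_cons/= !mxE.
case: splitP => [[[]//= ?] ij|j ij].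
  by rewrite mxE; congr (x ord0 _); apply/val_inj; rewrite /= ij.
by rewrite mxE; congr (x ord0 _); apply/val_inj; rewrite /= ij.
Qed.

Lemma rV_consD d (p q : R * 'rV[R]_d) :
  (rV_cons p + rV_cons q)%R = rV_cons (p.1 + q.1, p.2 + q.2)%R.
Proof.
by apply/rowP => i; rewrite /rV_cons !mxE/=; case: splitP => j _; rewrite !mxE.
Qed.

Lemma ge0_integral_rV_cons d (f : 'rV[R]_d.+1 -> \bar R) :
  measurable_fun setT f -> (forall x, 0 <= f x) ->
  \int[mu d.+1]_x f x = \int[(mu1 \x mu d)%E]_p f (rV_cons p).
Proof.
move=> mf f0.
rewrite -[LHS]/(\int[pushforward (mu1 \x mu d)%E (@rV_cons R d)]_x f x).
rewrite ge0_integral_pushforward//; first exact: measurable_rV_cons.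
Qed.

Lemma measurable_comp_rV_cons d (f : 'rV[R]_d.+1 -> \bar R) :
  measurable_fun setT f -> measurable_fun setT (f \o @rV_cons R d).
Proof. by move=> mf; apply: measurableT_comp => //; exact: measurable_rV_cons. Qed.

Lemma tonelli_rV d (f : 'rV[R]_d.+1 -> \bar R) :
  measurable_fun setT f -> (forall x, 0 <= f x) ->
  \int[mu d.+1]_x f x = \int[mu1]_a \int[mu d]_y f (rV_cons (a, y)).
Proof.
move=> mf f0; rewrite ge0_integral_rV_cons//.
by rewrite (fubini_tonelli1 (f \o @rV_cons R d)) => [|/=|p /=]//; exact: measurable_comp_rV_cons.
Qed.

Lemma tonelli_rV_sym d (f : 'rV[R]_d.+1 -> \bar R) :
  measurable_fun setT f -> (forall x, 0 <= f x) ->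
  \int[mu d.+1]_x f x = \int[mu d]_y \int[mu1]_a f (rV_cons (a, y)).
Proof.
move=> mf f0; rewrite ge0_integral_rV_cons//.
by rewrite (fubini_tonelli2 (f \o @rV_cons R d)) => [|/=|p /=]//; exact: measurable_comp_rV_cons.
Qed.

Lemma measurable_rV_translation d (v : 'rV[R]_d) :
  measurable_fun [set: 'rV[R]_d] (fun x => x + v)%R.
Proof.
apply: measurable_fun_rVP => i.
rewrite [X in measurable_fun _ X](_ : _ = (fun x => rV_coord i x + v ord0 i)%R).
  by apply: measurable_funD => //; exact: measurable_rV_coord.
by apply/funext => x; rewrite /rV_coord /= mxE.
Qed.

(** Induction on the dimension, by Tonelli. *)
Lemma ge0_integral_rV_translation d (v : 'rV[R]_d) (f : 'rV[R]_d -> \bar R) :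
  measurable_fun setT f -> (forall x, 0 <= f x) ->
  \int[mu d]_x f (x + v)%R = \int[mu d]_x f x.
Proof.
elim: d v f => [|d IH] v f mf f0.
  by apply: eq_integral => x _; congr f; apply/rowP => -[].
have mfv : measurable_fun [set: 'rV[R]_d.+1] (fun x => f (x + v)%R).
  by apply: (measurableT_comp mf); exact: measurable_rV_translation.
rewrite (tonelli_rV mfv (fun x => f0 _)) (tonelli_rV mf f0).
have mF : measurable_fun setT (fun a => \int[mu d]_y f (rV_cons (a, y))).
  apply: (measurable_fun_fubini_tonelli_F (f \o @rV_cons R d)) => //.
    exact: measurable_comp_rV_cons.
  by move=> x /=; exact: f0.
pose p := rV_uncons v.
transitivity (\int[mu1]_a \int[mu d]_y f (rV_cons (1 * a + p.1, y))%R).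
  apply: eq_integral => a _.
  rewrite -[RHS](IH p.2)//; last first.
    exact: (measurableT_comp (measurable_comp_rV_cons mf)).
  apply: eq_integral => y _; rewrite -[v in LHS]rV_unconsK rV_consD /=.
  by rewrite mul1r.
rewrite [RHS](@ge0_integral_affine R 1 p.1)//.
- by rewrite normr1 mul1e.
- by move=> a; exact: integral_ge0.
Qed.

Lemma integral_rV_translation d (v : 'rV[R]_d) (f : 'rV[R]_d -> \bar R) :
  measurable_fun setT f ->
  \int[mu d]_x f (x + v)%R = \int[mu d]_x f x.
Proof.
move=> mf; rewrite integralE [RHS]integralE; congr (_ - _).
- rewrite -[RHS](ge0_integral_rV_translation v (measurable_funepos mf))//.
  by apply: eq_integral => x _; rewrite !funeposE.
- rewrite -[RHS](ge0_integral_rV_translation v (measurable_funeneg mf))//.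
  by apply: eq_integral => x _; rewrite !funenegE.
Qed.

Lemma lebesgue_rV_open_box d (q r : 'I_d -> R) :
  mu d (open_box q r) < +oo /\
  ((forall i, (q i < r i)%R) -> 0 < mu d (open_box q r)).
Proof.
elim: d q r => [|d IH] q r.
  split; first by rewrite /= diracE; exact: ltry.
  move=> _; rewrite /= diracE (_ : 0%R \in _)//.
  by rewrite inE => -[].
pose q' i := q (lift ord0 i); pose r' i := r (lift ord0 i).
have -> : mu d.+1 (open_box q r) =
    lebesgue_measure `]q ord0, r ord0[%classic * mu d (open_box q' r').
  rewrite -(product_measure1E mu1 (mu d) (measurable_itv _) (measurable_open_box _ _)).
  rewrite -[LHS]/((mu1 \x mu d)%E (@rV_cons R d @^-1` open_box q r)).
  congr ((mu1 \x mu d)%E _); apply/seteqP; split => -[a y] /=.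
  - move=> h; split => /=.
      have := h ord0; rewrite in_itv/=; suff -> : rV_cons (a, y) ord0 ord0 = a by [].
      by have /(congr1 fst) := @rV_consK R d (a, y).
    move=> i; have := h (lift ord0 i).
    by have /(congr1 snd)/rowP/(_ i) := @rV_consK R d (a, y); rewrite mxE/= => ->.
  - move=> [/=]; rewrite in_itv/= => ha hy i.
    case: (unliftP ord0 i) => [j ->|->].
      have := hy j.
      by have /(congr1 snd)/rowP/(_ j) := @rV_consK R d (a, y); rewrite mxE/= => ->.
    suff -> : rV_cons (a, y) ord0 ord0 = a by [].
    by have /(congr1 fst) := @rV_consK R d (a, y).
have [fin pos] := IH q' r'.
rewrite lebesgue_measure_itv/= lte_fin; split.
  case: ifP => [qr|_]; last by rewrite mul0e ltry.
  by rewrite -EFinD; apply: lte_mul_pinfty => //; rewrite lee_fin subr_ge0; exact: ltW.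
move=> qr; rewrite (qr ord0) mule_gt0//; first by rewrite -EFinD lte_fin subr_gt0.
by apply: pos => i; exact: qr.
Qed.

End rV_tonelli.

Section bounded_support.
Context {R : realType} {d : nat}.
Local Notation mu := (@lebesgue_rV R d).
Local Notation fct := ('rV[R]_d -> R).
Implicit Types (h G : fct) (x : 'rV[R]_d).

Local Notation unit_vec i := (delta_mx ord0 i : 'rV[R]_d).

Lemma norm_delta_le (i : 'I_d) (a : R) : `|a *: unit_vec i| <= `|a|.
Proof.
rewrite rV_norm_le//; apply/forallP => j; rewrite !mxE/= normrM.
by case: eqP => _; rewrite ?normr1 ?mulr1// normr0 mulr0.
Qed.

Definition rV_ball_box (r : R) : set 'rV[R]_d :=
  open_box (fun=> - (`|r| + 1)) (fun=> `|r| + 1).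

Lemma sub_rV_ball_box r x : `|x| <= r -> rV_ball_box r x.
Proof.
move=> xr i; have := le_trans (le_trans (rV_coord_le x i) xr) (ler_norm r).
by rewrite ler_norml => /andP[? ?]; apply/andP; split; lra.
Qed.

Lemma integrable_bounded_on_box h (M r : R) : measurable_fun setT h ->
  (forall x, rV_ball_box r x -> `|h x| <= M) ->
  mu.-integrable setT (EFin \o (h \_ (rV_ball_box r))).
Proof.
move=> mh hM; rewrite -restrict_EFin.
apply/(integrable_mkcond _ (measurable_open_box _ _)).
apply: measurable_bounded_integrable.
- exact: measurable_open_box.
- by have [] := @lebesgue_rV_open_box R d (fun=> - (`|r| + 1)) (fun=> `|r| + 1).
- exact: measurable_funS mh.
- exists M; split; first exact: num_real.
  by move=> N MN x /= /hM /le_trans; apply; exact: ltW.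
Qed.

Lemma integrable_bounded_support h (M r : R) : measurable_fun setT h ->
  (forall x, `|h x| <= M) -> (forall x, r < `|x| -> h x = 0) ->
  mu.-integrable setT (EFin \o h).
Proof.
move=> mh hM hr.
rewrite (_ : h = h \_ (rV_ball_box r)); first exact: integrable_bounded_on_box.
apply/funext => x; rewrite patchE; case: ifPn => // /negP xB.
by apply: hr; rewrite ltNge; apply/negP => /sub_rV_ball_box xr; apply: xB; rewrite inE.
Qed.

Lemma L2_bounded (Omega : set 'rV[R]_d) (v : fct) (M : R) : bounded_set Omega ->
  measurable_fun setT (v \_ Omega) -> (forall x, Omega x -> `|v x| <= M) ->
  L2 Omega v.
Proof.
move=> [r [_ rO]] mv vM; apply/L2P; split=> //.
apply: (@integrable_bounded_support _ (M ^+ 2) (r + 1)).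
- exact: measurable_funX.
- move=> x; rewrite normrX !patchE; case: ifPn => [|_].
    by rewrite inE => /vM vx; rewrite lerXn2r ?nnegrE//; exact: le_trans vx.
  by rewrite normr0 expr0n/= sqr_ge0.
- move=> x rx; rewrite patchE; case: ifPn => [|_]; last by rewrite expr0n.
  rewrite inE => Ox; have := rO (r + 1) _ x Ox; rewrite ltrDl ltr01 => /(_ isT) /=.
  by rewrite leNgt rx.
Qed.

(** The difference quotients of [h] have mean zero by translation invariance, and
    converge to its derivative boundedly. *)
Lemma integral_partial_eq0 (i : 'I_d) h G (N : set 'rV[R]_d) (L M r : R) :
  measurable_fun setT h -> measurable_fun setT G ->
  (forall x, `|h x| <= M) -> (forall x, r < `|x| -> h x = 0) ->
  (forall x (a : R), `|h (x + a *: unit_vec i) - h x| <= L * `|a|) ->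
  mu.-negligible N ->
  (forall x, ~ N x -> is_derive x (unit_vec i) h (G x)) ->
  mu.-integrable setT (EFin \o G) /\ \int[mu]_x (G x) = 0.
Proof.
move=> mh mG hM hr hL N0 dh.
have L0 : 0 <= L.
  by have := le_trans (normr_ge0 _) (hL 0 1); rewrite normr1 mulr1.
pose a k : R := (@harmonic R) k.
have a0 k : 0 < a k := harmonic_gt0 k.
pose q k x := (a k)^-1 * (h (x + a k *: unit_vec i) - h x).
have mhs k : measurable_fun [set: 'rV[R]_d] (fun x => h (x + a k *: unit_vec i)).
  by apply: (measurableT_comp mh); exact: measurable_rV_translation.
have mq k : measurable_fun setT (q k).
  by apply: measurable_funM => //; exact: measurable_funB.
have ih : mu.-integrable setT (EFin \o h) by exact: integrable_bounded_support hM hr.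
have ihs k : mu.-integrable setT (fun x => (h (x + a k *: unit_vec i))%:E).
  apply: (@integrable_bounded_support _ M (r + a k)) => // x rx; apply: hr.
  have := lerB_normD x (a k *: unit_vec i); apply: lt_le_trans.
  rewrite ltrBrDr; apply: le_lt_trans rx; rewrite lerD2l.
  by apply: le_trans (norm_delta_le _ _) _; rewrite gtr0_norm.
have Iq k : (\int[mu]_x (q k x)%:E = 0)%E.
  under eq_integral do rewrite /q EFinM.
  rewrite (@integralZl _ _ _ mu _ measurableT (fun x => (h (x + a k *: unit_vec i) - h x)%:E)); last first.
    by under [X in integrable _ _ X]eq_fun do rewrite EFinB; exact: integrableB.
  under eq_integral do rewrite EFinB.
  rewrite integralB//.
  have -> : (\int[mu]_x (h (x + a k *: unit_vec i))%:E = \int[mu]_x (h x)%:E)%E.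
    apply: (@integral_rV_translation R d (a k *: unit_vec i) (EFin \o h)).
    exact/measurable_EFinP.
  by rewrite subee ?mule0//; exact: integrable_fin_num.
have rest0 k x : ~ rV_ball_box (r + 1) x -> q k x = 0.
  move=> xB; rewrite /q !hr ?subrr ?mulr0//.
    by rewrite ltNge; apply/negP => xr; apply/xB/sub_rV_ball_box; lra.
  have := lerB_normD x (a k *: unit_vec i); apply: lt_le_trans.
  have ak1 : a k <= 1 by rewrite /a/= invf_le1 ?ler1n ?ltr0n.
  have := norm_delta_le i (a k); rewrite gtr0_norm// => e1.
  by rewrite ltNge; apply/negP => xr; apply/xB/sub_rV_ball_box; lra.
have qL k x : `|q k x| <= L.
  rewrite normrM gtr0_norm ?invr_gt0// ler_pdivrMl// mulrC.
  by apply: le_trans (hL _ _) _; rewrite gtr0_norm.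
have := @dominated_convergence _ _ _ mu setT measurableT (fun k x => (q k x)%:E)
  (EFin \o G) (EFin \o ((fun=> L) \_ (rV_ball_box (r + 1)))).
case.
- by move=> k; exact/measurable_EFinP.
- exact/measurable_EFinP.
- apply: negligibleS N0 => x; apply: contra_notP => nN _.
  apply: cvg_EFin; first exact: nearW.
  have [d1 d2] := dh x nN; rewrite -d2.
  have /cvgr_dnbhsP/(_ a) c := d1.
  have {}c := c (conj (fun k => lt0r_neq0 (a0 k)) cvg_harmonic).
  rewrite (_ : _ \o _ = (fun n => (a n)^-1 *: ((h \o shift x) (a n *: unit_vec i) - h x)))//.
  by apply/funext => k; rewrite [RHS]/(_ *: _)/= /q /shift [_ + x]addrC.
- exact: integrable_bounded_on_box.
- apply: aeW => x k _; rewrite lee_fin patchE; case: ifPn => [_|]; first exact: qL.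
  by move/negP; rewrite inE => /(rest0 k) ->; rewrite normr0.
move=> iG _ cG; split=> //.
rewrite /Rintegral.
have /cvg_lim <- // := cG.
rewrite (_ : [sequence _]_n = (fun=> 0)%E) ?lim_cst//.
by apply/funext => k /=; exact: Iq.
Qed.

End bounded_support.

(** * Test functions and weak gradients *)

Section test_functions.
Context {R : realType} {d : nat}.
Local Notation mu := (@lebesgue_rV R d).
Local Notation fct := ('rV[R]_d -> R).
Implicit Types (f g h : fct) (x : 'rV[R]_d) (Omega : set 'rV[R]_d).
Local Notation unit_vec i := (delta_mx ord0 i : 'rV[R]_d).

Lemma is_derive_lineE f x v (a df : R) :
  is_derive (a *: v + x) v f df <-> is_derive a 1 (fun s : R => f (s *: v + x)) df.
Proof.
have E : (fun h : R => h^-1 *: ((f \o shift (a *: v + x)) (h *: v) - f (a *: v + x))) =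
    (fun h : R => h^-1 *: (((fun s : R => f (s *: v + x)) \o shift a) (h *: 1) - f (a *: v + x))).
  by apply/funext => h /=; rewrite /shift addrA -scalerDl [h *: 1]mulr1.
split => -[d1 d2].
- by split; [move: d1; rewrite /derivable E|move: d2; rewrite /derive E].
- by split; [move: d1; rewrite /derivable -E|move: d2; rewrite /derive -E].
Qed.

Lemma partial_bounded_lipschitz f (i : 'I_d) (M : R) :
  (forall x, derivable f x (unit_vec i)) -> (forall x, `|partial i f x| <= M) ->
  forall x (a : R), `|f (x + a *: unit_vec i) - f x| <= M * `|a|.
Proof.
move=> df fM.
have pos x (a : R) : 0 <= a -> `|f (x + a *: unit_vec i) - f x| <= M * `|a|.
  move=> a0; pose F s := f (s *: unit_vec i + x).
  have dF (s : R) : is_derive s (1 : R) F (partial i f (s *: unit_vec i + x)).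
    by apply/is_derive_lineE; exact/derivableP.
  have [|c _] := @MVT_segment R F (fun s => partial i f (s *: unit_vec i + x)) 0 a a0.
  - by apply: derivable_within_continuous => s _; have [] := dF s.
  - rewrite /F scale0r add0r [_ *: _ + x]addrC subr0 => ->.
    by rewrite normrM ler_wpM2r.
move=> x a; have [|a0] := leP 0 a; first exact: pos.
have := pos (x + a *: unit_vec i) (- a).
rewrite -addrA -scalerDl subrr scale0r addr0 normrN distrC; apply.
by rewrite oppr_ge0 ltW.
Qed.

Section fixed_domain.
Variable Omega : set 'rV[R]_d.
Local Notation test := (test_function Omega).

Lemma foldr_partial_lincomb f g (a : R) (s : seq 'I_d) :
  smooth_on setT f -> smooth_on setT g ->
  foldr (@partial R d) (a *: f + g) s = a *: foldr (@partial R d) f s + foldr (@partial R d) g s.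
Proof.
move=> sf sg; elim: s => [//|i s IH] /=; rewrite IH; apply/funext => x.
have [_ df] := sf s x I; have [_ dg] := sg s x I.
rewrite /partial deriveD//; last exact: derivableZ.
by rewrite deriveZ.
Qed.

Lemma test_function_lincomb f g (a : R) : test f -> test g -> test (a *: f + g).
Proof.
move=> [sf [K [cK KO f0]]] [sg [L [cL LO g0]]]; split.
  move=> s x _; rewrite foldr_partial_lincomb//.
  have [cf df] := sf s x I; have [cg dg] := sg s x I; split=> [|i].
    by apply: continuousD => //; apply: continuousZr => //; exact: cst_continuous.
  by apply: derivableD => //; exact: derivableZ.
exists (K `|` L); split.
- exact: compactU.
- by move=> x [/KO|/LO].
- move=> x /not_orP[Kx Lx].
  by rewrite -[LHS]/(a * f x + g x) f0// g0// mulr0 addr0.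
Qed.

Lemma test_function0 : test 0.
Proof.
have fold0 s : foldr (@partial R d) 0 s = 0.
  elim: s => //= i s ->; apply/funext => x; rewrite /partial.
  by rewrite (_ : 0 = cst 0)// derive_cst.
split; last by exists set0; split => //; exact: compact0.
move=> s x _; rewrite fold0; split; first exact: cst_continuous.
by move=> i; rewrite (_ : 0 = cst 0)//; exact: derivable_cst.
Qed.

Lemma rV_compact_closed (K : set 'rV[R]_d) : compact K -> closed K.
Proof. by apply: compact_closed; exact: norm_hausdorff. Qed.

Lemma test_function_partial i f : test f -> test (partial i f).
Proof.
move=> [sf [K [cK KO f0]]]; split.
  by move=> s x _; rewrite -foldr_rcons; exact: sf.
exists K; split => // x Kx; rewrite /partial.
rewrite (@near_eq_derive _ _ _ f (cst 0)) ?derive_cst//.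
have oK : open (~` K) by apply: closed_openC; exact: rV_compact_closed.
by have := open_nbhs_nbhs (conj oK Kx); apply: filterS => y Ky; exact: f0.
Qed.

Lemma test_function_continuous f : test f -> continuous f.
Proof. by move=> [sf _] x; have [] := sf [::] x I. Qed.

Lemma test_function_derivable i x f : test f -> derivable f x (unit_vec i).
Proof. by move=> [sf _]; have [_] := sf [::] x I. Qed.

Lemma test_function_measurable f : test f -> measurable_fun [set: 'rV[R]_d] f.
Proof. by move=> /test_function_continuous; exact: continuous_measurable_rV. Qed.

Lemma test_function_out f x : test f -> ~ Omega x -> f x = 0.
Proof. by move=> [_ [K [_ KO f0]]] Ox; apply: f0 => /KO. Qed.

Lemma test_function_restrict f : test f -> f \_ Omega = f.
Proof.
move=> tf; apply/funext => x; rewrite patchE; case: ifPn => // /negP xO.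
by rewrite (test_function_out tf)// => Ox; apply: xO; rewrite inE.
Qed.

Lemma test_function_bounded f : test f -> exists M : R, forall x, `|f x| <= M.
Proof.
move=> tf; have cf := test_function_continuous tf.
have [_ [K [cK _ f0]]] := tf.
have [M [_ hM]] : bounded_set (f @` K).
  apply: compact_bounded; apply: continuous_compact => //.
  exact: continuous_subspaceT.
exists (`|M| + 1) => x.
have M1 : M < `|M| + 1 by rewrite (le_lt_trans (ler_norm M))// ltrDl.
have [Kx|Kx] := pselect (K x); last by rewrite f0// normr0 addr_ge0.
by apply: (hM _ M1); exists x.
Qed.

Lemma test_function_support f : test f -> exists r : R, forall x, r < `|x| -> f x = 0.
Proof.
move=> [_ [K [/compact_bounded[r [_ hr]] _ f0]]]; exists (r + 1) => x rx.
by apply: f0 => /(hr (r + 1)); rewrite ltrDl ltr01 => /(_ isT) /=; rewrite leNgt rx.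
Qed.

Lemma test_function_lipschitz f (i : 'I_d) : test f ->
  exists L : R, forall x (a : R), `|f (x + a *: unit_vec i) - f x| <= L * `|a|.
Proof.
move=> tf; have [L hL] := test_function_bounded (test_function_partial i tf).
exists L; apply: partial_bounded_lipschitz => // x; exact: test_function_derivable.
Qed.

Lemma test_function_L2 f : test f -> L2 Omega f.
Proof.
move=> tf; have [M hM] := test_function_bounded tf.
have [r hr] := test_function_support tf.
apply/L2P; rewrite test_function_restrict//; split; first exact: test_function_measurable.
apply: (@integrable_bounded_support _ _ _ (M ^+ 2) r).
- by apply: measurable_funX; exact: test_function_measurable.
- by move=> x; rewrite normrX lerXn2r ?nnegrE//; exact: le_trans (hM x).
- by move=> x /hr ->; rewrite expr0n.
Qed.

Lemma test_function_is_grad f : test f -> is_grad Omega f (fun i => partial i f).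
Proof.
move=> tf; split; first exact: test_function_L2.
  by move=> i; apply/test_function_L2/test_function_partial.
exists (fun=> f); split => // [|i]; rewrite subrr L2norm0; exact: cvg_cst.
Qed.

(** The integral of the derivative of a product with bounded support vanishes. *)
Lemma test_function_parts i f g : test f -> test g ->
  L2dot Omega (partial i f) g = - L2dot Omega f (partial i g).
Proof.
move=> tf tg.
have [Mf hMf] := test_function_bounded tf.
have [Mg hMg] := test_function_bounded tg.
have [Lf hLf] := test_function_lipschitz i tf.
have [Lg hLg] := test_function_lipschitz i tg.
have [r hr] := test_function_support tf.
have tdf := test_function_partial i tf; have tdg := test_function_partial i tg.
have Mf0 : 0 <= Mf := le_trans (normr_ge0 _) (hMf 0).
have Mg0 : 0 <= Mg := le_trans (normr_ge0 _) (hMg 0).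
have mf := test_function_measurable tf; have mg := test_function_measurable tg.
have mdf := test_function_measurable tdf; have mdg := test_function_measurable tdg.
have [|||||||_ I0] := @integral_partial_eq0 R d i (f * g) (partial i f * g + f * partial i g)
  set0 (Mf * Lg + Lf * Mg) (Mf * Mg) r.
- exact: measurable_funM.
- by apply: measurable_funD; exact: measurable_funM.
- by move=> x; rewrite normrM ler_pM.
- by move=> x /hr fx; rewrite -[LHS]/(f x * g x) fx mul0r.
- move=> x a; rewrite -![(f * g) _]/(f _ * g _).
  set y := x + _.
  have -> : f y * g y - f x * g x = f y * (g y - g x) + (f y - f x) * g x by ring.
  apply: le_trans (ler_normD _ _) _; rewrite !normrM mulrDl -mulrA.
  rewrite [Lf * Mg * _]mulrAC; apply: lerD; apply: ler_pM => //; exact: hLg || exact: hLf.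
- by exists set0; split => //; rewrite measure0.
- move=> x _; have df := derivableP (test_function_derivable (i := i) (x := x) tf).
  have dg := derivableP (test_function_derivable (i := i) (x := x) tg).
  apply: is_derive_eq; rewrite [X in _ = X]addrC; congr (_ + _).
  by rewrite [RHS]mulrC.
apply/eqP; rewrite -addr_eq0 -[X in _ == X]I0 !L2dot_mkcond !test_function_restrict//.
have := L2dot_integrable (test_function_L2 tdf) (test_function_L2 tg).
have := L2dot_integrable (test_function_L2 tf) (test_function_L2 tdg).
by rewrite !test_function_restrict// => i1 i2; rewrite RintegralD.
Qed.

End fixed_domain.
End test_functions.

Section weak_gradient.
Context {R : realType} {d : nat} {Omega : set 'rV[R]_d}.
Local Notation mu := (@lebesgue_rV R d).
Local Notation fct := ('rV[R]_d -> R).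
Implicit Types (v w f g : fct) (G H : 'I_d -> fct).
Local Notation test := (test_function Omega).
Local Notation L2 := (L2 Omega).
Local Notation nm := (L2norm Omega).
Local Notation "'<| v , w |>" := (L2dot Omega v w).

Lemma cvg_L2dotl (f_ : nat -> fct) v w : L2 v -> L2 w -> (forall k, L2 (f_ k)) ->
  nm (f_ k - v) @[k --> \oo] --> (0 : R) ->
  '<|f_ k, w|> @[k --> \oo] --> '<|v, w|>.
Proof.
move=> Lv Lw Lf cf; apply: cvg_L2dot => //; first exact: nearW.
by rewrite subrr L2norm0; exact: cvg_cst.
Qed.

(** An element of the closure of a space that is orthogonal to the space is null. *)
Lemma orthogonal_test_norm0 (f_ : nat -> fct) w : L2 w ->
  (forall k, test (f_ k)) -> nm (f_ k - w) @[k --> \oo] --> (0 : R) ->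
  (forall f, test f -> '<|w, f|> = 0) -> nm w = 0.
Proof.
move=> Lw tf cf w0.
have c : '<|f_ k, w|> @[k --> \oo] --> '<|w, w|>.
  by apply: cvg_L2dotl => // k; exact: test_function_L2.
have : '<|w, w|> = 0.
  have /cvg_lim <- // := c.
  rewrite (_ : (fun k => _) = cst 0) ?lim_cst//.
  by apply/funext => k; rewrite L2dotC w0.
by rewrite -L2norm_sqr// => /eqP; rewrite sqrf_eq0 => /eqP.
Qed.

(** Both sides are limits of the same identity between test functions. *)
Lemma is_grad_parts v G i f : is_grad Omega v G -> test f ->
  '<|G i, f|> = - '<|v, partial i f|>.
Proof.
move=> [Lv LG [f_ [tf_ cf cG]]] tf.
have tdf := test_function_partial i tf.
have c1 : '<|partial i (f_ k), f|> @[k --> \oo] --> '<|G i, f|>.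
  apply: cvg_L2dotl => //; first exact: test_function_L2.
  by move=> k; apply/test_function_L2/test_function_partial.
have c2 : - '<|f_ k, partial i f|> @[k --> \oo] --> - '<|v, partial i f|>.
  apply: cvgN; apply: cvg_L2dotl => //; first exact: test_function_L2.
  by move=> k; exact: test_function_L2.
have E : (fun k => '<|partial i (f_ k), f|>) = (fun k => - '<|f_ k, partial i f|>).
  by apply/funext => k; exact: test_function_parts.
by rewrite E in c1; exact: (cvg_unique _ c1 c2).
Qed.

Lemma partial_lincomb i f g (a : R) : test f -> test g ->
  partial i (a *: f + g) = a *: partial i f + partial i g.
Proof. by move=> [sf _] [sg _]; exact: (foldr_partial_lincomb a [:: i] sf sg). Qed.

Lemma is_grad_lincomb (a : R) v w G H : is_grad Omega v G -> is_grad Omega w H ->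
  is_grad Omega (a *: v + w) (fun i => a *: G i + H i).
Proof.
move=> [Lv LG [f [tf cf cG]]] [Lw LH [g [tg cg cH]]]; split => [|i|].
- exact: L2_lincomb.
- exact: L2_lincomb.
have lin (F V F' V' : fct) : L2 F -> L2 V -> L2 F' -> L2 V' ->
    nm (a *: F + F' - (a *: V + V')) <= `|a| * nm (F - V) + nm (F' - V').
  move=> LF LV LF' LV'; rewrite -L2normZ//; apply: le_trans (L2norm_triangle _ _) => //.
  by rewrite opprD addrACA -scalerBr.
have cvg (F F' : nat -> fct) V V' : (forall k, L2 (F k)) -> (forall k, L2 (F' k)) ->
    L2 V -> L2 V' -> nm (F k - V) @[k --> \oo] --> (0 : R) ->
    nm (F' k - V') @[k --> \oo] --> (0 : R) ->
    nm (a *: F k + F' k - (a *: V + V')) @[k --> \oo] --> (0 : R).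
  move=> LF LF' LV LV' c c'.
  have cc : `|a| * nm (F k - V) + nm (F' k - V') @[k --> \oo] --> (0 : R).
    rewrite -[X in _ --> X](_ : `|a| * 0 + 0 = 0); last by rewrite mulr0 addr0.
    by apply: cvgD => //; apply: cvgM => //; exact: cvg_cst.
  apply: (squeeze_cvgr _ (cvg_cst 0) cc); apply: nearW => k.
  by rewrite L2norm_ge0/= lin.
exists (fun k => a *: f k + g k); split => [k||i].
- exact: test_function_lincomb.
- by apply: cvg => // k; exact: test_function_L2.
- under eq_fun do rewrite partial_lincomb//.
  by apply: cvg => // k; apply/test_function_L2/test_function_partial.
Qed.

(** The difference of two weak gradients is orthogonal to the test functions, among
    which it has approximations. *)
Lemma is_grad_unique v w G H : is_grad Omega v G -> is_grad Omega w H ->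
  nm (v - w) = 0 -> forall i, nm (G i - H i) = 0.
Proof.
move=> gv gw vw0 i; have [Lv LG _] := gv; have [Lw LH _] := gw.
have LGi := LG i; have LHi := LH i.
have := is_grad_lincomb (-1) gw gv => -[_ _ [f [tf _ cf]]].
apply: (@orthogonal_test_norm0 (fun k => partial i (f k))) => //.
- by move=> k; exact: test_function_partial.
- by have := cf i; rewrite scaleN1r addrC.
- move=> g tg; have Lg := test_function_L2 tg.
  have Ldg := test_function_L2 (test_function_partial i tg).
  rewrite L2dotBl// (is_grad_parts _ gv tg) (is_grad_parts _ gw tg) opprK addrC -L2dotBl//.
  by rewrite L2dot_norm0l// L2norm_distC.
Qed.

Lemma H10_gradP v : H10 Omega v -> is_grad Omega v (grad Omega v).
Proof. by move=> [G vG]; rewrite /grad; exact: xgetPex (ex_intro _ G vG). Qed.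

Lemma H10_L2 v : H10 Omega v -> L2 v.
Proof. by move=> [G []]. Qed.

Lemma grad_L2 v i : H10 Omega v -> L2 (grad Omega v i).
Proof. by move=> /H10_gradP[_ + _]. Qed.

Lemma H10_lincomb (a : R) v w : H10 Omega v -> H10 Omega w -> H10 Omega (a *: v + w).
Proof.
by move=> /H10_gradP gv /H10_gradP gw; eexists; exact: is_grad_lincomb gv gw.
Qed.

Lemma H10_test f : test f -> H10 Omega f.
Proof. by move=> tf; eexists; exact: test_function_is_grad. Qed.

Lemma grad_unique v G i : is_grad Omega v G -> nm (grad Omega v i - G i) = 0.
Proof.
move=> gv; have Hv : H10 Omega v by exists G.
by apply: is_grad_unique (H10_gradP Hv) gv _ i; rewrite subrr L2norm0.
Qed.

Lemma L2norm_le_H1norm v : nm v <= H1norm Omega v.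
Proof.
rewrite /H1norm -{1}[nm v]ger0_norm ?L2norm_ge0// -sqrtr_sqr ler_wsqrtr// lerDl.
by apply: sumr_ge0 => i _; exact: sqr_ge0.
Qed.

Lemma L2_cvg_H1 (T : Type) (F : set_system T) {FF : Filter F} (v_ : T -> fct) :
  H1norm Omega (v_ h) @[h --> F] --> (0 : R) -> nm (v_ h) @[h --> F] --> (0 : R).
Proof.
move=> c; apply: (squeeze_cvgr _ (cvg_cst 0) c); apply: nearW => h.
by rewrite L2norm_ge0 L2norm_le_H1norm.
Qed.

End weak_gradient.

(** * The elliptic form *)

Section cvg_bigsum.
Context {R : realType}.

Lemma cvg_bigsum (T : Type) (X : set_system T) {FX : Filter X} (I : Type) (s : seq I)
    (F : I -> T -> R) (l : I -> R) : (forall i, F i k @[k --> X] --> l i) ->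
  \sum_(i <- s) F i k @[k --> X] --> \sum_(i <- s) l i.
Proof.
move=> cF; elim: s => [|i s IH].
  by rewrite big_nil; under eq_fun do rewrite big_nil; exact: cvg_cst.
by rewrite big_cons; under eq_fun do rewrite big_cons; exact: cvgD.
Qed.

End cvg_bigsum.

Section elliptic_form.
Context {R : realType} {d : nat} {Omega : set 'rV[R]_d}.
Local Notation mu := (@lebesgue_rV R d).
Local Notation fct := ('rV[R]_d -> R).
Implicit Types (v w f g : fct) (G H : 'I_d -> fct).
Local Notation test := (test_function Omega).
Local Notation L2 := (L2 Omega).
Local Notation nm := (L2norm Omega).
Local Notation "'<| v , w |>" := (L2dot Omega v w).

Lemma L2_mul_bounded (a : fct) v (M : R) : measurable_fun setT (a \_ Omega) ->
  (forall x, Omega x -> `|a x| <= M) -> L2 v -> L2 (a * v).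
Proof.
move=> ma aM /L2P[mv iv]; apply/L2P.
have E : (a * v) \_ Omega = (a \_ Omega) * (v \_ Omega).
  by apply/funext => x; rewrite -[RHS]/(_ * _) !patchE; case: ifP => //; rewrite mul0r.
rewrite E; split; first exact: measurable_funM.
apply: (@le_integrableR _ _ _ mu _ _ _ (fun x => M ^+ 2 * (v \_ Omega) x ^+ 2)) => //.
- by apply: measurable_funX; exact: measurable_funM.
- move=> x _; rewrite -[(_ * _) x]/(_ * _) exprMn normrM [leRHS]normrM !normrX ler_pM ?exprn_ge0//.
  rewrite patchE; case: ifPn => [|_]; last by rewrite normr0 expr0n exprn_ge0.
  rewrite inE => /aM ax; rewrite lerXn2r ?nnegrE// (le_trans ax)//.
  exact: ler_norm.
- exact: integrableRZl.
Qed.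

Variable A : 'rV[R]_d -> 'M[R]_d.
Local Notation Aij i j := (fun x => A x i j).

Definition bounded_coefficients := forall i j,
  measurable_fun setT (Aij i j \_ Omega) /\
  exists M : R, forall x, Omega x -> `|A x i j| <= M.

Hypothesis cA : bounded_coefficients.

Lemma flux_L2 v i j : L2 v -> L2 (Aij i j * v).
Proof. by move=> Lv; have [mA [M AM]] := cA i j; exact: L2_mul_bounded AM Lv. Qed.

Lemma flux_dotE G H : (forall i, L2 (G i)) -> (forall i, L2 (H i)) ->
  flux_dot Omega A G H = \sum_i \sum_j '<|Aij i j * G j, H i|>.
Proof.
move=> LG LH; rewrite /flux_dot Rintegral_mkcond.
pose F i j x := ((Aij i j * G j) \_ Omega) x * (H i \_ Omega) x.
have iF i j : mu.-integrable setT (EFin \o F i j).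
  by apply: L2dot_integrable; [exact: flux_L2|exact: LH].
transitivity (\int[mu]_x (\sum_i \sum_j F i j x)).
  apply: eq_Rintegral => x _; rewrite patchE; case: ifPn => xO.
    by apply: eq_bigr => i _; apply: eq_bigr => j _; rewrite /F !patchE xO.
  by rewrite big1// => i _; rewrite big1// => j _; rewrite /F !patchE (negbTE xO) mul0r.
have iFs i := Rintegral_bigsum measurableT (index_enum 'I_d) (iF i).
rewrite (Rintegral_bigsum measurableT (index_enum 'I_d) (fun i => (iFs i).1)).2.
apply: eq_bigr => i _; rewrite (iFs i).2.
by apply: eq_bigr => j _; rewrite -L2dot_mkcond.
Qed.

Lemma flux_dot_lincombl (a : R) G G' H : (forall i, L2 (G i)) ->
  (forall i, L2 (G' i)) -> (forall i, L2 (H i)) ->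
  flux_dot Omega A (fun i => a *: G i + G' i) H =
  a * flux_dot Omega A G H + flux_dot Omega A G' H.
Proof.
move=> LG LG' LH; rewrite !flux_dotE => [|//|//|//|//|i|//]; last first.
  by have := LG i; have := LG' i.
rewrite mulr_sumr -big_split; apply: eq_bigr => i _.
rewrite mulr_sumr -big_split; apply: eq_bigr => j _ /=.
rewrite -L2dot_lincombl; [|exact: flux_L2|exact: flux_L2|exact: LH].
congr ('<| _, _|>); apply/funext => x.
rewrite -[LHS]/(A x i j * (a * G j x + G' j x)).
by rewrite -[RHS]/(a * (A x i j * G j x) + A x i j * G' j x); ring.
Qed.

(** Gradients are determined up to null functions, which the form does not see. *)
Lemma flux_dot_congr G G' H H' : (forall i, L2 (G i)) -> (forall i, L2 (G' i)) ->
  (forall i, L2 (H i)) -> (forall i, L2 (H' i)) ->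
  (forall i, nm (G i - G' i) = 0) -> (forall i, nm (H i - H' i) = 0) ->
  flux_dot Omega A G H = flux_dot Omega A G' H'.
Proof.
move=> LG LG' LH LH' GG' HH'; rewrite !flux_dotE//.
apply: eq_bigr => i _; apply: eq_bigr => j _.
have swap v w : '<|Aij i j * v, w|> = '<|v, Aij i j * w|>.
  by apply: eq_Rintegral => x _; rewrite -!/(_ * _) /= mulrCA mulrA.
have LGj := LG j; have LG'j := LG' j; have LHi := LH i; have LH'i := LH' i.
have LAH := flux_L2 i j LHi; have LAG' := flux_L2 i j LG'j.
apply/eqP; rewrite -subr_eq0; apply/eqP.
rewrite -(subrK '<|Aij i j * G' j, H i|> '<|Aij i j * G j, H i|>) -addrA -L2dotBr//.
rewrite (L2dot_norm0r _ _ (HH' i))// addr0 !swap -L2dotBl//.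
by rewrite (L2dot_norm0l _ _ (GG' j)).
Qed.

Lemma cvg_flux_dot G (H_ : nat -> 'I_d -> fct) H : (forall i, L2 (G i)) ->
  (forall k i, L2 (H_ k i)) -> (forall i, L2 (H i)) ->
  (forall i, nm (H_ k i - H i) @[k --> \oo] --> (0 : R)) ->
  flux_dot Omega A G (H_ k) @[k --> \oo] --> flux_dot Omega A G H.
Proof.
move=> LG LH_ LH cH; rewrite flux_dotE//.
under eq_fun do rewrite flux_dotE//.
apply: cvg_bigsum => i; apply: cvg_bigsum => j.
under eq_fun do rewrite L2dotC; rewrite L2dotC.
by apply: cvg_L2dotl => //; exact: flux_L2.
Qed.

End elliptic_form.

Section elliptic_operator.
Context {R : realType} {d : nat} {Omega : set 'rV[R]_d} {A : 'rV[R]_d -> 'M[R]_d}.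
Local Notation fct := ('rV[R]_d -> R).
Implicit Types (v w f g : fct).
Local Notation "'<| v , w |>" := (L2dot Omega v w).
Local Notation L2 := (L2 Omega).
Local Notation nm := (L2norm Omega).
Hypothesis cA : bounded_coefficients (Omega := Omega) A.

Lemma aform_lincombl (a : R) v w f : H10 Omega v -> H10 Omega w -> H10 Omega f ->
  aform Omega A (a *: v + w) f = a * aform Omega A v f + aform Omega A w f.
Proof.
move=> Hv Hw Hf; rewrite /aform -flux_dot_lincombl//; try by move=> i; exact: grad_L2.
have gvw := is_grad_lincomb a (H10_gradP Hv) (H10_gradP Hw).
apply: flux_dot_congr => // i.
- by apply: grad_L2; exact: H10_lincomb.
- by have := grad_L2 i Hv; have := grad_L2 i Hw.
- exact: grad_L2.
- exact: grad_L2.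
- exact: (grad_unique i gvw).
- by rewrite subrr L2norm0.
Qed.

Lemma flux_grad_test v f : H10 Omega v -> test_function Omega f ->
  flux_dot Omega A (grad Omega v) (fun i => partial i f) = aform Omega A v f.
Proof.
move=> Hv tf; apply: flux_dot_congr => // i.
- exact: grad_L2.
- exact: grad_L2.
- by apply/test_function_L2/test_function_partial.
- by apply/grad_L2/H10_test.
- by rewrite subrr L2norm0.
- rewrite L2norm_distC; last 2 first.
  + by apply/test_function_L2/test_function_partial.
  + by apply/grad_L2/H10_test.
  + exact: (grad_unique i (test_function_is_grad tf)).
Qed.

(** The test functions are dense in [H10], and both sides are continuous in [f]. *)
Lemma is_elliptic_aform v w f : H10 Omega v -> is_elliptic Omega A v w ->
  H10 Omega f -> aform Omega A v f = '<|w, f|>.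
Proof.
move=> Hv [Lw ew] Hf; have [Lf Lgf [f_ [tf_ cf cgf]]] := H10_gradP Hf.
have c1 : flux_dot Omega A (grad Omega v) (fun i => partial i (f_ k)) @[k --> \oo] -->
    aform Omega A v f.
  apply: cvg_flux_dot => // [i|k i].
  - exact: grad_L2.
  - by apply/test_function_L2/test_function_partial.
have c2 : '<|w, f_ k|> @[k --> \oo] --> '<|w, f|>.
  under eq_fun do rewrite L2dotC; rewrite L2dotC.
  by apply: cvg_L2dotl => // k; exact: test_function_L2.
have E : (fun k => flux_dot Omega A (grad Omega v) (fun i => partial i (f_ k))) =
    (fun k => '<|w, f_ k|>) by apply/funext => k; exact: ew.
by rewrite E in c1; exact: (cvg_unique _ c1 c2).
Qed.

Lemma aform_is_elliptic v w : H10 Omega v -> L2 w ->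
  (forall f, H10 Omega f -> aform Omega A v f = '<|w, f|>) -> is_elliptic Omega A v w.
Proof.
move=> Hv Lw h; split=> // f tf.
by rewrite -[LHS]/(flux_dot Omega A (grad Omega v) (fun i => partial i f))
  flux_grad_test// h//; exact: H10_test.
Qed.

Lemma elliptic_opP v w : is_elliptic Omega A v w ->
  is_elliptic Omega A v (elliptic_op Omega A v).
Proof. by move=> ew; exact: xgetPex (ex_intro _ w ew). Qed.

End elliptic_operator.

Section polytope.
Context {R : realType} {d : nat}.
Implicit Types (Omega : set 'rV[R]_d).

Lemma polytope_row_continuous (m : nat) (nu : 'M[R]_(m, d)) i :
  continuous (fun x : 'rV[R]_d => (nu *m x^T) i ord0).
Proof.
have -> : (fun x : 'rV[R]_d => (nu *m x^T) i ord0) = (fun x => \sum_j nu i j * x ord0 j).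
  by apply/funext => x; rewrite mxE; apply: eq_bigr => j _; rewrite mxE.
move=> x; apply: (@cvg_bigsum R _ (nbhs x) (nbhs_filter x) _ _ (fun j y => nu i j * y ord0 j)) => j; apply: cvgM; first exact: cvg_cst.
exact: coord_continuous.
Qed.

Lemma open_polytope Omega : convex_polytopal_domain Omega -> open Omega.
Proof.
move=> [_ _ [m [nu [b ->]]]]; rewrite openE => x h; 
  apply: (@filter_forall _ _ (fun i => [set y : 'rV[R]_d | (nu *m y^T) i ord0 < b i ord0]) (nbhs x)) => i.
by apply: cvgr_lt (h i); exact: polytope_row_continuous.
Qed.

Lemma compact_closure_bounded Omega : bounded_set Omega -> compact (closure Omega).
Proof.
move=> [M [_ hM]]; apply: bounded_closed_compact; last exact: closed_closure.
pose B := [set x : 'rV[R]_d | `|x| <= M + 1].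
have cB : closed B.
  apply: (@preimage_closed _ _ (fun x : 'rV[R]_d => `|x|) [set r | r <= M + 1]).
    by move=> x _; exact: norm_continuous.
  exact: closed_le.
have OB : closure Omega `<=` B.
  rewrite [B](closure_id _).1//; apply: closure_subset => x Ox.
  by apply: (hM (M + 1)) => //; rewrite ltrDl.
exists (M + 1); split; first exact: num_real.
by move=> N MN x /OB xB; apply: le_trans xB (ltW MN).
Qed.

Lemma smooth_bounded_coefficients Omega (A : 'rV[R]_d -> 'M[R]_d) :
  convex_polytopal_domain Omega ->
  (exists W, [/\ open W, closure Omega `<=` W
     & forall i j, smooth_on W (fun x => A x i j)]) ->
  bounded_coefficients (Omega := Omega) A.
Proof.
move=> pO [W [oW OW sA]] i j.
have cA x : W x -> {for x, continuous (fun x => A x i j)}.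
  by move=> Wx; have [] := sA i j [::] x Wx.
have oO := open_polytope pO; have OclO := @subset_closure _ Omega.
split.
  apply/(measurable_restrictT _ _).1; first exact: measurable_open_rV.
  by apply: continuous_at_measurable_rV => // x Ox; apply/cA/OW/OclO.
have cO : compact (closure Omega).
  by apply: compact_closure_bounded; have [_ bO _] := pO.
have [M [_ hM]] : bounded_set ((fun x => A x i j) @` closure Omega).
  apply: compact_bounded; apply: continuous_compact => //.
  by apply: continuous_in_subspaceT => x; rewrite inE => /OW; exact: cA.
exists (`|M| + 1) => x Ox.
have M1 : M < `|M| + 1 by rewrite (le_lt_trans (ler_norm M))// ltrDl.
by apply: (hM _ M1); exists x => //; exact: OclO.
Qed.

End polytope.

(** * Finite element functions are Lipschitz and piecewise polynomial *)

Section hyperplanes.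
Context {R : realType}.
Local Notation mu1 := (@lebesgue_measure R).
Local Notation mu d := (@lebesgue_rV R d).

Definition affine_form d (a : R) (b : 'I_d -> R) (x : 'rV[R]_d) : R :=
  a + \sum_i b i * x ord0 i.

Lemma affine_form_continuous d (a : R) (b : 'I_d -> R) :
  continuous (affine_form a b).
Proof.
move=> x; rewrite /affine_form; apply: (@cvgD _ _ _ (nbhs x)); first exact: cvg_cst.
apply: (@cvg_bigsum R _ (nbhs x) (nbhs_filter x) _ _ (fun j y => b j * y ord0 j)) => j.
by apply: cvgM; [exact: cvg_cst|exact: coord_continuous].
Qed.

Lemma closed_affine_form d (a : R) (b : 'I_d -> R) :
  closed [set x | affine_form a b x = 0].
Proof.
apply: (@preimage_closed _ _ (affine_form a b) [set r | r = 0]).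
  by move=> x _; exact: affine_form_continuous.
exact: closed_eq.
Qed.

(** Slicing along the first coordinate: each slice is a point, or is a hyperplane of
    the smaller space. *)
Lemma hyperplane_null d (a : R) (b : 'I_d -> R) : (a != 0 \/ exists i, b i != 0) ->
  mu d [set x | affine_form a b x = 0] = 0%E.
Proof.
elim: d a b => [|d IH] a b ab0.
  rewrite (_ : [set _ | _] = set0) ?measure0//; apply/seteqP; split => // x /=.
  rewrite /affine_form big_ord0 addr0 => a0.
  by case: ab0 => [|[[]//]]; rewrite a0 eqxx.
set S := [set x | _].
have mS : measurable S by apply: measurable_closed_rV; exact: closed_affine_form.
pose b' i := b (lift ord0 i).
have SE c y : affine_form a b (rV_cons (c, y)) = affine_form (a + b ord0 * c) b' y.
  rewrite /affine_form big_ord_recl addrA.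
  have E := rV_consK (c, y : 'rV[R]_d).
  congr (_ + _ * _ + _); first by have /(congr1 fst) := E.
  apply: eq_bigr => i _; congr (_ * _).
  by have /(congr1 snd)/rowP/(_ i) := E; rewrite mxE.
have mI : measurable_fun setT (fun x => (\1_S x)%:E : \bar R).
  by apply/measurable_EFinP; exact: measurable_indic.
have indicT d' (T : measurableType d') (m : {measure set T -> \bar R}) (B : set T) :
    measurable B -> m B = (\int[m]_x (\1_B x)%:E)%E.
  by move=> mB; rewrite integral_indic// setIT.
rewrite indicT//.
have [b0|b0] := eqVneq (b ord0) 0.
- have ab' : forall c, (a + b ord0 * c != 0 \/ exists i, b' i != 0).
    move=> c; rewrite b0 mul0r addr0; case: ab0 => [|[i bi]]; first by left.
    right; case: (unliftP ord0 i) bi => [j ->|->]; first by exists j.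
    by rewrite b0 eqxx.
  rewrite tonelli_rV//.
  rewrite integral0_eq// => c _.
  rewrite -(IH _ _ (ab' c)).
  rewrite indicT//; last by apply: measurable_closed_rV; exact: closed_affine_form.
  apply: eq_integral => y _; rewrite !indicE; congr ((nat_of_bool _)%:R%:E).
  by apply/idP/idP; rewrite !inE /S/= SE.
- rewrite tonelli_rV_sym//.
  rewrite integral0_eq// => y _.
  pose c0 := - (a + \sum_i b' i * y ord0 i) / b ord0.
  rewrite -(lebesgue_measure_set1 c0).
  rewrite indicT//; apply: eq_integral => c _; rewrite !indicE; congr ((nat_of_bool _)%:R%:E).
  apply/idP/idP; rewrite !inE /S/= SE /affine_form.
    by move=> h; apply: (mulIf b0); rewrite /c0 mulfVK//; move: h; lra.
  by move=> ->; rewrite /c0; field.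
Qed.

End hyperplanes.

Section C1_functions.
Context {R : realType} {d : nat}.
Local Notation fct := ('rV[R]_d -> R).
Implicit Types (p q : fct) (x : 'rV[R]_d).
Local Notation unit_vec i := (delta_mx ord0 i : 'rV[R]_d).

Definition C1 p := continuous p /\
  forall i, (forall x, derivable p x (unit_vec i)) /\ continuous (partial i p).

Lemma C1_cst (c : R) : C1 (fun=> c).
Proof.
split=> [x|i]; first exact: cst_continuous.
split=> [x|x]; first exact: derivable_cst.
rewrite (_ : partial i _ = cst 0); first exact: cst_continuous.
by apply/funext => y; rewrite /partial derive_cst.
Qed.

Lemma is_derive_coord x (v : 'rV[R]_d) (j : 'I_d) :
  is_derive x v (fun y => y ord0 j) (v ord0 j).
Proof.
have c : h^-1 *: (((fun y : 'rV[R]_d => y ord0 j) \o shift x) (h *: v) - x ord0 j)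
    @[h --> (0 : R)^'] --> v ord0 j.
  apply: cvg_near_cst; near=> h.
  have h0 : h != 0 by near: h; exact: nbhs_dnbhs_neq.
  by rewrite /= !mxE addrK [_ *: _]mulrA mulVf// mul1r.
by split; [exact: cvgP c|exact: cvg_lim c].
Unshelve. all: by end_near. Qed.

Lemma C1_coord j : C1 (fun x => x ord0 j).
Proof.
split=> [x|i]; first exact: coord_continuous.
split=> [x|]; first by have [] := is_derive_coord x (unit_vec i) j.
rewrite (_ : partial i _ = cst (unit_vec i ord0 j)); first by move=> x; exact: cst_continuous.
by apply/funext => x; have [_] := is_derive_coord x (unit_vec i) j.
Qed.

Lemma C1D p q : C1 p -> C1 q -> C1 (fun x => p x + q x).
Proof.
move=> [cp dp] [cq dq]; split=> [x|i]; first exact: cvgD (cp x) (cq x).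
have [dpi cpi] := dp i; have [dqi cqi] := dq i.
split=> [x|]; first exact: derivableD.
rewrite (_ : partial i _ = partial i p + partial i q); last first.
  by apply/funext => x; rewrite /partial deriveD.
by move=> x; exact: cvgD (cpi x) (cqi x).
Qed.

Lemma C1M p q : C1 p -> C1 q -> C1 (fun x => p x * q x).
Proof.
move=> [cp dp] [cq dq]; split=> [x|i]; first exact: cvgM (cp x) (cq x).
have [dpi cpi] := dp i; have [dqi cqi] := dq i.
split=> [x|]; first exact: derivableM.
rewrite (_ : partial i _ = fun x => p x * partial i q x + q x * partial i p x); last first.
  by apply/funext => x; rewrite /partial deriveM.
move=> x; apply: (@cvgD _ _ _ (nbhs x) (nbhs_filter x)
  (fun x => p x * partial i q x) (fun x => q x * partial i p x)).
- by apply: (@cvgM _ _ (nbhs x) (nbhs_filter x) p (partial i q)); [exact: cp|exact: cqi].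
- by apply: (@cvgM _ _ (nbhs x) (nbhs_filter x) q (partial i p)); [exact: cq|exact: cpi].
Qed.

Lemma C1_sum (I : Type) (s : seq I) (P : pred I) (F : I -> fct) :
  (forall i, C1 (F i)) -> C1 (fun x => \sum_(i <- s | P i) F i x).
Proof.
move=> CF; elim: s => [|i s IH].
  by under eq_fun do rewrite big_nil; exact: C1_cst.
under eq_fun do rewrite big_cons; case: (P i) => //; exact: C1D.
Qed.

Lemma C1_prod (I : Type) (s : seq I) (F : I -> fct) :
  (forall i, C1 (F i)) -> C1 (fun x => \prod_(i <- s) F i x).
Proof.
move=> CF; elim: s => [|i s IH].
  by under eq_fun do rewrite big_nil; exact: C1_cst.
by under eq_fun do rewrite big_cons; exact: C1M.
Qed.

Lemma C1X p n : C1 p -> C1 (fun x => p x ^+ n).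
Proof.
move=> Cp; elim: n => [|n IH]; first exact: C1_cst.
by under eq_fun do rewrite exprS; exact: C1M.
Qed.

Lemma poly_function_C1 r p : poly_function r p -> C1 p.
Proof.
move=> [c /funext ->]; apply: C1_sum => m; apply: C1M; first exact: C1_cst.
by apply: C1_prod => i; apply: C1X; exact: C1_coord.
Qed.

Lemma compact_ball_bounded (g : fct) (r : R) : continuous g ->
  exists M : R, 0 <= M /\ forall x, `|x| <= r -> `|g x| <= M.
Proof.
move=> cg; pose B := [set x : 'rV[R]_d | `|x| <= r].
have cB : compact B.
  apply: bounded_closed_compact.
    by exists r; split; [exact: num_real|move=> N rN x xr; exact: le_trans xr (ltW rN)].
  apply: (@preimage_closed _ _ (fun x : 'rV[R]_d => `|x|) [set s | s <= r]).
    by move=> x _; exact: norm_continuous.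
  exact: closed_le.
have [M [_ hM]] : bounded_set (g @` B).
  apply: compact_bounded; apply: continuous_compact => //.
  exact: continuous_subspaceT.
exists (`|M| + 1); split; first by rewrite addr_ge0.
move=> x xr; have M1 : M < `|M| + 1 by rewrite (le_lt_trans (ler_norm M))// ltrDl.
by apply: (hM _ M1); exists x.
Qed.

Lemma C1_lipschitz_ball p i (r : R) : C1 p -> exists L : R, 0 <= L /\
  forall x (a : R), `|x| <= r -> `|x + a *: unit_vec i| <= r ->
    `|p (x + a *: unit_vec i) - p x| <= L * `|a|.
Proof.
move=> [cp dp]; have [dpi cpi] := dp i.
have [L [L0 hL]] := compact_ball_bounded r cpi.
exists L; split=> //.
have pos x (a : R) : 0 <= a -> `|x| <= r -> `|x + a *: unit_vec i| <= r ->
    `|p (x + a *: unit_vec i) - p x| <= L * `|a|.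
  move=> a0 xr xar; pose F s := p (s *: unit_vec i + x).
  have r0 : 0 <= r := le_trans (normr_ge0 _) xr.
  have dF (s : R) : is_derive s (1 : R) F (partial i p (s *: unit_vec i + x)).
    by apply/is_derive_lineE; exact/derivableP.
  have [|c /itvP cI] := @MVT_segment R F (fun s => partial i p (s *: unit_vec i + x)) 0 a a0.
    by apply: derivable_within_continuous => s _; have [] := dF s.
  rewrite /F scale0r add0r [_ *: _ + x]addrC subr0 => ->.
  rewrite normrM ler_wpM2r// hL//.
  move: xr xar; rewrite !rV_norm_le// => /forallP xr /forallP xar.
  apply/forallP => j; have := xr j; have := xar j; rewrite !mxE/=.
  case: eqP => _; rewrite ?mulr1 ?mulr0 ?add0r ?addr0// !ler_norml.
  move=> /andP[? ?] /andP[? ?]; have c0 : 0 <= c by rewrite cI.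
  have ca : c <= a by rewrite cI.
  by apply/andP; split; lra.
move=> x a; have [|a0] := leP 0 a; first by move=> a0; exact: pos.
have := pos (x + a *: unit_vec i) (- a).
rewrite -addrA -scalerDl subrr scale0r addr0 normrN distrC => h xr xar; apply: h => //.
by rewrite oppr_ge0 ltW.
Qed.

End C1_functions.

Section lipschitz_on_cover.
Context {R : realType}.

(** Move to the last point of the piece containing the left end point: what remains
    is covered by the other pieces, these being closed. *)
Lemma lipschitz_closed_cover (I : choiceType) (s : seq I) (C : I -> set R) (f : R -> R)
    (L a b : R) : a <= b -> (forall i, closed (C i)) ->
  (forall i x y, C i x -> C i y -> `|f y - f x| <= L * `|y - x|) ->
  (forall x, a <= x <= b -> exists2 i, i \in s & C i x) ->
  `|f b - f a| <= L * (b - a).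
Proof.
move=> ab cC fC; move: {-1}(size s) (leqnn (size s)) => n.
elim: n s a ab => [|n IH] s a ab.
  by rewrite leqn0 => /nilP -> /(_ a); rewrite lexx ab => /(_ isT)[].
move=> sn cov; have [i si Ca] := cov a (introT andP (conj (lexx a) ab)).
pose D := C i `&` [set x | a <= x <= b].
have Da : D a by split => //=; rewrite lexx.
have supD : has_sup D.
  by split; [exists a|exists b => x [_ /= /andP[]]].
have ac : a <= sup D by apply: ub_le_sup => //; have [] := supD.
have cb : sup D <= b by apply: ge_sup; [exists a|move=> x [_ /= /andP[]]].
have clD : closed D.
  apply: closedI => //.
  rewrite (_ : [set x | _] = `[a, b]%classic); first exact: interval_closed.
  by apply/seteqP; split => x /=; rewrite in_itv.
have [Cc _] : D (sup D) by apply: clD; apply: closure_sup; have [] := supD.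
set c := sup D in ac cb Cc *.
have fca : `|f c - f a| <= L * (c - a).
  by have := fC i a c Ca Cc; rewrite [`|c - a|]ger0_norm// subr_ge0.
have [->//|cbn] := eqVneq b c.
have cb' : c < b by rewrite lt_neqAle eq_sym cbn cb.
have fbc : `|f b - f c| <= L * (b - c).
  apply: (IH (rem i s)) => //.
    by rewrite size_rem//; case: (s) sn => //.
  have out x : c < x -> x <= b -> exists2 j, j \in rem i s & C j x.
    move=> cx xb; have [|j js Cx] := cov x; first by rewrite xb andbT (le_trans ac)// ltW.
    exists j => //; move: js; have [ji|ji] := eqVneq j i; last first.
      by move=> js; have := perm_to_rem si => /perm_mem/(_ j); rewrite js inE (negbTE ji).
    move=> _; suff : x <= c by rewrite leNgt cx.
    apply: ub_le_sup.
      by have [] := supD.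
    by split; [rewrite -ji|rewrite /= xb andbT (le_trans ac)// ltW].
  move=> x /andP[cx xb]; have [->|xc] := eqVneq x c; last first.
    by apply: out => //; rewrite lt_neqAle eq_sym xc.
  have clU : closed (\bigcup_(j in [set` rem i s]) C j).
    by apply: closed_bigcup => //; exact: finite_seq.
  suff : (\bigcup_(j in [set` rem i s]) C j) c by move=> [j /= js Cj]; exists j.
  apply: clU => B nB.
  have /nbhs_ballP[e /= e0 eB] := nB.
  pose m := Num.min (e / 2) (b - c).
  have m0 : 0 < m by rewrite lt_min divr_gt0// subr_gt0.
  have me : m < e.
    by rewrite (@le_lt_trans _ _ (e / 2)) ?ge_min ?lexx//; lra.
  have mb : c + m <= b by rewrite -lerBrDl ge_min lexx orbT.
  have [|j js Cj] := out (c + m) _ mb; first by rewrite ltrDl.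
  exists (c + m); split; first by exists j.
  by apply: eB; rewrite /ball/= opprD addrA subrr sub0r normrN gtr0_norm.
have -> : f b - f a = (f b - f c) + (f c - f a) by rewrite addrA subrK.
apply: le_trans (ler_normD _ _) _; have := lerD fbc fca; lra.
Qed.

End lipschitz_on_cover.

Section simplices.
Context {R : realType} {d : nat}.
Implicit Types (K : @simplex R d) (x y : 'rV[R]_d).
Local Notation unit_vec i := (delta_mx ord0 i : 'rV[R]_d).
Local Notation nondegenerate := (@Defs.nondegenerate R d).

Definition simplex_mx K : 'M[R]_(d.+1, 1 + d) := row_mx (const_mx 1 : 'cV[R]_d.+1) K.

Definition bary_cst K (j : 'I_d.+1) : R := usubmx (pinvmx (simplex_mx K)) ord0 j.

Definition bary_lin K (j : 'I_d.+1) (i : 'I_d) : R := dsubmx (pinvmx (simplex_mx K)) i j.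

(** The barycentric coordinates of a point with respect to the vertices of [K]. *)
Definition bary K x : 'rV[R]_d.+1 := row_mx (1 : 'M[R]_1) x *m pinvmx (simplex_mx K).

Lemma baryE K x j : bary K x ord0 j = affine_form (bary_cst K j) (bary_lin K j) x.
Proof.
rewrite /bary -[pinvmx _]vsubmxK mul_row_col mul1mx mxE /affine_form; congr (_ + _).
by rewrite mxE; apply: eq_bigr => i _; rewrite mulrC.
Qed.

Lemma bary_comb K (l : 'rV[R]_d.+1) : nondegenerate K -> \sum_i l ord0 i = 1 ->
  bary K (l *m K) = l.
Proof.
move=> nK l1; rewrite /bary.
have -> : row_mx 1 (l *m K) = l *m simplex_mx K.
  rewrite mul_mx_row; congr row_mx; apply/matrixP => i j; rewrite !ord1 !mxE/= -[in LHS]l1.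
  by rewrite mulr1n; apply: eq_bigr => k _; rewrite mxE mulr1.
by rewrite -mulmxA mulmxVp// mulmx1.
Qed.

Lemma comb_bary K x : nondegenerate K ->
  \sum_i bary K x ord0 i = 1 /\ x = bary K x *m K.
Proof.
move=> nK; have E : bary K x *m simplex_mx K = row_mx 1 x.
  rewrite /bary; apply: mulmxKpV; apply: submx_full.
  exact: nK.
move: E; rewrite mul_mx_row => /eq_row_mx[E1 E2]; split=> //.
have /matrixP/(_ ord0 ord0) := E1; rewrite !mxE/= mulr1n => <-.
by apply: eq_bigr => i _; rewrite [const_mx _ _ _]mxE mulr1.
Qed.

Lemma hull_bary K x : nondegenerate K -> hull K x <-> forall j, 0 <= bary K x ord0 j.
Proof.
move=> nK; split=> [[l [l0 l1 _ ->]] j|h]; first by rewrite bary_comb.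
have [h1 h2] := comb_bary x nK.
by exists (bary K x); split => // i; rewrite inE.
Qed.

Lemma closed_hull K : nondegenerate K -> closed (hull K).
Proof.
move=> nK.
have -> : hull K = \bigcap_(j in [set: 'I_d.+1]) [set x | 0 <= bary K x ord0 j].
  by apply/seteqP; split => x; rewrite (hull_bary x nK)// => h j; [move=> _|]; exact: h.
apply: closed_bigI => j _.
under eq_fun do rewrite baryE.
apply: (@preimage_closed _ _ (affine_form (bary_cst K j) (bary_lin K j)) [set r | 0 <= r]).
  by move=> x _; exact: affine_form_continuous.
exact: closed_ge.
Qed.

Lemma hull_interior K x : nondegenerate K -> hull K x ->
  (forall j, bary K x ord0 j != 0) -> \forall y \near x, hull K y.
Proof.
move=> nK /(hull_bary _ nK) hx x0.
apply: filterS (fun y => (hull_bary y nK).2) _.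
apply: (@filter_forall _ _ (fun j => [set y : 'rV[R]_d | 0 <= bary K y ord0 j]) (nbhs x)) => j.
have : 0 < bary K x ord0 j by rewrite lt_def x0 hx.
rewrite baryE => bx; apply: filterS (_ : nbhs x [set y | 0 < affine_form (bary_cst K j) (bary_lin K j) y]).
  by move=> y /= h; rewrite baryE ltW.
exact: cvgr_gt (affine_form_continuous (x := x)) _ bx.
Qed.

(** The [j]-th barycentric coordinate is not identically zero: it is 1 at the [j]-th vertex. *)
Lemma bary_nontrivial K j : nondegenerate K ->
  bary_cst K j != 0 \/ exists i, bary_lin K j i != 0.
Proof.
move=> nK; apply: contrapT => /not_orP[/negP/negPn/eqP a0 /forallNP b0].
pose l : 'rV[R]_d.+1 := delta_mx ord0 j.
have l1 : \sum_i l ord0 i = 1.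
  rewrite (bigD1 j)//= big1 ?addr0 ?mxE ?eqxx// => i ij.
  by rewrite mxE (negbTE ij) andbF.
have := congr1 (fun M : 'rV[R]_d.+1 => M ord0 j) (bary_comb nK l1).
rewrite baryE /affine_form a0 add0r big1; last first.
  by move=> i _; have /negP/negPn/eqP -> := b0 i; rewrite mul0r.
by rewrite mxE !eqxx => /eqP; rewrite eq_sym oner_eq0.
Qed.

(** The points where some barycentric coordinate vanishes: the faces of codimension one,
    extended to hyperplanes. *)
Definition skeleton (Th : seq (@simplex R d)) : set 'rV[R]_d :=
  [set x | exists K j, K \in Th /\ bary K x ord0 j = 0].

Lemma closed_skeleton Th : closed (skeleton Th).
Proof.
have -> : skeleton Th =
    \bigcup_(K in [set` Th]) \bigcup_(j in [set: 'I_d.+1]) [set x | bary K x ord0 j = 0].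
  apply/seteqP; split => x; first by move=> [K [j [KT xj]]]; exists K => //; exists j.
  by move=> [K KT [j _ xj]]; exists K, j.
apply: closed_bigcup; first exact: finite_seq.
move=> K _; apply: closed_bigcup; first exact: finite_finset.
move=> j _; by under eq_fun do rewrite baryE; exact: closed_affine_form.
Qed.

Definition dilation (x0 : 'rV[R]_d) (lam : R) x : 'rV[R]_d := x0 + lam *: (x - x0).

Lemma negligible_bigcup_seq (I : choiceType) (s : seq I) (F : I -> set 'rV[R]_d) :
  (forall i, i \in s -> (@lebesgue_rV R d).-negligible (F i)) ->
  (@lebesgue_rV R d).-negligible (\bigcup_(i in [set` s]) F i).
Proof.
move=> nF; rewrite bigcup_seq big_seq; elim/big_ind: _ => //.
- exact: negligible_set0.
- by move=> A B; exact: negligibleU.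
Qed.

(** The preimage of a hyperplane under a dilation is a hyperplane. *)
Lemma skeleton_dilation_negligible Th x0 (lam : R) : lam != 0 ->
  (forall K, K \in Th -> nondegenerate K) ->
  (@lebesgue_rV R d).-negligible (dilation x0 lam @^-1` skeleton Th).
Proof.
move=> lam0 nTh.
have -> : dilation x0 lam @^-1` skeleton Th = \bigcup_(K in [set` Th])
    \bigcup_(j in [set` enum 'I_d.+1]) [set x | bary K (dilation x0 lam x) ord0 j = 0].
  apply/seteqP; split => x.
    by move=> [K [j [KT xj]]]; exists K => //; exists j => //=; rewrite mem_enum.
  by move=> [K KT [j _ xj]]; exists K, j.
apply: negligible_bigcup_seq => K KT; apply: negligible_bigcup_seq => j _.
pose a := affine_form (bary_cst K j) (bary_lin K j) x0 -
  lam * \sum_i bary_lin K j i * x0 ord0 i.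
pose b i := lam * bary_lin K j i.
have E : [set x | bary K (dilation x0 lam x) ord0 j = 0] = [set x | affine_form a b x = 0].
  suff h x : bary K (dilation x0 lam x) ord0 j = affine_form a b x.
    by apply/seteqP; split => x /=; rewrite h.
  rewrite baryE /affine_form /a /b /affine_form -!addrA; congr (_ + _).
  rewrite mulr_sumr -sumrN -!big_split/=; apply: eq_bigr => i _.
  by rewrite !mxE; ring.
rewrite E; apply/negligibleP; first by apply: measurable_closed_rV; exact: closed_affine_form.
apply: hyperplane_null.
have [[i bi]|nb] := pselect (exists i, bary_lin K j i != 0).
  by right; exists i; rewrite mulf_neq0.
have b0 i : bary_lin K j i = 0 by apply: contrapT => /eqP bi; apply: nb; exists i.
left; case: (bary_nontrivial j (nTh K KT)) => [|[i]]; last by rewrite b0 eqxx.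
suff -> : a = bary_cst K j by [].
rewrite /a /affine_form !big1 ?mulr0 ?subr0 ?addr0// => i _; by rewrite b0 mul0r.
Qed.

Lemma skeleton_negligible Th : (forall K, K \in Th -> nondegenerate K) ->
  (@lebesgue_rV R d).-negligible (skeleton Th).
Proof.
move=> /(@skeleton_dilation_negligible Th 0 1 (oner_neq0 _)).
rewrite (_ : _ @^-1` _ = skeleton Th)//.
by apply/seteqP; split => x; rewrite /= /dilation subr0 add0r scale1r.
Qed.

End simplices.

Section piecewise_polynomials.
Context {R : realType} {d : nat}.
Implicit Types (Omega : set 'rV[R]_d) (v : 'rV[R]_d -> R) (Th : seq (@simplex R d)).
Local Notation unit_vec i := (delta_mx ord0 i : 'rV[R]_d).

Variables (Omega : set 'rV[R]_d) (r : nat) (Th : seq (@simplex R d)) (v : 'rV[R]_d -> R).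
Hypothesis pO : convex_polytopal_domain Omega.
Hypothesis cT : conforming_triangulation Omega Th.
Hypothesis fv : fe_space Omega r Th v.

(** A point off the skeleton is interior to a simplex or to the complement of the
    domain, where [v] vanishes. *)
Lemma fe_space_locally_C1 x : ~ skeleton Th x ->
  exists2 p, C1 p & \forall y \near x, v y = p y.
Proof.
have [_ v0 vp] := fv; have [nT clO _] := cT => nx.
have [cx|ncx] := pselect (closure Omega x); last first.
  exists (fun=> 0); first exact: C1_cst.
  have oC : open (~` closure Omega) by apply: closed_openC; exact: closed_closure.
  apply: filterS (open_nbhs_nbhs (conj oC ncx)) => y ncy; apply: v0 => Oy.
  by apply: ncy; exact: subset_closure.
move: cx; rewrite clO => -[K /= KT Kx].
have [p pp pv] := vp K KT; exists p; first exact: poly_function_C1 pp.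
apply: filterS (hull_interior (nT K KT) Kx _) => [y Ky|j]; first exact: pv.
by apply/eqP => xj; apply: nx; exists K, j.
Qed.

(** On a coordinate line, the closed pieces are the traces of the simplices and of the
    complement of the domain; [v] is Lipschitz on each of them. *)
Lemma fe_space_lipschitz : exists L : R, 0 <= L /\
  forall i x (a : R), `|v (x + a *: unit_vec i) - v x| <= L * `|a|.
Proof.
have [cv v0 vp] := fv; have [nT clO _] := cT.
have oO := open_polytope pO.
have [rad hrad] : exists rad : R, forall x, closure Omega x -> `|x| <= rad.
  have [_ bO _] := pO.
  have [M [_ hM]] := compact_bounded (compact_closure_bounded bO).
  by exists (M + 1) => x /(hM (M + 1)); apply; rewrite ltrDl.
have H (Ki : @simplex R d * 'I_d) : exists L : R, 0 <= L /\ (Ki.1 \in Th ->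
    forall x (a : R), hull Ki.1 x -> hull Ki.1 (x + a *: unit_vec Ki.2) ->
    `|v (x + a *: unit_vec Ki.2) - v x| <= L * `|a|).
  case: Ki => K i /=; have [KT|KT] := boolP (K \in Th); last by exists 0.
  have [p pp pv] := vp K KT.
  have [L [L0 hL]] := C1_lipschitz_ball i rad (poly_function_C1 pp).
  exists L; split=> // _ x a Kx Kxa; rewrite !pv//; apply: hL; apply: hrad;
    by rewrite clO; exists K.
have {H}[Lf hLf] := choice H.
pose L := \sum_(K <- Th) \sum_i Lf (K, i).
have Lf0 K i : 0 <= Lf (K, i) by have [] := hLf (K, i).
have L_ge K i : K \in Th -> Lf (K, i) <= L.
  move=> KT; rewrite /L (big_rem K)//= (bigD1 i)//= -addrA lerDl.
  by rewrite addr_ge0 ?sumr_ge0// => K' _; apply: sumr_ge0.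
have L0 : 0 <= L by apply: sumr_ge0 => K _; apply: sumr_ge0.
exists L; split=> // i.
have step x (a : R) : 0 <= a -> `|v (x + a *: unit_vec i) - v x| <= L * `|a|.
  move=> a0.
  pose C (o : option (@simplex R d)) : set R := if o is Some K then
    (if K \in Th then [set s | hull K (x + s *: unit_vec i)] else set0)
    else [set s | ~ Omega (x + s *: unit_vec i)].
  have cline : continuous (fun s : R => x + s *: unit_vec i).
    by move=> s; apply: cvgD; [exact: cvg_cst|apply: cvgZr_tmp; exact: cvg_id].
  have := @lipschitz_closed_cover R (option (@simplex R d)) (None :: [seq Some K | K <- Th])
    C (fun s => v (x + s *: unit_vec i)) L 0 a a0.
  rewrite scale0r addr0 subr0 [`|a|]ger0_norm//; apply.
  - case=> [K|] /=.
      case: ifP => KT; last exact: closed0.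
      apply: (@preimage_closed _ _ (fun s : R => x + s *: unit_vec i) (hull K)).
        by move=> s _; exact: cline.
      exact: closed_hull (nT K KT).
    apply: (@preimage_closed _ _ (fun s : R => x + s *: unit_vec i) (~` Omega)).
      by move=> s _; exact: cline.
    exact: open_closedC.
  - case=> [K|] s s' /=; last by move=> ? ?; rewrite !v0// subrr normr0 mulr_ge0.
    case: ifP => KT // Ks Ks'; have [_ /(_ KT)/= h] := hLf (K, i).
    have E : x + s' *: unit_vec i = x + s *: unit_vec i + (s' - s) *: unit_vec i.
      by rewrite -addrA -scalerDl addrCA subrr addr0.
    rewrite E; apply: le_trans (h _ _ Ks _) _; first by rewrite -E.
    by rewrite ler_wpM2r// L_ge.
  - move=> s _; have [Os|nOs] := pselect (Omega (x + s *: unit_vec i)); last first.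
      by exists None.
    have : closure Omega (x + s *: unit_vec i) by exact: subset_closure.
    rewrite clO => -[K /= KT Ks]; exists (Some K); last by rewrite /C KT.
    by rewrite inE/= map_f.
move=> x a; have [|a0] := leP 0 a; first exact: step.
have := step (x + a *: unit_vec i) (- a).
rewrite -addrA -scalerDl subrr scale0r addr0 normrN distrC; apply.
by rewrite oppr_ge0 ltW.
Qed.

Lemma fe_space_bounded : exists M : R, 0 <= M /\ forall x, `|v x| <= M.
Proof.
have [cv v0 _] := fv.
have [_ [M [_ hM]] _] := pO.
have [B [B0 hB]] := compact_ball_bounded (M + 1) cv.
exists B; split=> // x; have [Ox|nOx] := pselect (Omega x); last by rewrite v0// normr0.
by apply: hB; apply: (hM (M + 1)) => //; rewrite ltrDl.
Qed.

End piecewise_polynomials.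

(** * Mollification *)

Section quadratic_remainder.
Context {R : realType} {V : normedModType R}.

(** A quadratic remainder is the form in which derivatives are computed below: it
    passes through products and integrals by plain estimates. *)
Lemma is_derive_quadratic (f : V -> R) (x v : V) (l C : R) :
  (forall h : R, `|h| <= 1 -> `|f (x + h *: v) - f x - h * l| <= C * h ^+ 2) ->
  is_derive x v f l.
Proof.
move=> H.
have c : h^-1 *: ((f \o shift x) (h *: v) - f x) @[h --> (0 : R)^'] --> l.
  apply/cvgrPdist_le => e e0; near=> h.
  have h0 : h != 0 by near: h; exact: nbhs_dnbhs_neq.
  have hd : `|h| <= Num.min 1 (e / (`|C| + 1)).
    near: h; apply: nbhs_dnbhs; apply/nbhs_ballP; exists (Num.min 1 (e / (`|C| + 1))) => /=.
      by rewrite lt_min ltr01/= divr_gt0// ltr_wpDl.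
    by move=> y; rewrite /ball/= sub0r normrN => /ltW.
  move: hd; rewrite le_min => /andP[h1 h2].
  rewrite -(ler_pM2l (x := `|h|)) ?normr_gt0// -normrM mulrBr.
  rewrite [_ *: _]/(h^-1 * _) mulrA mulfV// mul1r /= [h *: v + x]addrC distrC.
  apply: le_trans (H h h1) _; rewrite -real_normK ?num_real// expr2 mulrCA mulrA.
  rewrite [_ * e]mulrC ler_wpM2r//.
  apply: (@le_trans _ _ ((`|C| + 1) * `|h|)).
    by rewrite [leLHS]mulrC ler_wpM2r// (le_trans (ler_norm C))// lerDl.
  by rewrite mulrC -ler_pdivlMr// ltr_wpDl.
by split; [exact: cvgP c|exact: cvg_lim c].
Unshelve. all: by end_near. Qed.

End quadratic_remainder.

Section bump.
Context {R : realType}.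
Implicit Types (P : {poly R}) (x : R).

Lemma is_derive_horner P x : is_derive x (1 : R) (horner P) P^`().[x].
Proof.
by apply: DeriveDef; [exact: derivable_horner|rewrite -derive1E -derivE].
Qed.

Lemma expR_dominates (n : nat) (z : R) : 0 <= z -> z ^+ n * expR (- z) <= (n.+1%:R) ^+ n.
Proof.
move=> z0; rewrite -ler_pdivlMr ?expR_gt0// expRN invrK.
have n1 : 0 < n.+1%:R :> R by rewrite ltr0n.
have := expR_ge1Dx (z / n.+1%:R) => h.
have {}h : z <= n.+1%:R * expR (z / n.+1%:R).
  by rewrite mulrC -ler_pdivrMr//; apply: le_trans h; rewrite lerDr.
have {h} := lerXn2r n (z0 : z \in Num.nneg) (mulr_ge0 (ltW n1) (expR_ge0 _)) h.
rewrite exprMn -expRM_natl => h; apply: le_trans h _.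
apply: ler_wpM2l; first by rewrite exprn_ge0// ltW.
by rewrite ler_expR mulrCA -[leRHS]mulr1 ler_wpM2l// ler_pdivrMr// mul1r ler_nat.
Qed.

(** Derivatives of the standard bump [expR (- (1 - x ^+ 2)^-1)] have this form. *)
Definition bump P (k : nat) x : R :=
  if `|x| < 1 then P.[x] * (1 - x ^+ 2)^-1 ^+ k * expR (- (1 - x ^+ 2)^-1) else 0.

Definition bump_next P (k : nat) : {poly R} :=
  P^`() * (1 - 'X^2) ^+ 2 + k%:R *: (2%:R *: ('X * P * (1 - 'X^2))) - 2%:R *: ('X * P).

Lemma one_sub_sqr_gt0 x : `|x| < 1 -> 0 < 1 - x ^+ 2.
Proof. by move=> x1; rewrite subr_gt0 -real_normK ?num_real// exprn_ilt1. Qed.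

(** The exponential beats all powers of [(1 - x ^+ 2)^-1]; hence [bump] is flat at the end
    points of its support, which gives its derivative there. *)
Lemma bump_quadratic_bound P k : exists M : R, 0 <= M /\ forall x, `|bump P k x| <= M * (1 - x ^+ 2) ^+ 2.
Proof.
have [B [_ hB]] : bounded_set (horner P @` `[-1, 1]%classic).
  apply: compact_bounded; apply: continuous_compact; last exact: segment_compact.
  by apply: continuous_subspaceT; exact: continuous_horner.
have B1 : B < `|B| + 1 by rewrite (le_lt_trans (ler_norm B))// ltrDl.
exists ((`|B| + 1) * (k.+2.+1)%:R ^+ k.+2); split.
  by rewrite mulr_ge0 ?exprn_ge0// addr_ge0.
move=> x; rewrite /bump.
case: ifPn => x1; last first.
  by rewrite normr0 mulr_ge0 ?sqr_ge0// mulr_ge0 ?exprn_ge0// addr_ge0.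
have y0 := one_sub_sqr_gt0 x1.
set y := 1 - x ^+ 2 in y0 *; have yV : 0 <= y^-1 by rewrite invr_ge0 ltW.
have -> : P.[x] * y^-1 ^+ k * expR (- y^-1) =
    P.[x] * (y^-1 ^+ k.+2 * expR (- y^-1)) * y ^+ 2.
  rewrite !exprS expr0; field; exact: lt0r_neq0.
rewrite normrM [`|y ^+ 2|]ger0_norm ?sqr_ge0// ler_wpM2r ?sqr_ge0// normrM ler_pM//.
  apply: (hB _ B1); exists x => //=; rewrite in_itv/=.
  by move: x1; rewrite ltr_norml => /andP[/ltW -> /ltW ->].
rewrite ger0_norm; first exact: expR_dominates.
by rewrite mulr_ge0 ?exprn_ge0 ?expR_ge0.
Qed.

Lemma is_derive_bump P k x : is_derive x (1 : R) (bump P k) (bump (bump_next P k) k.+2 x).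
Proof.
have [x1|x1] := ltP `|x| 1.
  have y0 := one_sub_sqr_gt0 x1.
  have yn0 := lt0r_neq0 y0.
  have nx : \forall y \near x, P.[y] * (1 - y ^+ 2)^-1 ^+ k * expR (- (1 - y ^+ 2)^-1) = bump P k y.
    have : \forall y \near x, `|y| < 1 by exact: (cvgr_lt `|x| (@norm_continuous _ R x) 1 x1).
    by apply: filterS => y y1; rewrite /bump y1.
  apply: near_eq_is_derive nx _.
  have dP := is_derive_horner P x.
  have dz : is_derive x (1 : R) (fun y : R => (1 - y ^+ 2)^-1) (2 * x * (1 - x ^+ 2)^-1 ^+ 2).
    have dy : is_derive x (1 : R) (fun y : R => 1 - y ^+ 2) (- (2 * x)).
      apply: is_derive_eq; rewrite /GRing.scale /=; ring.
    apply: (is_derive_eq (@is_deriveV R (fun y : R => 1 - y ^+ 2) x _ 1 yn0 dy)).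
    by rewrite /GRing.scale/=; field.
  have de : is_derive x (1 : R) (fun y : R => expR (- (1 - y ^+ 2)^-1))
      (expR (- (1 - x ^+ 2)^-1) * - (2 * x * (1 - x ^+ 2)^-1 ^+ 2)).
    by have := @is_derive1_comp R expR (fun y : R => - (1 - y ^+ 2)^-1) x _ _ (is_derive_expR _) (is_deriveN dz).
  have dzk : is_derive x (1 : R) (fun y : R => (1 - y ^+ 2)^-1 ^+ k)
      (k%:R * (1 - x ^+ 2)^-1 ^+ k.-1 * (2 * x * (1 - x ^+ 2)^-1 ^+ 2)).
    rewrite (_ : (fun _ => _) = (fun y : R => (1 - y ^+ 2)^-1) ^+ k); last first.
      by apply/funext => y; rewrite exprfctE.
    apply: (is_derive_eq (is_deriveX k dz)); by rewrite mulr_natl.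
  apply: (is_derive_eq (is_deriveM (is_deriveM dP dzk) de)).
  rewrite /bump x1 (exprS _ k.+1) (exprS _ k) /bump_next !hornerE /= /GRing.scale/=.
  rewrite -[(_ * _) x]/(P.[x] * (1 - x ^+ 2)^-1 ^+ k).
  set e := expR _; set y := 1 - x ^+ 2 in yn0 *.
  case: (k) => [|j] /=; first by rewrite expr0; field.
  by rewrite exprS; field.
have -> : bump (bump_next P k) k.+2 x = 0 by rewrite /bump ltNge x1.
have [M [M0 hM]] := bump_quadratic_bound P k.
have bx : bump P k x = 0 by rewrite /bump ltNge x1.
apply: (@is_derive_quadratic _ _ _ _ _ _ (4 * M)) => h _.
rewrite bx mulr0 !subr0 [h *: 1]mulr1.
have [xh1|xh1] := ltP `|x + h| 1; last first.
  by rewrite /bump ltNge xh1/= normr0 mulr_ge0 ?sqr_ge0// mulr_ge0.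
apply: le_trans (hM _) _.
have y0 := one_sub_sqr_gt0 xh1.
have yh : 1 - (x + h) ^+ 2 <= 2 * `|h|.
  have := lerB_dist x (- h); rewrite normrN opprK => h1.
  rewrite -[(x + h) ^+ 2]real_normK ?num_real//.
  have := normr_ge0 (x + h); nra.
apply: (@le_trans _ _ (M * (2 * `|h|) ^+ 2)).
  by rewrite ler_wpM2l// lerXn2r ?nnegrE ?mulr_ge0// ltW.
by rewrite exprMn real_normK ?num_real// mulrA [4 * _]mulrC -natrX.
Qed.

Lemma bump_bounded P k : exists M : R, forall x, `|bump P k x| <= M.
Proof.
have [M [M0 hM]] := bump_quadratic_bound P k; exists M => x.
have [x1|x1] := ltP `|x| 1; last by rewrite /bump ltNge x1 normr0.
apply: le_trans (hM x) _; rewrite -[leRHS]mulr1 ler_wpM2l//.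
have y0 := one_sub_sqr_gt0 x1.
by apply: exprn_ile1; [exact: ltW|rewrite lerBlDr lerDl sqr_ge0].
Qed.

(** The derivatives are carried as data, so that differentiating a product of such
    functions of one coordinate each is a shift of indices. *)
Definition smooth_family (D : nat -> R -> R) : Prop :=
  (forall n x, is_derive x (1 : R) (D n) (D n.+1 x)) /\
  forall n, exists M : R, forall x, `|D n x| <= M.

Definition bump_data n : {poly R} * nat :=
  iter n (fun p => (bump_next p.1 p.2, p.2.+2)) (1, 0%N).

Definition bump_family n : R -> R := bump (bump_data n).1 (bump_data n).2.

Lemma smooth_family_bump : smooth_family bump_family.
Proof. by split=> n; [move=> x; exact: is_derive_bump|exact: bump_bounded]. Qed.

Lemma smooth_family_shift D : smooth_family D -> smooth_family (fun n => D n.+1).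
Proof. by move=> [d b]; split=> n; [exact: d|exact: b]. Qed.

Lemma smooth_family_scale (c : R) D : smooth_family D ->
  smooth_family (fun n x => c ^+ n * D n (c * x)).
Proof.
move=> [dD bD]; split=> n.
  move=> x; have dl : is_derive x (1 : R) (fun y : R => c * y) c.
    by apply: is_derive_eq; rewrite /GRing.scale/=; ring.
  have dc := @is_derive1_comp R (D n) (fun y : R => c * y) x _ _ (dD n (c * x)) dl.
  apply: (is_derive_eq (is_deriveZ (c ^+ n) dc)).
  by rewrite /GRing.scale/= exprS; ring.
have [M hM] := bD n; exists (`|c ^+ n| * M) => x.
by rewrite normrM ler_wpM2l.
Qed.

Lemma bump_family0_ge0 x : 0 <= bump_family 0 x.
Proof.
rewrite /bump_family /bump /=; case: ifP => // _.
by rewrite hornerC mul1r expr0 mul1r expR_ge0.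
Qed.

Lemma bump_family0_gt0 x : `|x| < 1 -> 0 < bump_family 0 x.
Proof.
by rewrite /bump_family /bump /= => ->; rewrite hornerC mul1r expr0 mul1r expR_gt0.
Qed.

Lemma bump_family0_out x : 1 <= `|x| -> bump_family 0 x = 0.
Proof. by rewrite /bump_family /bump leNgt => /negbTE ->. Qed.

Lemma bump_family0N x : bump_family 0 (- x) = bump_family 0 x.
Proof. by rewrite /bump_family /bump normrN sqrrN /= !hornerC. Qed.

(** The second derivative is bounded, hence the uniform remainder. *)
Lemma smooth_family_taylor D n : smooth_family D -> exists C : R, 0 <= C /\
  forall x h : R, `|D n (x + h) - D n x - h * D n.+1 x| <= C * h ^+ 2.
Proof.
move=> [dD bD]; have [M hM] := bD n.+2.
have M0 : 0 <= M := le_trans (normr_ge0 _) (hM 0).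
have mvt m (x h : R) : exists2 c, `|c - x| <= `|h| & D m (x + h) - D m x = h * D m.+1 c.
  have cD (i : interval R) : {within [set` i], continuous D m}.
    by apply: derivable_within_continuous => s _; have [] := dD m s.
  have [h0|h0] := leP 0 h.
    have xh : x <= x + h by rewrite lerDl.
    have [c] := @MVT_segment R (D m) (D m.+1) x (x + h) xh (fun s _ => dD m s) (cD _).
    rewrite in_itv/= => /andP[c1 c2] ->; exists c; last by rewrite addrAC subrr add0r mulrC.
    by rewrite !ger0_norm ?subr_ge0// lerBlDl.
  have xh : x + h <= x by rewrite gerDl ltW.
  have [c] := @MVT_segment R (D m) (D m.+1) (x + h) x xh (fun s _ => dD m s) (cD _).
  rewrite in_itv/= => /andP[c1 c2] E; exists c.
    by rewrite ler0_norm ?subr_le0// ltr0_norm// opprB lerBlDl -lerBlDr opprK.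
  by rewrite -opprB E opprD addrA subrr sub0r mulrN opprK mulrC.
exists M; split=> // x h.
have [c ch ->] := mvt n x h.
have [c' _ E] := mvt n.+1 x (c - x).
have -> : h * D n.+1 c - h * D n.+1 x = h * ((c - x) * D n.+2 c').
  by rewrite -E [x + _]addrC subrK mulrBr.
rewrite !normrM; apply: (@le_trans _ _ (`|h| * (`|h| * M))).
  by apply: ler_wpM2l => //; exact: ler_pM.
by rewrite mulrA -expr2 real_normK ?num_real// mulrC.
Qed.

End bump.

Section product_kernels.
Context {R : realType} {d : nat}.
Local Notation mu := (@lebesgue_rV R d).
Local Notation fct := ('rV[R]_d -> R).
Implicit Types (f g w : fct) (x y : 'rV[R]_d).
Local Notation unit_vec i := (delta_mx ord0 i : 'rV[R]_d).

Definition bounded_lipschitz f := exists M L : R,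
  [/\ 0 <= M, 0 <= L, forall x, `|f x| <= M & forall x y, `|f x - f y| <= L * `|x - y|].

Lemma bounded_lipschitzM f g : bounded_lipschitz f -> bounded_lipschitz g ->
  bounded_lipschitz (fun x => f x * g x).
Proof.
move=> [M [L [M0 L0 fM fL]]] [M' [L' [M'0 L'0 gM gL]]].
exists (M * M'), (M * L' + L * M'); split.
- exact: mulr_ge0.
- by rewrite addr_ge0// mulr_ge0.
- by move=> x; rewrite normrM ler_pM.
- move=> x y.
  have -> : f x * g x - f y * g y = f x * (g x - g y) + (f x - f y) * g y by ring.
  apply: le_trans (ler_normD _ _) _; rewrite !normrM mulrDl -mulrA.
  by rewrite [L * M' * _]mulrAC; apply: lerD; apply: ler_pM.
Qed.

Lemma bounded_lipschitz_continuous f : bounded_lipschitz f -> continuous f.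
Proof.
move=> [M [L [_ L0 _ fL]]] x.
apply/(@cvgrPdist_le _ _ _ (nbhs x) (nbhs_filter x)) => e e0.
near=> y; apply: le_trans (fL x y) _.
have : `|x - y| <= e / (L + 1).
  near: y; apply/nbhs_ballP; exists (e / (L + 1)); first by rewrite /= divr_gt0// ltr_wpDl.
  by move=> y; rewrite mx_norm_ball /ball_/= => /ltW.
rewrite ler_pdivlMr ?ltr_wpDl// => /(le_trans _); apply.
by rewrite mulrC ler_wpM2l// lerDl.
Unshelve. all: by end_near. Qed.

Lemma bounded_lipschitz_prod (I : Type) (s : seq I) (P : pred I) (F : I -> fct) :
  (forall i, bounded_lipschitz (F i)) ->
  bounded_lipschitz (fun x => \prod_(i <- s | P i) F i x).
Proof.
move=> BF; elim: s => [|i s IH].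
  under eq_fun do rewrite big_nil; exists 1, 0; split => // [x|x y].
    by rewrite normr1.
  by rewrite subrr normr0 mul0r.
by under eq_fun do rewrite big_cons; case: (P i) => //; exact: bounded_lipschitzM.
Qed.

Implicit Types (D : 'I_d -> nat -> R -> R).

Definition kernel D x : R := \prod_i D i 0%N (x ord0 i).

(** Differentiating a product kernel in the [i]-th coordinate shifts the [i]-th family. *)
Definition shift_at (i : 'I_d) D : 'I_d -> nat -> R -> R :=
  fun j n => if j == i then D j n.+1 else D j n.

Definition smooth_kernel D := forall i, smooth_family (D i).

Lemma smooth_kernel_shift i D : smooth_kernel D -> smooth_kernel (shift_at i D).
Proof.
move=> sD j; rewrite /shift_at; case: (j == i) => //.
exact: smooth_family_shift.
Qed.

Lemma coord_factor_bounded_lipschitz D i : smooth_kernel D ->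
  bounded_lipschitz (fun x => D i 0%N (x ord0 i)).
Proof.
move=> sD; have [dD bD] := sD i.
have [M hM] := bD 0%N; have [L hL] := bD 1%N.
exists M, L; split.
- exact: le_trans (normr_ge0 _) (hM 0).
- exact: le_trans (normr_ge0 _) (hL 0).
- by [].
- move=> x y.
  have lip (a b : R) : a <= b -> `|D i 0%N a - D i 0%N b| <= L * `|a - b|.
    move=> ab; have cD (J : interval R) : {within [set` J], continuous D i 0%N}.
      by apply: derivable_within_continuous => s _; have [] := dD 0%N s.
    have [c _ E] := @MVT_segment R _ _ a b ab (fun s _ => dD 0%N s) (cD _).
    by rewrite distrC E [`|a - b|]distrC normrM ler_wpM2r.
  have L0 : 0 <= L := le_trans (normr_ge0 _) (hL 0).
  apply: (@le_trans _ _ (L * `|x ord0 i - y ord0 i|)).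
    by have [/lip//|/ltW/lip] := leP (x ord0 i) (y ord0 i); rewrite distrC [X in _ * X]distrC.
  rewrite ler_wpM2l//; have := rV_coord_le (x - y) i; by rewrite !mxE.
Qed.

Lemma kernel_bounded_lipschitz D : smooth_kernel D -> bounded_lipschitz (kernel D).
Proof. by move=> sD; apply: bounded_lipschitz_prod => i; exact: coord_factor_bounded_lipschitz. Qed.

(** Uniform in [x], so that it may be integrated against [w] to differentiate a
    convolution. *)
Lemma kernel_taylor D i : smooth_kernel D -> exists C : R, 0 <= C /\ forall x (h : R),
  `|kernel D (x + h *: unit_vec i) - kernel D x - h * kernel (shift_at i D) x| <= C * h ^+ 2.
Proof.
move=> sD; have [C [C0 hC]] := smooth_family_taylor 0 (sD i).
pose P x := \prod_(j | j != i) D j 0%N (x ord0 j).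
have [M [_ [M0 _ hM _]]] : bounded_lipschitz P.
  by apply: bounded_lipschitz_prod => j; exact: coord_factor_bounded_lipschitz.
exists (C * M); split=> [|x h]; first exact: mulr_ge0.
have E1 : kernel D (x + h *: unit_vec i) = D i 0%N (x ord0 i + h) * P x.
  rewrite /kernel (bigD1 i)//= !mxE !eqxx mulr1; congr (_ * _).
  by apply: eq_bigr => j ji; rewrite !mxE (negbTE ji) mulr0 addr0.
have E2 : kernel D x = D i 0%N (x ord0 i) * P x by rewrite /kernel (bigD1 i).
have E3 : kernel (shift_at i D) x = D i 1%N (x ord0 i) * P x.
  rewrite /kernel (bigD1 i)//= {1}/shift_at eqxx; congr (_ * _).
  by apply: eq_bigr => j ji; rewrite /shift_at (negbTE ji).
rewrite E1 E2 E3.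
have -> : D i 0%N (x ord0 i + h) * P x - D i 0%N (x ord0 i) * P x - h * (D i 1%N (x ord0 i) * P x)
  = (D i 0%N (x ord0 i + h) - D i 0%N (x ord0 i) - h * D i 1%N (x ord0 i)) * P x by ring.
by rewrite normrM mulrAC ler_pM.
Qed.

Section convolution.
Variable w : fct.
Hypothesis iw : mu.-integrable setT (EFin \o w).

Let mw : measurable_fun setT w.
Proof. by apply/measurable_EFinP; exact: measurable_int iw. Qed.

Lemma bounded_mul_integrable g (M : R) : measurable_fun setT g -> (forall x, `|g x| <= M) ->
  mu.-integrable setT (EFin \o (fun y => g y * w y)).
Proof.
move=> mg gM; apply: (@le_integrableR _ _ _ mu _ _ _ (fun y => M * w y)) => //.
- exact: measurable_funM.
- by move=> y _; rewrite !normrM ler_wpM2r// (le_trans (gM y))// ler_norm.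
- exact: integrableRZl.
Qed.

Lemma pairing_bound g (M : R) : measurable_fun setT g -> (forall x, `|g x| <= M) ->
  `|\int[mu]_y (g y * w y)| <= M * \int[mu]_y `|w y|.
Proof.
move=> mg gM.
have iaw : mu.-integrable setT (EFin \o (fun y => `|w y|)).
  by move/integrable_abse: iw; apply: eq_integrable.
apply: le_trans (le_normr_Rintegral measurableT (bounded_mul_integrable mg gM)) _.
rewrite -RintegralZl//; apply: le_Rintegral => //.
- move/integrable_abse: (bounded_mul_integrable mg gM); exact: eq_integrable.
- exact: integrableRZl.
- by move=> y _; rewrite normrM ler_wpM2r.
Qed.

Definition convolve D x : R := \int[mu]_y (kernel D (x - y) * w y).

Lemma continuous_reflect (g : fct) x : continuous g -> continuous (fun y => g (x - y)).
Proof.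
move=> cg y; apply: (@continuous_comp _ _ _ (fun y => x - y) g); last exact: cg.
by apply: (@cvgB _ _ _ (nbhs y) (nbhs_filter y)); [exact: cvg_cst|exact: cvg_id].
Qed.

Lemma measurable_kernel_reflect D x : smooth_kernel D ->
  measurable_fun setT (fun y : 'rV[R]_d => kernel D (x - y)).
Proof.
move=> sD; apply: continuous_measurable_rV; apply: continuous_reflect.
by apply: bounded_lipschitz_continuous; exact: kernel_bounded_lipschitz.
Qed.

Lemma convolve_integrable D x : smooth_kernel D ->
  mu.-integrable setT (EFin \o (fun y => kernel D (x - y) * w y)).
Proof.
move=> sD; have [M [_ [_ _ hM _]]] := kernel_bounded_lipschitz sD.
by apply: (bounded_mul_integrable (measurable_kernel_reflect x sD)) => y; exact: hM.
Qed.

Lemma convolve_continuous D : smooth_kernel D -> continuous (convolve D).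
Proof.
move=> sD; apply: bounded_lipschitz_continuous.
have [M [L [M0 L0 hM hL]]] := kernel_bounded_lipschitz sD.
have W0 : 0 <= \int[mu]_y `|w y| by apply: Rintegral_ge0.
exists (M * \int[mu]_y `|w y|), (L * \int[mu]_y `|w y|); split.
- exact: mulr_ge0.
- exact: mulr_ge0.
- by move=> x; apply: pairing_bound => //; exact: measurable_kernel_reflect.
- move=> x x'; rewrite /convolve -RintegralB//; try exact: convolve_integrable.
  under eq_Rintegral do rewrite -mulrBl.
  rewrite mulrAC; apply: (@pairing_bound (fun y => kernel D (x - y) - kernel D (x' - y))).
    by apply: measurable_funB; exact: measurable_kernel_reflect.
  by move=> y; apply: le_trans (hL _ _) _; rewrite opprB addrA subrK.
Qed.

Lemma is_derive_convolve D i x : smooth_kernel D ->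
  is_derive x (unit_vec i) (convolve D) (convolve (shift_at i D) x).
Proof.
move=> sD; have sD' := smooth_kernel_shift i sD.
have [C [C0 hC]] := kernel_taylor i sD.
apply: (@is_derive_quadratic _ _ _ _ _ _ (C * \int[mu]_y `|w y|)) => h _.
rewrite /convolve -RintegralB//; try exact: convolve_integrable.
rewrite -RintegralZl//; last exact: convolve_integrable.
rewrite -RintegralB//; last 2 first.
- by apply: integrableRB => //; exact: convolve_integrable.
- by apply: integrableRZl => //; exact: convolve_integrable.
under eq_Rintegral do rewrite -mulrBl mulrA -mulrBl.
rewrite mulrAC; apply: (@pairing_bound (fun y => kernel D (x + h *: unit_vec i - y) -
  kernel D (x - y) - h * kernel (shift_at i D) (x - y))).
  apply: measurable_funB; last first.
    by apply: measurable_funM => //; exact: measurable_kernel_reflect.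
  by apply: measurable_funB; exact: measurable_kernel_reflect.
by move=> y; have := hC (x - y) h; rewrite [x - y + _]addrAC.
Qed.

Lemma foldr_partial_convolve D (s : seq 'I_d) : smooth_kernel D ->
  exists D', smooth_kernel D' /\ foldr (@partial R d) (convolve D) s = convolve D'.
Proof.
move=> sD; elim: s => [|i s [D' [sD' E]]]; first by exists D.
exists (shift_at i D'); split; first exact: smooth_kernel_shift.
rewrite /= E; apply/funext => x; have := is_derive_convolve i x sD'.
by case.
Qed.

Lemma smooth_convolve D : smooth_kernel D -> smooth_on setT (convolve D).
Proof.
move=> sD s x _; have [D' [sD' ->]] := foldr_partial_convolve s sD.
split; first exact: convolve_continuous.
by move=> i; have := is_derive_convolve i x sD'; case.
Qed.

End convolution.
End product_kernels.

Section mollifier.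
Context {R : realType} {d : nat}.
Local Notation mu := (@lebesgue_rV R d).
Local Notation fct := ('rV[R]_d -> R).
Implicit Types (f g w : fct) (x y : 'rV[R]_d).
Local Notation unit_vec i := (delta_mx ord0 i : 'rV[R]_d).

Definition mollifier_family (e : R) : 'I_d -> nat -> R -> R :=
  fun _ n s => e^-1 ^+ n * bump_family n (e^-1 * s).

Local Notation eta e := (kernel (mollifier_family e)).

Lemma smooth_mollifier (e : R) : smooth_kernel (mollifier_family e).
Proof. by move=> i; apply: smooth_family_scale; exact: smooth_family_bump. Qed.

Lemma mollifierE (e : R) x : eta e x = \prod_i bump_family 0 (e^-1 * x ord0 i).
Proof. by apply: eq_bigr => i _; rewrite /mollifier_family expr0 mul1r. Qed.

Lemma mollifier_ge0 (e : R) x : 0 <= eta e x.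
Proof. by rewrite mollifierE; apply: prodr_ge0 => i _; exact: bump_family0_ge0. Qed.

Lemma mollifier_gt0 (e : R) x : 0 < e -> `|x| < e -> 0 < eta e x.
Proof.
move=> e0; rewrite rV_norm_lt// => /forallP xe; rewrite mollifierE.
apply: prodr_gt0 => i _; apply: bump_family0_gt0.
by rewrite normrM gtr0_norm ?invr_gt0// ltr_pdivrMl// mulr1.
Qed.

Lemma mollifier_out (e : R) x : 0 < e -> e <= `|x| -> eta e x = 0.
Proof.
move=> e0; rewrite leNgt rV_norm_lt// negb_forall => /existsP[i].
rewrite -leNgt => xe; rewrite mollifierE (bigD1 i)//= bump_family0_out ?mul0r//.
by rewrite normrM gtr0_norm ?invr_gt0// ler_pdivlMl// mulr1.
Qed.

Lemma mollifierN (e : R) x : eta e (- x) = eta e x.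
Proof. by rewrite !mollifierE; apply: eq_bigr => i _; rewrite mxE mulrN bump_family0N. Qed.

Lemma measurable_mollifier (e : R) : measurable_fun setT (eta e).
Proof.
apply: continuous_measurable_rV; apply: bounded_lipschitz_continuous.
exact: kernel_bounded_lipschitz (smooth_mollifier e).
Qed.

Lemma mollifier_integrable (e : R) : 0 < e -> mu.-integrable setT (EFin \o eta e).
Proof.
move=> e0; have [M [_ [_ _ hM _]]] := kernel_bounded_lipschitz (smooth_mollifier e).
apply: (@integrable_bounded_support _ _ _ M e) => //; first exact: measurable_mollifier.
by move=> x /ltW; exact: mollifier_out.
Qed.

Definition mollifier_mass (e : R) : R := \int[mu]_x (eta e x).

(** The mollifier is positive on a box, and a box has positive measure. *)
Lemma mollifier_mass_gt0 (e : R) : 0 < e -> 0 < mollifier_mass e.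
Proof.
move=> e0; rewrite lt_def Rintegral_ge0 ?andbT; last by move=> x _; exact: mollifier_ge0.
apply/eqP => m0.
have I0 : (\int[mu]_x `|(eta e x)%:E| = 0)%E.
  under eq_integral do rewrite abse_EFin ger0_norm ?mollifier_ge0//.
  rewrite -[LHS]fineK; first by rewrite -/(mollifier_mass e) [fine _]m0.
  by apply: integrable_fin_num => //; exact: mollifier_integrable.
have mE : measurable_fun [set: 'rV[R]_d] (EFin \o eta e).
  by apply/measurable_EFinP; exact: measurable_mollifier.
have [A [mA A0 sA]] := (ae_eq_integral_abs mu measurableT mE).1 I0.
have [_ box0] := @lebesgue_rV_open_box R d (fun=> - e) (fun=> e).
pose B : set 'rV[R]_d := open_box (fun=> - e) (fun=> e).
have : (0 < mu B)%E by apply: box0 => i; rewrite gtrN.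
rewrite ltNge => /negP; apply; rewrite -A0; apply: le_measure.
- by rewrite inE; exact: measurable_open_box.
- by rewrite inE.
move=> x xb; apply: sA => /= /(_ I) [E0].
have xe : `|x| < e.
  by rewrite rV_norm_lt//; apply/forallP => i; rewrite ltr_norml; exact: xb.
by have := mollifier_gt0 e0 xe; rewrite E0 ltxx.
Qed.

Lemma mollifier_reflect (e : R) x : 0 < e ->
  mu.-integrable setT (fun y => (eta e (x - y))%:E) /\
  \int[mu]_y (eta e (x - y)) = mollifier_mass e.
Proof.
move=> e0.
have E : (fun y => eta e (x - y)) = (fun y => eta e (y - x)).
  by apply/funext => y; rewrite -mollifierN opprB.
split.
  have [M [_ [_ _ hM _]]] := kernel_bounded_lipschitz (smooth_mollifier e).
  apply: (@integrable_bounded_support _ _ (fun y => eta e (x - y)) M (`|x| + e)) => //.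
    exact: measurable_kernel_reflect (smooth_mollifier e).
  move=> y xy; apply: mollifier_out => //.
  have := lerB_dist y x; rewrite distrC => /(le_trans _); apply.
  by rewrite lerBrDl ltW.
rewrite E /mollifier_mass /Rintegral; congr fine.
apply: (@integral_rV_translation R d (- x) (EFin \o eta e)).
by apply/measurable_EFinP; exact: measurable_mollifier.
Qed.

Definition mollify (e : R) w x : R := (mollifier_mass e)^-1 * convolve w (mollifier_family e) x.

(** A mollified value is an average of nearby values. *)
Lemma mollify_near (e : R) w x (c del : R) : 0 < e -> mu.-integrable setT (EFin \o w) ->
  (forall y, `|x - y| <= e -> `|w y - c| <= del) -> `|mollify e w x - c| <= del.
Proof.
move=> e0 iw wc; have m0 := mollifier_mass_gt0 e0.
have [ie Ie] := mollifier_reflect x e0.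
have iew := convolve_integrable iw x (smooth_mollifier e).
have -> : mollify e w x - c =
    (mollifier_mass e)^-1 * (convolve w (mollifier_family e) x - c * mollifier_mass e).
  by rewrite /mollify mulrBr mulrCA mulVf ?mulr1// gt_eqF.
rewrite normrM gtr0_norm ?invr_gt0// ler_pdivrMl//.
rewrite -{1}Ie -RintegralZl// /convolve -RintegralB//; last exact: integrableRZl.
have id' : mu.-integrable setT (EFin \o (fun y => eta e (x - y) * w y - c * eta e (x - y))).
  by apply: integrableRB => //; exact: integrableRZl.
apply: le_trans (le_normr_Rintegral measurableT id') _.
rewrite -Ie mulrC -RintegralZl//; apply: le_Rintegral => //.
- by move/integrable_abse: id'; exact: eq_integrable.
- exact: integrableRZl.
move=> y _; rewrite [c * _]mulrC -mulrBr normrM ger0_norm ?mollifier_ge0// [leRHS]mulrC.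
have [xy|xy] := leP `|x - y| e; first by rewrite ler_wpM2l ?mollifier_ge0// wc.
by rewrite mollifier_out ?mul0r// ltW.
Qed.

Lemma mollifyZ (e a : R) w x : 0 < e -> mu.-integrable setT (EFin \o w) ->
  mollify e (fun y => a * w y) x = a * mollify e w x.
Proof.
move=> e0 iw; rewrite /mollify mulrCA; congr (_ * _); rewrite /convolve.
under eq_Rintegral do rewrite mulrCA.
by rewrite RintegralZl//; exact: (convolve_integrable iw x (smooth_mollifier e)).
Qed.

Lemma smooth_mollify (e : R) w : 0 < e -> mu.-integrable setT (EFin \o w) ->
  smooth_on setT (mollify e w).
Proof.
move=> e0 iw.
have iw' : mu.-integrable setT (EFin \o (fun y => (mollifier_mass e)^-1 * w y)).
  exact: integrableRZl.
rewrite (_ : mollify e w = convolve (fun y => (mollifier_mass e)^-1 * w y) (mollifier_family e)).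
  exact: (smooth_convolve iw' (smooth_mollifier e)).
apply/funext => x; rewrite /mollify /convolve -RintegralZl//; last first.
  exact: (convolve_integrable iw x (smooth_mollifier e)).
by apply: eq_Rintegral => y _; rewrite mulrCA.
Qed.

Lemma mollify_eq0 (e : R) w x : 0 < e -> (forall y, `|x - y| <= e -> w y = 0) ->
  mollify e w x = 0.
Proof.
move=> e0 w0; rewrite /mollify /convolve.
rewrite (_ : (fun y => _) = cst 0) ?Rintegral_cst ?mul0r ?mulr0//.
apply/funext => y; have [xy|xy] := leP `|x - y| e; first by rewrite w0 ?mulr0.
by rewrite mollifier_out ?mul0r// ltW.
Qed.

(** Derivatives may be moved from the mollifier to the mollified function when the
    latter is Lipschitz and differentiable almost everywhere. *)
Lemma partial_mollify (e : R) i w G (N : set 'rV[R]_d) (L M r : R) : 0 < e ->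
  measurable_fun setT w -> measurable_fun setT G ->
  (forall x, `|w x| <= M) -> (forall x, r < `|x| -> w x = 0) ->
  (forall x (a : R), `|w (x + a *: unit_vec i) - w x| <= L * `|a|) ->
  mu.-negligible N -> (forall x, ~ N x -> is_derive x (unit_vec i) w (G x)) ->
  mu.-integrable setT (EFin \o G) ->
  partial i (mollify e w) = mollify e G.
Proof.
move=> e0 mw mG wM wr wL N0 dw iG.
have iw : mu.-integrable setT (EFin \o w) by exact: integrable_bounded_support wM wr.
have sD := smooth_mollifier e; have sD' := smooth_kernel_shift i sD.
set D := mollifier_family e in sD sD' *.
apply/funext => x.
have dc := is_derive_convolve iw i x sD.
rewrite /mollify.
have -> : partial i (fun x => (mollifier_mass e)^-1 * convolve w D x) x =
    (mollifier_mass e)^-1 * convolve w (shift_at i D) x.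
  by have [] := is_deriveZ (mollifier_mass e)^-1 dc.
congr (_ * _).
have [M1 [L1 [M10 L10 hM1 hL1]]] := kernel_bounded_lipschitz sD.
have dK y : is_derive y (unit_vec i) (fun y => kernel D (x - y)) (- kernel (shift_at i D) (x - y)).
  have [C [C0 hC]] := kernel_taylor i sD.
  apply: (@is_derive_quadratic _ _ _ _ _ _ C) => h _.
  have := hC (x - y) (- h).
  have -> : x - y + - h *: unit_vec i = x - (y + h *: unit_vec i).
    by rewrite scaleNr opprD addrA.
  by rewrite sqrrN mulNr mulrN.
have Mge0 : 0 <= M := le_trans (normr_ge0 _) (wM 0).
have [|||||||_] := @integral_partial_eq0 R d i (fun y => kernel D (x - y) * w y)
  (fun y => kernel D (x - y) * G y - kernel (shift_at i D) (x - y) * w y)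
  N (M1 * L + L1 * M) (M1 * M) r.
- by apply: measurable_funM => //; exact: measurable_kernel_reflect.
- by apply: measurable_funB; apply: measurable_funM => //; exact: measurable_kernel_reflect.
- by move=> y; rewrite normrM ler_pM.
- by move=> y /wr ->; rewrite mulr0.
- move=> y a; set z := y + _.
  have -> : kernel D (x - z) * w z - kernel D (x - y) * w y =
    kernel D (x - z) * (w z - w y) + (kernel D (x - z) - kernel D (x - y)) * w y by ring.
  apply: le_trans (ler_normD _ _) _; rewrite !normrM mulrDl -mulrA.
  rewrite [L1 * M * _]mulrAC; apply: lerD; apply: ler_pM => //; first exact: wL.
  apply: le_trans (hL1 _ _) _; rewrite ler_wpM2l//.
  rewrite opprB addrC addrA subrK /z opprD addrA subrr sub0r normrN.
  exact: norm_delta_le.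
- exact: N0.
- move=> y /dw dwy; have dKy := dK y.
  have := is_deriveM dKy dwy; rewrite /GRing.scale/=.
  by rewrite mulrN [w y * _]mulrC.
have iKG := convolve_integrable iG x sD.
have iKw := convolve_integrable iw x sD'.
by rewrite RintegralB// => /eqP; rewrite subr_eq0 => /eqP.
Qed.

End mollifier.

(** * Finite element functions have weak gradients *)

Section bounded_convergence.
Context {R : realType} {d : nat}.
Local Notation mu := (@lebesgue_rV R d).
Local Notation fct := ('rV[R]_d -> R).
Implicit Types (f g w : fct) (x y : 'rV[R]_d).
Local Notation unit_vec i := (delta_mx ord0 i : 'rV[R]_d).

(** Dominated convergence, on a bounded set. *)
Lemma L2norm_bounded_cvg (Omega : set 'rV[R]_d) (h_ : nat -> fct) (M : R)
    (N : set 'rV[R]_d) : open Omega -> bounded_set Omega ->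
  (forall k, measurable_fun setT (h_ k)) -> (forall k x, `|h_ k x| <= M) ->
  mu.-negligible N -> (forall x, ~ N x -> h_ k x @[k --> \oo] --> (0 : R)) ->
  L2norm Omega (h_ k) @[k --> \oo] --> (0 : R).
Proof.
move=> oO bO mh hM N0 ch.
have mO : measurable Omega by exact: measurable_open_rV.
have mhO k : measurable_fun setT (h_ k \_ Omega).
  by apply/(measurable_restrictT _ _).1 => //; exact: measurable_funS (mh k).
have Lh k : L2 Omega (h_ k) by exact: L2_bounded bO (mhO k) (fun x _ => hM k x).
have [r [_ hr]] := bO.
have M0 : 0 <= M := le_trans (normr_ge0 _) (hM 0%N 0).
have := @dominated_convergence _ _ _ mu setT measurableT
  (fun k x => ((h_ k \_ Omega) x ^+ 2)%:E) (cst 0%E)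
  (EFin \o ((fun=> M ^+ 2) \_ (rV_ball_box (r + 1)))).
case.
- by move=> k; apply/measurable_EFinP; exact: measurable_funX.
- exact: measurable_cst.
- apply: negligibleS N0 => x; apply: contra_notP => nN _.
  apply: cvg_EFin; first exact: nearW.
  have c : h_ k x ^+ 2 @[k --> \oo] --> (0 : R).
    have c2 : h_ k x * h_ k x @[k --> \oo] --> (0 * 0 : R) by apply: cvgM; exact: ch.
    rewrite mulr0 in c2; move: c2.
    by apply: cvg_trans; apply: near_eq_cvg; apply: nearW => k; rewrite expr2.
  rewrite /= (_ : _ \o _ = fun k => (h_ k \_ Omega) x ^+ 2)//.
  have [Ox|Ox] := boolP (x \in Omega).
    by under eq_fun do rewrite patchE Ox.
  by under eq_fun do rewrite patchE (negbTE Ox) expr0n; exact: cvg_cst.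
- by apply: (@integrable_bounded_on_box _ _ _ (M ^+ 2)) => // x _; rewrite ger0_norm ?sqr_ge0.
- apply: aeW => x k _; rewrite /= lee_fin normrX !patchE.
  case: ifPn => [xO|_]; last by rewrite normr0 expr0n/=; case: ifP => // _; rewrite sqr_ge0.
  rewrite ifT; first by rewrite lerXn2r ?nnegrE.
  rewrite inE; apply: sub_rV_ball_box; rewrite inE in xO.
  by apply: (hr (r + 1)) => //; rewrite ltrDl.
move=> _ _ /= c.
have {}c : L2norm Omega (h_ k) ^+ 2 @[k --> \oo] --> (0 : R).
  have : fine (\int[mu]_x ((h_ k \_ Omega) x ^+ 2)%:E)%E @[k --> \oo] --> (0 : R).
    by move: c; rewrite integral0 => /fine_cvg.
  apply: cvg_trans; apply: near_eq_cvg; apply: nearW => k.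
  by rewrite L2norm_sqr// L2dot_mkcond.
have : Num.sqrt (L2norm Omega (h_ k) ^+ 2) @[k --> \oo] --> Num.sqrt (0 : R).
  exact: (cvg_comp _ _ c (sqrt_continuous (x := 0))).
rewrite sqrtr0; apply: cvg_trans; apply: near_eq_cvg; apply: nearW => k.
by rewrite sqrtr_sqr ger0_norm// L2norm_ge0.
Qed.

Lemma is_derive_dilation f (x0 x v : 'rV[R]_d) (lam l : R) :
  is_derive (dilation x0 lam x) v f l ->
  is_derive x v (fun y => f (dilation x0 lam y)) (lam * l).
Proof.
move=> df.
have h1 : is_derive (0 : R) (1 : R) (fun s : R => f (s *: v + dilation x0 lam x)) l.
  by apply/is_derive_lineE; rewrite scale0r add0r.
have dl : is_derive (0 : R) (1 : R) (fun s : R => lam * s) lam.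
  by apply: is_derive_eq; rewrite /GRing.scale/=; ring.
have h1' : is_derive (lam * 0) (1 : R) (fun s : R => f (s *: v + dilation x0 lam x)) l.
  by rewrite mulr0.
have := @is_derive1_comp R _ (fun s : R => lam * s) 0 _ _ h1' dl.
rewrite mulrC => h2.
suff : is_derive (0 *: v + x) v (fun y => f (dilation x0 lam y)) (lam * l).
  by rewrite scale0r add0r.
apply/is_derive_lineE; rewrite (_ : (fun _ => _) =
  (fun s : R => f (s *: v + dilation x0 lam x)) \o (fun s : R => lam * s))//.
apply/funext => s /=; congr f; rewrite /dilation.
by rewrite -addrA scalerDr scalerA addrCA.
Qed.

Lemma is_derive_lipschitz_le f i x (l L : R) : is_derive x (unit_vec i) f l ->
  (forall a : R, `|f (x + a *: unit_vec i) - f x| <= L * `|a|) -> `|l| <= L.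
Proof.
move=> [d1 d2] fL; rewrite -d2.
have c : `|h^-1 *: ((f \o shift x) (h *: unit_vec i) - f x)| @[h --> (0 : R)^']
    --> `|'D_(unit_vec i) f x| by apply: cvg_norm; exact: d1.
apply: (ler_cvg_to c (cvg_cst L)); near=> h.
have h0 : h != 0 by near: h; exact: nbhs_dnbhs_neq.
rewrite normrZ normfV ler_pdivrMl ?normr_gt0//= addrC mulrC [h *: _ + x]addrC.
by rewrite [- _ + _]addrC; exact: fL.
Unshelve. all: by end_near. Qed.

End bounded_convergence.

Section dilation_margin.
Context {R : realType} {d : nat}.
Implicit Types (Omega : set 'rV[R]_d) (x y : 'rV[R]_d).

(** Each linear constraint is strict at [x0] and gains a slack under the contraction,
    proportional to [1 - lam^-1], which absorbs a small displacement. *)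
Lemma dilation_margin Omega x0 (lam : R) : convex_polytopal_domain Omega -> Omega x0 ->
  1 < lam -> exists e0 : R, 0 < e0 /\ exists K, [/\ compact K, K `<=` Omega &
    forall x y, `|x - y| <= e0 -> Omega (dilation x0 lam y) -> K x].
Proof.
move=> [_ bO [m [nu [b EO]]]] Ox0 lam1.
pose F i x := (nu *m x^T) i ord0.
have FE i x : F i x = \sum_j nu i j * x ord0 j.
  by rewrite /F mxE; apply: eq_bigr => j _; rewrite mxE.
have FD i x y : F i (x + y) = F i x + F i y.
  by rewrite !FE -big_split; apply: eq_bigr => j _; rewrite mxE mulrDr.
have FZ i (a : R) x : F i (a *: x) = a * F i x.
  by rewrite !FE mulr_sumr; apply: eq_bigr => j _; rewrite mxE mulrCA.
have FN i x : F i (- x) = - F i x by rewrite -scaleN1r FZ mulN1r.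
(* [mg i] is the slack that the contraction leaves in the [i]-th constraint, and [n i] bounds
   the variation of that constraint over a unit distance; the sum in [S] stands for a
   maximum over the constraints. *)
pose mg i := (b i ord0 - F i x0) * (1 - lam^-1).
have lam0 : 0 < lam by rewrite (lt_trans _ lam1).
have mg0 i : 0 < mg i.
  rewrite mulr_gt0// subr_gt0; first by move: Ox0; rewrite EO; exact.
  by rewrite invf_lt1.
pose n i := \sum_j `|nu i j|.
have n0 i : 0 <= n i by apply: sumr_ge0.
pose S := 1 + \sum_i (n i + 1) / mg i.
have S0 : 0 < S.
  by rewrite ltr_pwDl// sumr_ge0// => i _; rewrite divr_ge0 ?addr_ge0// ltW.
have Sn i : S^-1 * n i < mg i.
  rewrite ltr_pdivrMl// -ltr_pdivrMr//.
  apply: (@lt_le_trans _ _ ((n i + 1) / mg i)).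
    by rewrite ltr_pM2r ?invr_gt0// ltrDl.
  rewrite /S (bigD1 i)//= addrCA lerDl addr_ge0// sumr_ge0// => j _.
  by rewrite divr_ge0 ?addr_ge0// ltW.
exists S^-1; split; first by rewrite invr_gt0.
pose K := [set x | forall i, F i x <= b i ord0 - mg i + S^-1 * n i].
have KO : K `<=` Omega.
  by move=> x Kx; rewrite EO => i; have := Kx i; have := Sn i; rewrite /F; lra.
exists K; split => //.
- apply: bounded_closed_compact.
    have [M [Mr hM]] := bO; exists M; split=> // N MN x /KO; exact: hM.
  have -> : K = \bigcap_(i in [set: 'I_m]) [set x | F i x <= b i ord0 - mg i + S^-1 * n i].
    by apply/seteqP; split => x h i; [move=> _; exact: h|exact: h i I].
  apply: closed_bigI => i _.
  apply: (@preimage_closed _ _ (F i) [set s | s <= b i ord0 - mg i + S^-1 * n i]).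
    by move=> x _; exact: polytope_row_continuous.
  exact: closed_le.
- move=> x y xy Oy i.
  have hy : F i x0 + lam * (F i y - F i x0) < b i ord0.
    move: Oy; rewrite EO => /(_ i); rewrite -/(F i _) /dilation.
    suff -> : F i (x0 + lam *: (y - x0)) = F i x0 + lam * (F i y - F i x0) by [].
    by rewrite FD FZ FD FN.
  have hxy : F i x - F i y <= S^-1 * n i.
    rewrite -[F i x - F i y](_ : F i (x - y) = _); last first.
      by rewrite FD FN.
    rewrite FE /n mulr_sumr; apply: ler_sum => j _.
    apply: le_trans (ler_norm _) _; rewrite normrM mulrC ler_wpM2r//.
    exact: le_trans (rV_coord_le _ _) xy.
  have : F i y <= F i x0 + (b i ord0 - F i x0) * lam^-1.
    rewrite -lerBlDl ler_pdivlMr// mulrC; lra.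
  rewrite /mg; lra.
Qed.

End dilation_margin.

Section fe_space_in_H10.
Context {R : realType} {d : nat}.
Local Notation mu := (@lebesgue_rV R d).
Local Notation fct := ('rV[R]_d -> R).
Implicit Types (f g w : fct) (x y : 'rV[R]_d).
Local Notation unit_vec i := (delta_mx ord0 i : 'rV[R]_d).

Variables (Omega : set 'rV[R]_d) (r : nat) (Th : seq (@simplex R d)) (v : fct).
Hypothesis pO : convex_polytopal_domain Omega.
Hypothesis cT : conforming_triangulation Omega Th.
Hypothesis fv : fe_space Omega r Th v.

(** Off the skeleton this is the classical gradient. *)
Definition piecewise_grad i : fct := partial i v \_ (~` skeleton Th).

Lemma piecewise_grad_near i x : ~ skeleton Th x -> exists2 p, C1 p &
  \forall y \near x, v y = p y /\ piecewise_grad i y = partial i p y.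
Proof.
move=> nx; have [p Cp vp] := fe_space_locally_C1 cT fv nx; exists p => //.
have oS : open (~` skeleton Th) by apply: closed_openC; exact: closed_skeleton.
have := nbhs_interior vp; have := open_nbhs_nbhs (conj oS nx).
apply: filterS2 => y ny vpy; split; first exact: nbhs_singleton vpy.
rewrite /piecewise_grad patchE ifT; last by rewrite inE.
exact: near_eq_derive.
Qed.

Lemma piecewise_grad_is_derive i x : ~ skeleton Th x ->
  is_derive x (unit_vec i) v (piecewise_grad i x).
Proof.
move=> nx; have [p [cp dp] vp] := piecewise_grad_near i nx.
have [_ ->] := nbhs_singleton vp; have [dpi _] := dp i.
apply: near_eq_is_derive (derivableP (dpi x)).
by apply: filterS vp => y [].
Qed.

Lemma piecewise_grad_continuous i x : ~ skeleton Th x -> {for x, continuous (piecewise_grad i)}.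
Proof.
move=> nx; have [p [cp dp] vp] := piecewise_grad_near i nx.
have [_ cpi] := dp i; have [_ E] := nbhs_singleton vp.
change (piecewise_grad i @ x --> piecewise_grad i x); rewrite E.
apply: cvg_trans (cpi x); apply: (@near_eq_cvg _ _ (nbhs x) (nbhs_filter x)).
by apply: filterS vp => y [].
Qed.

Lemma measurable_piecewise_grad i : measurable_fun setT (piecewise_grad i).
Proof.
have oS : open (~` skeleton Th) by apply: closed_openC; exact: closed_skeleton.
apply/(measurable_restrictT _ _).1; first exact: measurable_open_rV.
apply: (@eq_measurable_fun _ _ _ _ _ (piecewise_grad i)).
  by move=> x; rewrite /piecewise_grad patchE => ->.
by apply: continuous_at_measurable_rV => // x; exact: piecewise_grad_continuous.
Qed.

Lemma piecewise_grad_bound i (L : R) : 0 <= L ->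
  (forall x (a : R), `|v (x + a *: unit_vec i) - v x| <= L * `|a|) ->
  forall x, `|piecewise_grad i x| <= L.
Proof.
move=> L0 vL x; have [nx|nx] := pselect (skeleton Th x); last first.
  exact: is_derive_lipschitz_le (piecewise_grad_is_derive i nx) (vL x).
by rewrite /piecewise_grad patchE ifF ?normr0//; apply/negP; rewrite inE.
Qed.

Variable x0 : 'rV[R]_d.
Hypothesis Ox0 : Omega x0.

(** Contraction by [lam k > 1] about [x0] moves the support of [v] inside the domain. *)
Let lam (k : nat) : R := 1 + k.+1%:R^-1.
Let lam_gt1 k : 1 < lam k. Proof. by rewrite /lam ltrDl invr_gt0 ltr0n. Qed.
Let lam_le2 k : lam k <= 2.
Proof. by rewrite /lam [leRHS](_ : 2 = 1 + 1)// lerD2l invf_le1 ?ler1n ?ltr0n. Qed.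

Let w k : fct := fun y => v (dilation x0 (lam k) y).

Let dilation_continuous (a : R) : continuous (dilation x0 a).
Proof.
move=> x; apply: (@cvgD _ _ _ (nbhs x) (nbhs_filter x)); first exact: cvg_cst.
apply: (@cvgZl_tmp _ _ _ (nbhs x) (nbhs_filter x)).
by apply: (@cvgB _ _ _ (nbhs x) (nbhs_filter x)); [exact: cvg_id|exact: cvg_cst].
Qed.

Let w_continuous k : continuous (w k).
Proof.
have [cv _ _] := fv => x.
apply: (@continuous_comp _ _ _ (dilation x0 (lam k)) v); last exact: cv.
exact: dilation_continuous.
Qed.

Let w_support : exists rad : R, forall k x, rad < `|x| -> w k x = 0.
Proof.
have [_ v0 _] := fv; have [_ [M [_ hM]] _] := pO.
exists (M + 1 + `|x0| + `|x0|) => k x xr; apply: v0 => /(hM (M + 1)).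
rewrite ltrDl ltr01 => /(_ isT)/=; rewrite leNgt => /negP; apply.
rewrite /dilation; have := lerB_normD (lam k *: (x - x0)) x0.
rewrite [x0 + _]addrC; apply: lt_le_trans; rewrite normrZ gtr0_norm ?(lt_trans _ (lam_gt1 k))//.
have h2 : `|x| - `|x0| <= `|x - x0| := lerB_dist _ _.
have h3 : `|x - x0| <= lam k * `|x - x0| by rewrite ler_peMl// ltW.
lra.
Qed.

Let vbound : exists M : R, 0 <= M /\ forall x, `|v x| <= M.
Proof. exact: fe_space_bounded pO fv. Qed.

Let vlip : exists L : R, 0 <= L /\
  forall i x (a : R), `|v (x + a *: unit_vec i) - v x| <= L * `|a|.
Proof. exact: fe_space_lipschitz pO cT fv. Qed.

Let dilation_line k i x (a : R) :
  dilation x0 (lam k) (x + a *: unit_vec i) = dilation x0 (lam k) x + (lam k * a) *: unit_vec i.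
Proof. by rewrite /dilation [x + _ - x0]addrAC scalerDr scalerA addrA. Qed.

Let Gw i k : fct := fun y => lam k * piecewise_grad i (dilation x0 (lam k) y).

Let measurable_dilation_grad i k :
  measurable_fun setT (fun y => piecewise_grad i (dilation x0 (lam k) y)).
Proof.
apply: (measurableT_comp (measurable_piecewise_grad i)).
apply: measurable_fun_rVP => j; apply: continuous_measurable_rV => y.
apply: (@continuous_comp _ _ _ (dilation x0 (lam k)) (fun z : 'rV[R]_d => z ord0 j)).
  exact: dilation_continuous.
exact: coord_continuous.
Qed.

Let w_integrable k : mu.-integrable setT (EFin \o w k).
Proof.
have [M [M0 vM]] := vbound; have [rad wr] := w_support.
apply: (@integrable_bounded_support _ _ _ M rad); last exact: wr.
  by apply: continuous_measurable_rV; exact: w_continuous.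
by move=> x; exact: vM.
Qed.

Let partial_w i k (e : R) : 0 < e ->
  mu.-integrable setT (EFin \o Gw i k) /\
  partial i (mollify e (w k)) = mollify e (Gw i k).
Proof.
move=> e0; have [M [M0 vM]] := vbound; have [rad wr] := w_support.
have [L [L0 vL]] := vlip.
have [nT _ _] := cT.
have lam0 : lam k != 0 by rewrite gt_eqF// (lt_trans _ (lam_gt1 k)).
have nN := skeleton_dilation_negligible x0 lam0 nT.
have mw : measurable_fun setT (w k) by apply: continuous_measurable_rV; exact: w_continuous.
have mG : measurable_fun setT (Gw i k).
  by apply: measurable_funM => //; exact: measurable_dilation_grad.
have wL x (a : R) : `|w k (x + a *: unit_vec i) - w k x| <= L * lam k * `|a|.
  rewrite /w dilation_line; apply: le_trans (vL _ _ _) _.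
  by rewrite normrM gtr0_norm ?mulrA// (lt_trans _ (lam_gt1 k)).
have dw x : ~ (dilation x0 (lam k) @^-1` skeleton Th) x ->
    is_derive x (unit_vec i) (w k) (Gw i k x).
  by move=> nx; apply: is_derive_dilation; exact: piecewise_grad_is_derive.
have wM x : `|w k x| <= M by exact: vM.
have [iG _] := integral_partial_eq0 mw mG wM (wr k) wL nN dw.
by split=> //; exact: (partial_mollify e0 mw mG wM (wr k) wL nN dw iG).
Qed.

Let margins : exists e : nat -> R, forall k, [/\ 0 < e k, e k <= k.+1%:R^-1 &
  exists K, [/\ compact K, K `<=` Omega &
    forall x y, `|x - y| <= e k -> Omega (dilation x0 (lam k) y) -> K x]].
Proof.
have H k : exists e : R, [/\ 0 < e, e <= k.+1%:R^-1 & exists K, [/\ compact K,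
    K `<=` Omega & forall x y, `|x - y| <= e -> Omega (dilation x0 (lam k) y) -> K x]].
  have [e0 [e00 [K [cK KO hK]]]] := dilation_margin pO Ox0 (lam_gt1 k).
  exists (Num.min e0 k.+1%:R^-1); split.
  - by rewrite lt_min e00/= invr_gt0 ltr0n.
  - by rewrite ge_min lexx orbT.
  - exists K; split => // x y xy; apply: hK; apply: le_trans xy _.
    by rewrite ge_min lexx.
by have [e he] := choice H; exists e.
Qed.

Let mollify_cvg (e : nat -> R) (g : fct) x :
  (forall k, 0 < e k) -> (forall k, e k <= k.+1%:R^-1) ->
  (forall k, mu.-integrable setT (EFin \o (fun y => g (dilation x0 (lam k) y)))) ->
  {for x, continuous g} ->
  mollify (e k) (fun y => g (dilation x0 (lam k) y)) x @[k --> \oo] --> g x.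
Proof.
move=> e0 e1 ig cg; apply/cvgrPdist_le => del del0.
have /cvgrPdist_le/(_ _ del0) := cg.
rewrite nearE => /nbhs_ballP[h /= h0 hg].
have c : k.+1%:R^-1 * (2 + `|x - x0|) @[k --> \oo] --> (0 : R).
  rewrite -[X in _ --> X](mul0r (2 + `|x - x0|)).
  by apply: cvgM; [exact: cvg_harmonic|exact: cvg_cst].
have nk : \forall k \near \oo, k.+1%:R^-1 * (2 + `|x - x0|) < h.
  exact: (cvgr_lt _ c).
apply: filterS nk => k hk; rewrite distrC; apply: mollify_near => // y xy.
rewrite distrC; apply: hg; rewrite mx_norm_ball /ball_/=; apply: le_lt_trans hk.
set a := k.+1%:R^-1 : R.
have a0 : 0 <= a by rewrite invr_ge0.
have a1 : a <= 1 by rewrite invf_le1 ?ler1n ?ltr0n.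
have -> : x - dilation x0 (lam k) y = (1 + a) *: (x - y) - a *: (x - x0).
  rewrite /dilation /lam -/a; apply/rowP => j; rewrite !mxE; ring.
apply: le_trans (ler_normB _ _) _; rewrite !normrZ !ger0_norm ?addr_ge0//.
have := le_trans xy (e1 k); rewrite -/a; have := normr_ge0 (x - x0); nra.
Qed.

(** The approximating test functions are the contractions of [v], mollified at a scale
    below the margin that the contraction leaves. *)
Lemma fe_space_H10_from : H10 Omega v.
Proof.
have [e he] := margins.
have e0 k : 0 < e k by have [] := he k.
have e1 k : e k <= k.+1%:R^-1 by have [] := he k.
have [M [M0 vM]] := vbound; have [rad wr] := w_support.
have [L [L0 vL]] := vlip.
have [cv v0 _] := fv; have [nT _ _] := cT.
have oO := open_polytope pO; have [_ bO _] := pO.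
have mv : measurable_fun [set: 'rV[R]_d] v by exact: continuous_measurable_rV.
have mO : measurable Omega by exact: measurable_open_rV.
have GL i x : `|piecewise_grad i x| <= L by exact: piecewise_grad_bound (vL i) x.
have tf k : test_function Omega (mollify (e k) (w k)).
  split; first by apply: smooth_mollify; [exact: e0|exact: w_integrable].
  have [_ _ [K [cK KO hK]]] := he k; exists K; split => // x Kx.
  apply: mollify_eq0 => // y xy; apply: v0 => Oy; apply: Kx; exact: hK xy Oy.
have Lv : L2 Omega v.
  apply: (@L2_bounded _ _ _ _ M) => //.
  by apply/(measurable_restrictT _ _).1 => //; exact: measurable_funS mv.
have LG i : L2 Omega (piecewise_grad i).
  apply: (@L2_bounded _ _ _ _ L) => //.
  by apply/(measurable_restrictT _ _).1 => //; exact: measurable_funS (measurable_piecewise_grad i).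
exists piecewise_grad; split => //.
exists (fun k => mollify (e k) (w k)); split => [//||i].
- apply: (@L2norm_bounded_cvg _ _ _ _ (M + M) set0) => //.
  + move=> k; apply: measurable_funB => //; exact: test_function_measurable (tf k).
  + move=> k x; apply: le_trans (ler_normB _ _) _; rewrite lerD//.
    rewrite -[mollify _ _ _]subr0; apply: mollify_near => // y _.
    by rewrite subr0; exact: vM.
  + exact: negligible_set0.
  + move=> x _; apply/subr_cvg0; apply: mollify_cvg => //; exact: cv.
- apply: (@L2norm_bounded_cvg _ _ _ _ (2 * L + L) (skeleton Th)) => //.
  + move=> k; apply: measurable_funB; last exact: measurable_piecewise_grad.
    by apply: test_function_measurable; exact: test_function_partial (tf k).
  + move=> k x; apply: le_trans (ler_normB _ _) _; rewrite lerD//.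
    have [iG ->] := partial_w i k (e0 k).
    rewrite -[mollify _ _ _]subr0; apply: mollify_near => // y _.
    rewrite subr0 normrM gtr0_norm ?(lt_trans _ (lam_gt1 k))//.
    by rewrite ler_pM// ltW// (lt_trans _ (lam_gt1 k)).
  + exact: skeleton_negligible.
  + move=> x nx; apply/subr_cvg0.
    have lam0 k : lam k != 0 by rewrite gt_eqF// (lt_trans _ (lam_gt1 k)).
    have ig k : mu.-integrable setT (EFin \o (fun y => piecewise_grad i (dilation x0 (lam k) y))).
      have [iG _] := partial_w i k (e0 k).
      have := @integrableRZl _ _ _ mu _ measurableT (lam k)^-1 _ iG.
      by apply: eq_integrable => // y _; rewrite /= /Gw mulrA mulVf ?mul1r.
    have c : lam k * mollify (e k) (fun y => piecewise_grad i (dilation x0 (lam k) y)) x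
        @[k --> \oo] --> 1 * piecewise_grad i x.
      apply: cvgM; last by apply: mollify_cvg => //; exact: piecewise_grad_continuous.
      rewrite -[X in _ --> X]addr0; apply: cvgD; first exact: cvg_cst.
      exact: cvg_harmonic.
    rewrite mul1r in c; apply: cvg_trans c; apply: near_eq_cvg; apply: nearW => k /=.
    have [iG ->] := partial_w i k (e0 k).
    by rewrite mollifyZ.
Qed.

End fe_space_in_H10.

Lemma fe_space_H10 {R : realType} {d : nat} (Omega : set 'rV[R]_d) (r : nat)
    (Th : seq (@simplex R d)) (v : 'rV[R]_d -> R) : convex_polytopal_domain Omega ->
  conforming_triangulation Omega Th -> fe_space Omega r Th v -> H10 Omega v.
Proof. by move=> pO cT fv; have [[x0 Ox0] _ _] := pO; exact: (@fe_space_H10_from R d Omega r Th v pO cT fv x0 Ox0). Qed.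

(** * The kernel of the Caputo derivative *)

Section finite_exceptions.
Context {R : realType}.
Local Notation mu := (@lebesgue_measure R).

Lemma integrable_eq_off_finite (D : set R) (E : seq R) (f g : R -> R) : measurable D ->
  (forall s, D s -> s \notin E -> f s = g s) -> mu.-integrable D (EFin \o f) ->
  mu.-integrable D (EFin \o g) /\ \int[mu]_(s in D) g s = \int[mu]_(s in D) f s.
Proof.
move=> mD fg intf.
have fE : countable ([set` E] : set R).
  by apply: finite_set_countable; exact: finite_seq.
have mE : measurable ([set` E] : set R) by apply: countable_measurable.
have E0 : mu [set` E] = 0%E by exact: countable_lebesgue_measure0.
have mf : measurable_fun D f by exact: integrable_measurable.
have mg : measurable_fun D g.
  have -> : D = (D `\` [set` E]) `|` (D `&` [set` E]) by rewrite setUC setUIDK.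
  apply/measurable_funU; [exact: measurableD|exact: measurableI|split].
    apply: (@eq_measurable_fun _ _ _ _ _ f); last by apply: measurable_funS mf.
    by move=> s; rewrite inE => -[Ds /= /negP sE]; rewrite fg.
  apply: countable_measurable_fun.
  exact: sub_countable (subset_card_le (@subIsetr _ _ _)) fE.
have mef : measurable_fun D (EFin \o f) by exact/measurable_EFinP.
have meg : measurable_fun D (EFin \o g) by exact/measurable_EFinP.
split; last first.
  rewrite /Rintegral; congr fine; apply: ae_eq_integral => //.
  exists [set` E]; split=> // s /= /not_implyP[Ds gf]; apply: contrapT => /negP sE.
  by apply: gf; rewrite fg.
apply: (@negligible_integrable _ _ _ mu D [set` E] (EFin \o g) mE mD meg E0).2.
have := (@negligible_integrable _ _ _ mu D [set` E] (EFin \o f) mE mD mef E0).1 intf.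
by apply: eq_integrable; [exact: measurableD|move=> s; rewrite inE => -[Ds /= /negP sE]; rewrite /= fg].
Qed.

End finite_exceptions.

Section kernel_normalization.
Context {R : realType}.
Local Notation mu := (@lebesgue_measure R).
Variable al : R.
Hypothesis al01 : 0 < al < 1.

Lemma powR_itv01_integrable : mu.-integrable `]0, 1[ (fun s : R => (s `^ (- al))%:E).
Proof.
have /andP[al0 al1] := al01.
apply/integrableP; split.
  by apply/measurable_EFinP; apply: measurable_funTS; exact: measurable_powR.
have := @integral_powR01_fin R (- al); rewrite ltrN2 => /(_ al1); apply: le_lt_trans.
by rewrite le_eqVlt; apply/orP; left; apply/eqP; apply: eq_integral => s _; rewrite abse_EFin ger0_norm ?powR_ge0.
Qed.

Lemma abel_kernel_integrable (t : R) : 0 < t ->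
  mu.-integrable `]0, t[ (fun s : R => ((t - s) `^ (- al))%:E).
Proof.
move=> t0; have /andP[al0 al1] := al01.
apply/integrableP; split.
  by apply/measurable_EFinP; apply: measurable_funTS; exact: measurable_powR_sub.
under eq_integral do rewrite /= ger0_norm ?powR_ge0//.
have mk (c d : R) : measurable_fun [set: R] (fun s : R => ((c * s + d) `^ (- al))%:E).
  by apply/measurable_EFinP; exact: measurable_powR_affine.
rewrite (@ge0_integral_rescale01 R 0 t (fun s => ((t - s) `^ (- al))%:E))//; last 2 first.
- by apply/measurable_EFinP; exact: measurable_powR_sub.
- by move=> s; rewrite lee_fin powR_ge0.
rewrite subr0 -(@ge0_integral_reflect01 R (fun x => ((t - (t * x + 0)) `^ (- al))%:E)); last 2 first.
- rewrite (_ : (fun _ => _) = (fun x => ((- t * x + t) `^ (- al))%:E))//.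
  by apply/funext => x; congr (_ `^ _)%:E; ring.
- by move=> s; rewrite lee_fin powR_ge0.
have -> : (\int[mu]_(x in `]0%R, 1%R[) ((t - (t * (1 - x) + 0)) `^ (- al))%:E =
    \int[mu]_(x in `]0%R, 1%R[) ((t `^ (- al))%:E * (x `^ (- al))%:E))%E.
  apply: eq_integral => x; rewrite inE/= in_itv/= => /andP[x0 _].
  rewrite -EFinM -powRM ?ltW//.
  by congr (_ `^ _)%:E; ring.
rewrite ge0_integralZl//; last 3 first.
- by apply/measurable_EFinP; apply: measurable_funTS; exact: measurable_powR.
- by move=> x _; rewrite lee_fin powR_ge0.
- by rewrite lee_fin powR_ge0.
have f1 := @integral_powR01_fin R (- al); rewrite ltrN2 in f1.
apply: lte_mul_pinfty => //; first exact: ltW.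
apply: lte_mul_pinfty; [by rewrite lee_fin powR_ge0|by []|exact: f1].
Qed.

(** The integrand is at least [exp (- 1)] on the unit interval.  As real-valued integrals
    are 0 when they diverge, finiteness has to be proved too. *)
Lemma Gamma_gt0 : 0 < Gamma (1 - al).
Proof.
have /andP[al0 al1] := al01.
have p : 1 - al - 1 = - al by ring.
pose g s : R := s `^ (1 - al - 1) * expR (- s).
have mg : measurable_fun [set: R] g.
  apply: measurable_funM; first exact: measurable_powR.
  by apply: measurableT_comp => //; exact: measurable_funN.
have g0 s : 0 <= g s by rewrite mulr_ge0 ?powR_ge0 ?expR_ge0.
have E : `]0, +oo[%classic = `]0, 1[%classic `|` `[1, +oo[%classic :> set R.
  by rewrite -itv_bndbnd_setU// bnd_simp.
have i1 : mu.-integrable `]0, 1[ (EFin \o g).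
  apply: (@le_integrableR _ _ _ mu _ _ _ (fun s => s `^ (- al))) => //.
  - exact: measurable_funTS.
  - move=> s; rewrite /= in_itv/= => /andP[s0 _].
    rewrite !ger0_norm ?powR_ge0// /g p ler_piMr ?powR_ge0//.
    by rewrite -[leRHS]expR0 ler_expR oppr_le0 ltW.
  - exact: powR_itv01_integrable.
have i2 : mu.-integrable `[1, +oo[ (EFin \o g).
  apply: (@le_integrableR _ _ _ mu _ _ _ (exponential_pdf 1)) => //.
  - exact: measurable_funTS.
  - move=> s; rewrite /= in_itv/= andbT => s1.
    have s0 : 0 <= s by rewrite (le_trans _ s1).
    rewrite !ger0_norm ?exponential_pdf_ge0// exponential_pdfE// /g p.
    rewrite [leRHS]mul1r mulN1r ler_piMl ?expR_ge0//.
    by rewrite -[leRHS](powRr0 s) ler_powR// oppr_le0 ltW.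
  - by apply: (integrableS _ _ _ (integrable_exponential_pdf _)) => //; exact: measurable_itv.
have mgE (D : set R) : measurable_fun D (EFin \o g).
  by apply/measurable_EFinP; exact: measurable_funTS.
have eI : (\int[mu]_(s in `]0%R, +oo[) (g s)%:E =
    \int[mu]_(s in `]0%R, 1%R[) (g s)%:E + \int[mu]_(s in `[1%R, +oo[) (g s)%:E)%E.
  rewrite E ge0_integral_setU//.
  - exact: mgE.
  - by move=> s _; rewrite lee_fin.
  - apply/disj_setPS => s [] /=; rewrite !in_itv/= andbT => /andP[_ s1].
    by rewrite leNgt s1.
have fin (D : set R) : mu.-integrable D (EFin \o g) -> (\int[mu]_(s in D) (g s)%:E < +oo)%E.
  move=> /integrableP[_]; apply: le_lt_trans; rewrite le_eqVlt; apply/orP; left; apply/eqP.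
  by apply: eq_integral => s _; rewrite /= ger0_norm.
rewrite /Gamma /Rintegral; apply: fine_gt0; rewrite eI; apply/andP; split; last first.
  by rewrite lte_add_pinfty// fin.
rewrite -[0%E](adde0 0%E); apply: lte_leD => //; last first.
  by apply: integral_ge0 => s _; rewrite lee_fin.
apply: (@lt_le_trans _ _ (expR (-1))%:E); first by rewrite lte_fin expR_gt0.
rewrite -[leLHS]mule1 -[X in (_ * X)%E](_ : mu `]0%R, 1%R[ = _)%E; last first.
  by rewrite lebesgue_measure_itv/= lte_fin ltr01 oppr0 adde0.
rewrite -integral_cst//; apply: ge0_le_integral => //.
- by move=> s _; rewrite lee_fin expR_ge0.
- exact: mgE.
move=> s; rewrite /= in_itv/= => /andP[s0 s1]; rewrite lee_fin /g p.
rewrite -[leLHS]mul1r ler_pM ?expR_ge0//; last by rewrite ler_expR lerN2 ltW.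
rewrite -[leLHS](powRr0 s); apply: ger_powR; first by rewrite s0 ltW.
by rewrite oppr_le0 ltW.
Qed.

Lemma omegaE (s : R) : omega (1 - al) s = s `^ (- al) / Gamma (1 - al).
Proof. by rewrite /omega; congr (_ `^ _ / _); ring. Qed.

End kernel_normalization.

(** * The reconstruction in time *)

Section mesh_facts.
Context {R : realType}.
Variables (T : R) (N : nat) (t : nat -> R).
Hypothesis tM : mesh T N t.

Lemma mesh_lt i j : (i < j)%N -> (j <= N)%N -> t i < t j.
Proof.
have [_ _ tS] := tM; elim: j => // j IH; rewrite ltnS leq_eqVlt => /orP[/eqP ->|ij] jN.
  exact: tS.
by apply: lt_trans (tS _ jN); apply: IH => //; exact: ltnW.
Qed.

Lemma mesh_le i j : (i <= j)%N -> (j <= N)%N -> t i <= t j.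
Proof. by rewrite leq_eqVlt => /orP[/eqP -> //|ij jN]; exact: ltW (mesh_lt ij jN). Qed.

Lemma kstep_gt0 n : (1 <= n <= N)%N -> 0 < kstep t n.
Proof.
by case: n => // n /andP[_ nN]; rewrite /kstep subr_gt0; exact: mesh_lt.
Qed.

Lemma mesh_index_cell n s : (1 <= n <= N)%N -> t n.-1 < s <= t n -> mesh_index N t s = n.
Proof.
move=> /andP[n1 nN] /andP[ts st]; rewrite /mesh_index.
suff -> : (\sum_(j < N) (t j < s)%R)%N = n by exact/maxn_idPr.
have E (j : 'I_N) : (t j < s) = (j < n)%N.
  have [jn|nj] := ltnP j n.
    apply: le_lt_trans ts; apply: mesh_le; first by rewrite -ltnS prednK.
    exact: leq_trans (leq_pred _) nN.
  by apply/negbTE; rewrite -leNgt; apply: le_trans st _; apply: mesh_le => //; exact: ltnW.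
under eq_bigr do rewrite E.
rewrite -big_mkcond/= -(big_mkord (fun j => (j < n)%N) (fun=> 1%N)).
rewrite (big_cat_nat _ nN)//= [X in (_ + X)%N]big1_seq ?addn0; last first.
  by move=> j /andP[jn]; rewrite mem_index_iota leqNgt jn.
rewrite big_nat_cond (eq_bigl (fun j => (0 <= j < n)%N)); last first.
  by move=> j; rewrite andbC; case: (j < n)%N.
by rewrite -big_nat sum_nat_const_nat subn0 muln1.
Qed.

(** The time 0 belongs to no cell, and is attached to the first one. *)
Lemma mesh_index0 : (1 <= N)%N -> mesh_index N t 0 = 1%N.
Proof.
move=> N1; rewrite /mesh_index big1 ?maxn0// => j _.
have [t0 _ _] := tM; rewrite -t0 ltNge mesh_le//; exact: ltnW.
Qed.

Lemma mesh_cell s : 0 < s <= T -> exists2 n, (1 <= n <= N)%N & t n.-1 < s <= t n.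
Proof.
move=> /andP[s0 sT]; have [t0 tN _] := tM.
have ex : exists n, s <= t n by exists N; rewrite tN.
have [n sn min] := ex_minnP ex; exists n.
  rewrite min ?tN// andbT lt0n; apply: contraTneq sn => ->.
  by rewrite t0 -ltNge.
rewrite sn andbT ltNge; apply/negP => /min; rewrite leqNgt => /negP; apply.
by rewrite prednK// lt0n; apply: contraTneq sn => ->; rewrite t0 -ltNge.
Qed.

End mesh_facts.

Section time_reconstruction.
Context {R : realType} {d : nat} {Omega : set 'rV[R]_d}.
Local Notation mu := (@lebesgue_measure R).
Local Notation fct := ('rV[R]_d -> R).
Local Notation L2 := (L2 Omega).
Local Notation nm := (L2norm Omega).
Local Notation "'<| v , w |>" := (L2dot Omega v w).
Variables (T : R) (N : nat) (t : nat -> R).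
Hypothesis tM : mesh T N t.
Hypothesis N1 : (1 <= N)%N.
Variables (Rc : nat -> fct -> fct) (U : nat -> fct).
Local Notation W j := (Rc j (U j)).
Local Notation UR := (space_time_reconstruction N t U Rc).

Definition slope (n : nat) : fct := (kstep t n)^-1 *: (W n - W n.-1).

(** The left end point belongs to the previous cell, whose interpolant takes the
    same value there. *)
Lemma reconstruction_cell n s : (1 <= n <= N)%N -> t n.-1 <= s <= t n ->
  UR s = ((t n - s) / kstep t n) *: W n.-1 + ((s - t n.-1) / kstep t n) *: W n.
Proof.
move=> nN /andP[ts st]; have k0 := kstep_gt0 tM nN; have /andP[n1 nN'] := nN.
have [tsE|ts'] := eqVneq (t n.-1) s; last first.
  have E : mesh_index N t s = n by apply: (mesh_index_cell tM nN); rewrite lt_neqAle ts' ts.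
  by rewrite /space_time_reconstruction E.
have kn : t n - s = kstep t n by rewrite -tsE.
rewrite -[s in (s - t n.-1)]tsE subrr mul0r scale0r addr0 kn divff ?gt_eqF// scale1r -tsE.
case: n nN n1 nN' {ts st k0 tsE kn} => // -[|n] _ _ nN.
  have [t0 _ _] := tM; rewrite /space_time_reconstruction /= t0 (mesh_index0 tM N1)/= t0.
  have k1 : kstep t 1%N = t 1%N by rewrite /kstep /= t0 subr0.
  have k10 : kstep t 1%N != 0 by rewrite gt_eqF// (kstep_gt0 tM).
  by rewrite subrr mul0r scale0r addr0 subr0 -k1 divff// scale1r.
have nN' : (1 <= n.+1 <= N)%N by rewrite /= ltnW.
have k0 : kstep t n.+1 != 0 by rewrite gt_eqF// (kstep_gt0 tM).
rewrite /space_time_reconstruction /= (mesh_index_cell tM nN'); last first.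
  by rewrite lexx andbT; apply: (mesh_lt tM) => //; exact: ltnW.
by rewrite subrr mul0r scale0r add0r -/(kstep t n.+1) divff// scale1r.
Qed.

Lemma reconstruction_increment n a b : (1 <= n <= N)%N -> t n.-1 <= a <= t n ->
  t n.-1 <= b <= t n -> UR a - UR b = (a - b) *: slope n.
Proof.
move=> nN an bn; rewrite !(reconstruction_cell nN)//; have k0 := kstep_gt0 tM nN.
apply/funext => x; rewrite /slope.
rewrite -[LHS]/((t n - a) / kstep t n * W n.-1 x + (a - t n.-1) / kstep t n * W n x -
  ((t n - b) / kstep t n * W n.-1 x + (b - t n.-1) / kstep t n * W n x)).
rewrite -[RHS]/((a - b) * ((kstep t n)^-1 * (W n x - W n.-1 x))).
by field; rewrite gt_eqF.
Qed.

Lemma reconstruction_cell_exists s : 0 <= s <= T ->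
  exists2 n, (1 <= n <= N)%N & t n.-1 <= s <= t n.
Proof.
move=> /andP[s0 sT]; have [->|sn] := eqVneq s 0.
  exists 1%N => //=; have [t0 _ _] := tM.
  by rewrite -t0 lexx (mesh_le tM).
have [n nN /andP[h1 h2]] : exists2 n, (1 <= n <= N)%N & t n.-1 < s <= t n.
  by apply: (mesh_cell tM); rewrite lt_def sn s0.
by exists n => //; rewrite ltW.
Qed.

Hypothesis LW : forall j, (j <= N)%N -> L2 (W j).

Lemma slope_L2 n : (n <= N)%N -> L2 (slope n).
Proof. by move=> nN; have := LW nN; have := LW (leq_trans (leq_pred n) nN). Qed.

Lemma reconstruction_L2 s : 0 <= s <= T -> L2 (UR s).
Proof.
move=> /reconstruction_cell_exists[n nN ns]; rewrite (reconstruction_cell nN ns).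
have /andP[_ nN'] := nN.
by have := LW nN'; have := LW (leq_trans (leq_pred n) nN').
Qed.

(** Lipschitz on each cell with a constant common to all cells, hence on the whole
    interval. *)
Lemma reconstruction_continuous : Defs.norm_continuous nm `[0, T] UR.
Proof.
pose C := \sum_(1 <= n < N.+1) nm (slope n).
have C0 : 0 <= C by apply: sumr_ge0 => n _; exact: L2norm_ge0.
have C_ge n : (1 <= n <= N)%N -> nm (slope n) <= C.
  move=> nN; rewrite /C (big_rem n)/=; last by rewrite mem_index_iota ltnS.
  by rewrite lerDl; apply: sumr_ge0 => *; exact: L2norm_ge0.
have lip a b : 0 <= a <= b -> b <= T -> nm (UR b - UR a) <= C * (b - a) /\
    nm (UR a - UR b) <= C * (b - a).
  move=> /andP[a0 ab] bT.
  have Iab x : a <= x <= b -> 0 <= x <= T.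
    by move=> /andP[h1 h2]; rewrite (le_trans a0 h1) (le_trans h2 bT).
  have La : L2 (UR a) by apply: reconstruction_L2; apply: Iab; rewrite lexx.
  have Lb : L2 (UR b) by apply: reconstruction_L2; apply: Iab; rewrite lexx ab.
  suff h : nm (UR b - UR a) <= C * (b - a) by split=> //; rewrite L2norm_distC.
  pose cell n : set R := [set s | (1 <= n <= N)%N /\ a <= s <= b /\ t n.-1 <= s <= t n].
  have := @lipschitz_closed_cover R nat (index_iota 1 N.+1) cell (fun s => nm (UR s - UR a)) C a b ab.
  rewrite subrr L2norm0 subr0 ger0_norm ?L2norm_ge0//; apply.
  - move=> n; rewrite /cell; have [nN|nN] := boolP (1 <= n <= N)%N; last first.
      rewrite (_ : [set _ | _] = set0); first exact: closed0.
      by apply/seteqP; split => // s [].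
    rewrite (_ : [set _ | _] = `[a, b]%classic `&` `[t n.-1, t n]%classic).
      by apply: closedI; exact: interval_closed.
    by apply/seteqP; split => s /=; rewrite !in_itv/= => -[] // _ [].
  - move=> n x y [nN [xI xn]] [_ [yI yn]].
    have Lx := reconstruction_L2 (Iab _ xI); have Ly := reconstruction_L2 (Iab _ yI).
    have /andP[_ nN'] := nN.
    apply: (@le_trans _ _ (nm (UR y - UR x))).
      have h1 := L2norm_triangleB Ly La Lx; have h2 := L2norm_triangleB Lx La Ly.
      rewrite (L2norm_distC Lx Ly) in h2.
      by rewrite ler_norml; apply/andP; split; lra.
    rewrite (reconstruction_increment nN yn xn) L2normZ; last exact: slope_L2.
    by rewrite mulrC ler_wpM2r// C_ge.
  - move=> x xI; have [n nN xn] := reconstruction_cell_exists (Iab _ xI).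
    by exists n; [rewrite mem_index_iota ltnS|].
move=> s; rewrite /= in_itv/= => /andP[s0 sT].
have c : C * `|r - s| @[r --> within `[0, T] (nbhs s)] --> (0 : R).
  rewrite -[X in _ --> X](mulr0 C); apply: cvgM; first exact: cvg_cst.
  rewrite -[X in _ --> X](normr0 R) -[X in `|X|](subrr s).
  apply: cvg_norm; apply: cvgB; last exact: cvg_cst.
  exact: cvg_within.
apply: (squeeze_cvgr _ (cvg_cst 0) c); near=> r.
have : `[0, T]%classic r by near: r; exact: withinT.
rewrite /= in_itv/= => /andP[r0 rT]; rewrite L2norm_ge0/=.
have [sr|/ltW rs] := leP s r.
  have [|//|h _] := lip s r; first by rewrite s0.
  by rewrite [`|_|]ger0_norm ?subr_ge0.
have [|//|_ h] := lip r s; first by rewrite r0.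
by rewrite distrC [`|_|]ger0_norm ?subr_ge0.
Unshelve. all: by end_near. Qed.

(** The time derivative of the reconstruction, off the mesh points. *)
Definition drift (s : R) : fct :=
  \sum_(1 <= n < N.+1) \1_(`]t n.-1, t n] : set R) s *: slope n.

Lemma drift_cell n s : (1 <= n <= N)%N -> t n.-1 < s <= t n -> drift s = slope n.
Proof.
move=> nN ns; have /andP[n1 nN'] := nN.
rewrite /drift (bigD1_seq n) ?iota_uniq ?mem_index_iota ?ltnS//=.
rewrite indicE mem_set ?in_itv//= scale1r big1_seq ?addr0// => j.
rewrite mem_index_iota ltnS => /andP[jn jN].
rewrite indicE memNset ?scale0r//= in_itv/= => js.
by move: jn; rewrite -(mesh_index_cell tM nN ns) -(mesh_index_cell tM jN js) eqxx.
Qed.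

Lemma drift_L2 s : L2 (drift s).
Proof.
rewrite /drift big_seq; elim/big_ind: _ => [|v w Lv Lw|n].
- exact: L2_0.
- exact: L2D.
- by rewrite mem_index_iota ltnS => /andP[_ nN]; apply: L2Z; exact: slope_L2.
Qed.

Definition mesh_points : seq R := [seq t n | n <- iota 0 N.+1].

Lemma mesh_cell_oo s : 0 < s < T -> s \notin mesh_points ->
  exists2 n, (1 <= n <= N)%N & t n.-1 < s < t n.
Proof.
move=> /andP[s0 sT] sE.
have [n nN /andP[h1 h2]] : exists2 n, (1 <= n <= N)%N & t n.-1 < s <= t n.
  by apply: (mesh_cell tM); rewrite s0 ltW.
exists n => //; rewrite h1 lt_neqAle h2 andbT; apply: contraNneq sE => ->.
by apply: map_f; rewrite mem_iota add0n ltnS; case/andP: nN.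
Qed.

Lemma near_cell n s : t n.-1 < s < t n -> \forall r \near s, t n.-1 < r < t n.
Proof.
move=> sn; have : nbhs s `]t n.-1, t n[%classic.
  by apply: near_in_itvoo; rewrite in_itv.
by apply: filterS => r /=; rewrite in_itv.
Qed.

Lemma reconstruction_derive s : 0 < s < T -> s \notin mesh_points ->
  norm_derive nm UR s (drift s) /\ nm (drift r - drift s) @[r --> s] --> (0 : R).
Proof.
move=> sT sE; have [n nN sn] := mesh_cell_oo sT sE; have /andP[h1 h2] := sn.
have E r : t n.-1 < r < t n -> drift r = slope n.
  by move=> /andP[r1 r2]; apply: drift_cell; rewrite // r1 ltW.
split; last first.
  apply: cvg_near_cst; apply: filterS (near_cell sn) => r rn.
  by rewrite (E r rn) (E s sn) subrr L2norm0.
apply: cvg_near_cst.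
have nh : \forall h \near (0 : R)^', t n.-1 < s + h < t n.
  apply: nbhs_dnbhs; have := near_cell sn.
  by rewrite (near_shift 0 s) => /=; apply: filterS => h /=; rewrite subr0 addrC.
near=> h.
have h0 : h != 0 by near: h; exact: nbhs_dnbhs_neq.
have /andP[r1 r2] : t n.-1 < s + h < t n by near: h.
rewrite (reconstruction_increment nN) ?ltW//.
rewrite (E s sn) [s + h - s]addrAC subrr add0r scalerA mulVf// scale1r subrr.
exact: L2norm0.
Unshelve. all: by end_near. Qed.

End time_reconstruction.

(** * Caputo derivatives along paths of square integrable functions *)

Section caputo_derivatives.
Context {R : realType} {d : nat} {Omega : set 'rV[R]_d}.
Local Notation mu := (@lebesgue_measure R).
Local Notation fct := ('rV[R]_d -> R).
Local Notation L2 := (L2 Omega).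
Local Notation nm := (L2norm Omega).
Local Notation "'<| v , w |>" := (L2dot Omega v w).

Lemma L2dot_suml (I : eqType) (s : seq I) (a : I -> R) (F : I -> fct) (g : fct) : L2 g ->
  (forall i, i \in s -> L2 (F i)) ->
  L2 (\sum_(i <- s) a i *: F i) /\
  '<|\sum_(i <- s) a i *: F i, g|> = \sum_(i <- s) a i * '<|F i, g|>.
Proof.
move=> Lg; elim: s => [|i s IH] LF; first by rewrite !big_nil L2dot0l; split=> //; exact: L2_0.
have [Ls IHs] := IH (fun j js => LF j (mem_behead (s := i :: s) js)).
have Li := LF i (mem_head _ _).
rewrite !big_cons -IHs; split; first exact: L2_lincomb.
exact: L2dot_lincombl.
Qed.

(** Two limits in norm of the same difference quotients. *)
Lemma norm_derive_unique (v : R -> fct) (s : R) (a b : fct) : L2 a -> L2 b ->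
  (\forall h \near (0 : R)^', L2 (v (s + h))) -> L2 (v s) ->
  norm_derive nm v s a -> norm_derive nm v s b -> nm (a - b) = 0.
Proof.
move=> La Lb Lv Ls da db.
have c : nm (h^-1 *: (v (s + h) - v s) - a) + nm (h^-1 *: (v (s + h) - v s) - b)
    @[h --> (0 : R)^'] --> (0 + 0 : R) by exact: cvgD.
rewrite addr0 in c.
apply/eqP; rewrite eq_le L2norm_ge0 andbT.
apply: (ler_cvg_to (cvg_cst (nm (a - b))) c); near=> h.
have Lh : L2 (v (s + h)) by near: h.
have Lq : L2 (h^-1 *: (v (s + h) - v s)) by [].
by rewrite (L2norm_distC Lq La); exact: L2norm_triangleB.
Unshelve. all: by end_near. Qed.

Lemma norm_continuousS (I J : set R) (v : R -> fct) : I `<=` J ->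
  Defs.norm_continuous nm J v -> Defs.norm_continuous nm I v.
Proof.
move=> IJ cv s Is; apply: cvg_trans (cv s (IJ s Is)).
by apply: cvg_app => P; exact: (filterS (F := nbhs s) (fun r h Ir => h (IJ r Ir))).
Qed.

Lemma measurable_norm_path (w : R -> fct) (E : seq R) (a b : R) :
  (forall s, a < s < b -> L2 (w s)) ->
  (forall s, a < s < b -> s \notin E -> nm (w r - w s) @[r --> s] --> (0 : R)) ->
  measurable_fun `]a, b[ (fun s => nm (w s)).
Proof.
move=> Lw cw; apply: (measurable_fun_continuous_off (E := E)) => s sab sE.
have Ls := Lw s sab.
apply/subr_cvg0/norm_cvg0P; apply: (squeeze_cvgr _ (cvg_cst 0) (cw s sab sE)).
have nr : \forall r \near s, a < r < b.
  have : nbhs s `]a, b[%classic by apply: near_in_itvoo; rewrite in_itv.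
  by apply: filterS => r /=; rewrite in_itv.
near=> r; rewrite normr_ge0/=.
have Lr : L2 (w r) by apply: Lw; near: r.
have h1 := L2norm_triangle (L2B Lr Ls) Ls; have h2 := L2norm_triangle (L2B Ls Lr) Lr.
rewrite !subrK in h1 h2; rewrite (L2norm_distC Ls Lr) in h2.
by rewrite ler_norml; apply/andP; split; lra.
Unshelve. all: by end_near. Qed.

Variable al : R.
Hypothesis al01 : 0 < al < 1.

Lemma caputoP (v : R -> fct) (t : R) : (exists w, is_caputo al Omega v t w) ->
  is_caputo al Omega v t (caputo al Omega v t).
Proof. exact: xgetPex. Qed.

(** The derivative in the definition of the Caputo derivative may be replaced by any
    other one, since both agree in norm off a finite set. *)
Lemma is_caputo_any_derivative (v dv : R -> fct) (t : R) (w : fct) (E : seq R) :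
  is_caputo al Omega v t w -> (forall s, 0 < s < t -> L2 (dv s)) ->
  (forall s, 0 < s < t -> s \notin E -> norm_derive nm v s (dv s)) ->
  mu.-integrable `]0, t[ (fun s => (omega (1 - al) (t - s) * nm (dv s))%:E) /\
  forall g, L2 g ->
    mu.-integrable `]0, t[ (fun s => (omega (1 - al) (t - s) * '<|dv s, g|>)%:E) /\
    '<|w, g|> = \int[mu]_(s in `]0, t[) (omega (1 - al) (t - s) * '<|dv s, g|>).
Proof.
move=> [Lw Lv cv [v' [E' [Lv' dv' iv' pv']]]] Ldv ddv.
have mI : measurable (`]0, t[ : set R)%classic by exact: measurable_itv.
have eq0 s : 0 < s < t -> s \notin E' ++ E -> nm (v' s - dv s) = 0.
  move=> st; rewrite mem_cat => /norP[sE' sE].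
  apply: (norm_derive_unique (Lv' s st) (Ldv s st) _ _ (dv' s st sE') (ddv s st sE)).
    by apply: filterS (near_shift_itv st) => h; exact: Lv.
  by apply: Lv; case/andP: st => *; apply/andP; split; exact: ltW.
split.
  apply: (integrable_eq_off_finite (E := E' ++ E) mI _ iv').1 => s.
  rewrite /= in_itv/= => st sE; congr (_ * _).
  by apply: L2norm_eq0_trans (eq0 s st sE); [exact: Lv'|exact: Ldv].
move=> g Lg; have [ig ->] := pv' g Lg.
have H s : `]0, t[%classic s -> s \notin E' ++ E ->
    omega (1 - al) (t - s) * '<|v' s, g|> = omega (1 - al) (t - s) * '<|dv s, g|>.
  rewrite /= in_itv/= => st sE; congr (_ * _).
  have L1 := Lv' s st; have L2s := Ldv s st.
  apply/eqP; rewrite -subr_eq0 -L2dotBl//; apply/eqP.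
  by apply: L2dot_norm0l => //; exact: eq0.
by have [ig' ->] := integrable_eq_off_finite mI H ig.
Qed.

Section reconstruction.
Variables (T : R) (N : nat) (t : nat -> R).
Hypothesis tM : mesh T N t.
Hypothesis N1 : (1 <= N)%N.
Variables (Rc : nat -> fct -> fct) (U : nat -> fct).
Hypothesis LW : forall j, (j <= N)%N -> L2 (Rc j (U j)).
Local Notation UR := (space_time_reconstruction N t U Rc).
Local Notation drift := (drift N t Rc U).
Local Notation slope := (slope t Rc U).

Lemma omega_integrable (tau : R) : 0 < tau ->
  mu.-integrable `]0, tau[ (EFin \o (fun s : R => omega (1 - al) (tau - s))).
Proof.
move=> tau0; under [X in integrable _ _ X]eq_fun do rewrite /= omegaE mulrC.
exact: (@integrableRZl _ _ _ mu _ (measurable_itv _) _ _ (abel_kernel_integrable al01 tau0)).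
Qed.

Lemma omega_ge0 (s : R) : 0 <= omega (1 - al) s.
Proof. by rewrite omegaE divr_ge0 ?powR_ge0// ltW// Gamma_gt0. Qed.

(** The derivative in time is a step function, so that the Caputo derivative is a
    combination of the slopes with the integrals of the kernel over the cells. *)
Lemma reconstruction_caputo (tau : R) : 0 < tau <= T ->
  exists w, is_caputo al Omega UR tau w.
Proof.
move=> /andP[tau0 tauT].
have mI : measurable (`]0, tau[ : set R)%classic by exact: measurable_itv.
have iom := omega_integrable tau0.
have mom : measurable_fun `]0, tau[ (fun s : R => omega (1 - al) (tau - s)).
  exact: integrable_measurable iom.
have sub s : 0 < s < tau -> 0 < s < T.
  by move=> /andP[-> h] /=; exact: lt_le_trans tauT.
have Ldr s : L2 (drift s) by exact: (drift_L2 t LW s).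
pose chi n : R -> R := \1_(`]t n.-1, t n]%classic : set R).
have mchi n : measurable_fun (`]0, tau[%classic : set (measurableTypeR R))
    (chi n : measurableTypeR R -> R).
  by apply: measurable_funTS; apply: measurable_indic; exact: measurable_itv.
have chi1 n s : `|chi n s| <= 1.
  by rewrite /chi indicE; case: (_ \in _); rewrite ?normr1 ?normr0.
have ioc n : mu.-integrable `]0, tau[ (EFin \o (fun s : R => omega (1 - al) (tau - s) * chi n s)).
  apply: (@le_integrableR _ _ _ mu _ _ _ (fun s => omega (1 - al) (tau - s))) => //.
    exact: measurable_funM.
  by move=> s _; rewrite normrM ler_piMr.
pose c n := \int[mu]_(s in `]0, tau[) (omega (1 - al) (tau - s) * chi n s).
have Lsl n : n \in index_iota 1 N.+1 -> L2 (slope n).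
  by rewrite mem_index_iota ltnS => /andP[_ nN]; exact: (slope_L2 _ LW nN).
exists (\sum_(1 <= n < N.+1) c n *: slope n); split.
- by have [] := L2dot_suml c (@L2_0 _ _ Omega) Lsl.
- move=> s /andP[s0 st]; apply: (reconstruction_L2 tM N1 LW).
  by rewrite s0 (le_trans st).
- apply: norm_continuousS (reconstruction_continuous tM N1 LW) => r.
  by rewrite /= !in_itv/= => /andP[-> h]; exact: le_trans tauT.
exists drift, (mesh_points N t); split => [s _|s st sE||g Lg].
- exact: Ldr.
- by have [] := @reconstruction_derive _ _ Omega _ _ _ tM N1 Rc U s (sub s st) sE.
- pose C := \sum_(1 <= n < N.+1) nm (slope n).
  apply: (@le_integrableR _ _ _ mu _ _ _ (fun s => C * omega (1 - al) (tau - s))) => //.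
  + apply: measurable_funM => //; apply: (@measurable_norm_path _ (mesh_points N t)).
      by [].
    by move=> s st sE; have [] := @reconstruction_derive _ _ Omega _ _ _ tM N1 Rc U s (sub s st) sE.
  + move=> s _; rewrite mulrC !normrM ler_wpM2r// ger0_norm ?L2norm_ge0//.
    apply: le_trans (ler_norm _).
    rewrite /drift /C.
    have : forall r, {subset r <= index_iota 1 N.+1} ->
      nm (\sum_(n <- r) chi n s *: slope n) <= \sum_(n <- r) nm (slope n).
      elim=> [_|n r IH sr]; first by rewrite !big_nil L2norm0.
      have Ln : L2 (slope n) by apply: Lsl; apply: sr; exact: mem_head.
      have sr' : {subset r <= index_iota 1 N.+1}.
        by move=> m mr; apply: sr; rewrite inE mr orbT.
      have [Lr _] := L2dot_suml (chi^~ s) (@L2_0 _ _ Omega) (fun m mr => Lsl m (sr' m mr)).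
      rewrite !big_cons; apply: le_trans (L2norm_triangle _ _) _ => //.
      rewrite lerD//; last exact: IH.
      by rewrite L2normZ// ler_piMl ?L2norm_ge0.
    by apply.
  + exact: (@integrableRZl _ _ _ mu).
- have E : (fun s => omega (1 - al) (tau - s) * '<|drift s, g|>) =
      (fun s => \sum_(n <- index_iota 1 N.+1) '<|slope n, g|> * (omega (1 - al) (tau - s) * chi n s)).
    apply/funext => s; have [_ ->] := L2dot_suml (chi^~ s) Lg Lsl.
    by rewrite mulr_sumr; apply: eq_bigr => n _; rewrite mulrA mulrC.
  have iz n : mu.-integrable `]0, tau[ (EFin \o (fun s => '<|slope n, g|> *
      (omega (1 - al) (tau - s) * chi n s))) by exact: (@integrableRZl _ _ _ mu).
  have [h1 h2] := @Rintegral_bigsum _ _ _ mu _ mI _ (index_iota 1 N.+1) _ iz.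
  rewrite -E in h1; split; first exact: h1.
  rewrite E h2; have [_ ->] := L2dot_suml c Lg Lsl.
  by apply: eq_bigr => n _; rewrite RintegralZl// mulrC.
Qed.

End reconstruction.
End caputo_derivatives.

(** * The error estimate *)

Section path_differences.
Context {R : realType} {d : nat} {Omega : set 'rV[R]_d}.
Local Notation fct := ('rV[R]_d -> R).
Local Notation L2 := (L2 Omega).
Local Notation nm := (L2norm Omega).

Lemma norm_derive_H1_L2 (v : R -> fct) (s : R) (w : fct) :
  norm_derive (H1norm Omega) v s w -> norm_derive nm v s w.
Proof. exact: L2_cvg_H1. Qed.

Lemma cvg_normB (F : set_system R) {FF : Filter F} (v w : R -> fct) :
  (\forall r \near F, L2 (v r)) -> (\forall r \near F, L2 (w r)) ->
  nm (v r) @[r --> F] --> (0 : R) -> nm (w r) @[r --> F] --> (0 : R) ->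
  nm (v r - w r) @[r --> F] --> (0 : R).
Proof.
move=> Lv Lw cv cw.
have c : nm (v r) + nm (w r) @[r --> F] --> (0 + 0 : R) by exact: cvgD.
rewrite addr0 in c; apply: (squeeze_cvgr _ (cvg_cst 0) c); near=> r.
have L1 : L2 (v r) by near: r.
have L2r : L2 (w r) by near: r.
by rewrite L2norm_ge0/= -(L2normN L2r); apply: L2norm_triangle.
Unshelve. all: by end_near. Qed.

Lemma norm_deriveB (v w : R -> fct) (s : R) (dv dw : fct) : L2 dv -> L2 dw ->
  (\forall h \near (0 : R)^', L2 (v (s + h)) /\ L2 (w (s + h))) -> L2 (v s) -> L2 (w s) ->
  norm_derive nm v s dv -> norm_derive nm w s dw ->
  norm_derive nm (fun r => v r - w r) s (dv - dw).
Proof.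
move=> Ldv Ldw Lvw Lv Lw hv hw.
have E (h : R) : h^-1 *: (v (s + h) - w (s + h) - (v s - w s)) - (dv - dw) =
    (h^-1 *: (v (s + h) - v s) - dv) - (h^-1 *: (w (s + h) - w s) - dw).
  apply/funext => x.
  rewrite -[LHS]/(h^-1 * (v (s + h) x - w (s + h) x - (v s x - w s x)) - (dv x - dw x)).
  by rewrite -[RHS]/((h^-1 * (v (s + h) x - v s x) - dv x) -
    (h^-1 * (w (s + h) x - w s x) - dw x)); ring.
rewrite /norm_derive; under eq_fun do rewrite E.
by apply: cvg_normB hv hw; apply: filterS Lvw => h [].
Qed.

Lemma norm_continuousB (I : set R) (v w : R -> fct) :
  (forall s, I s -> L2 (v s)) -> (forall s, I s -> L2 (w s)) ->
  Defs.norm_continuous nm I v -> Defs.norm_continuous nm I w ->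
  Defs.norm_continuous nm I (fun s => v s - w s).
Proof.
move=> Lv Lw cv cw s Is.
have E r : v r - w r - (v s - w s) = (v r - v s) - (w r - w s).
  apply/funext => x; rewrite -[LHS]/(v r x - w r x - (v s x - w s x)).
  by rewrite -[RHS]/((v r x - v s x) - (w r x - w s x)); ring.
under eq_fun do rewrite E.
have Ls := Lv s Is; have Ls' := Lw s Is.
have nI : \forall r \near within I (nbhs s), I r by exact: withinT.
apply: cvg_normB (cv s Is) (cw s Is); apply: filterS nI => r Ir.
- by have := Lv r Ir.
- by have := Lw r Ir.
Qed.

End path_differences.

Section H10_combinations.
Context {R : realType} {d : nat} {Omega : set 'rV[R]_d} {A : 'rV[R]_d -> 'M[R]_d}.
Local Notation fct := ('rV[R]_d -> R).
Implicit Types (v w f : fct).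

Lemma H100 : H10 Omega (0 : fct).
Proof. by apply: H10_test; exact: test_function0. Qed.

Lemma H10_comb (a b : R) v w : H10 Omega v -> H10 Omega w -> H10 Omega (a *: v + b *: w).
Proof.
move=> Hv Hw; apply: H10_lincomb => //.
by rewrite -[b *: w]addr0; apply: H10_lincomb => //; exact: H100.
Qed.

Lemma H10B v w : H10 Omega v -> H10 Omega w -> H10 Omega (v - w).
Proof. by move=> Hv Hw; rewrite -[v]scale1r -scaleN1r; exact: H10_comb. Qed.

Hypothesis cA : bounded_coefficients (Omega := Omega) A.

Lemma aform_comb (a b : R) v w f : H10 Omega v -> H10 Omega w -> H10 Omega f ->
  aform Omega A (a *: v + b *: w) f = a * aform Omega A v f + b * aform Omega A w f.
Proof.
move=> Hv Hw Hf; have H0 := H100.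
have a0 : aform Omega A 0 f = 0.
  have := aform_lincombl cA 1 H0 H0 Hf; rewrite scaler0 addr0 mul1r => h.
  by apply: (addrI (aform Omega A 0 f)); rewrite addr0 -h.
have bw : aform Omega A (b *: w) f = b * aform Omega A w f.
  by have := aform_lincombl cA b Hw H0 Hf; rewrite addr0 a0 addr0.
have Hbw : H10 Omega (b *: w) by rewrite -[b *: w]addr0; exact: H10_lincomb.
by rewrite (aform_lincombl cA a Hv Hbw Hf) bw.
Qed.

Lemma aformB v w f : H10 Omega v -> H10 Omega w -> H10 Omega f ->
  aform Omega A (v - w) f = aform Omega A v f - aform Omega A w f.
Proof.
move=> Hv Hw Hf; have := aform_comb 1 (-1) Hv Hw Hf.
by rewrite scale1r scaleN1r mul1r mulN1r.
Qed.

End H10_combinations.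

Section constants.
Context {R : realType}.

(** The sine is at most 1, and so is the cosine, which is raised to a negative power. *)
Lemma sector_constant_ge (al theta Gam : R) : 0 < al < 1 -> 0 < Gam -> 0 < theta < pi / 2 ->
  Gam / pi <= (sin theta)^-1 *
    (pi^-1 * cos (Num.max 0 (pi - (pi - theta) / al)) `^ (al - 1) * Gam).
Proof.
move=> /andP[al0 al1] G0 /andP[th0 th1]; have pi0 := pi_gt0 R.
set phi := Num.max _ _.
have phi0 : 0 <= phi by rewrite le_max lexx.
have phi1 : phi < pi / 2.
  rewrite /phi gt_max divr_gt0//= ltrBlDr -ltrBlDl.
  have h : (pi - theta) < (pi - theta) / al.
    by rewrite ltr_pdivlMr// gtr_pMr// subr_gt0; lra.
  lra.
have c0 : 0 < cos phi by apply: cos_gt0_pihalf; rewrite phi1 andbT; lra.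
have c1 : cos phi <= 1 := cos_le1 phi.
have s0 : 0 < sin theta by apply: sin_gt0_pi; apply/andP; split; lra.
have s1 : sin theta <= 1 := sin_le1 theta.
have p1 : 1 <= cos phi `^ (al - 1).
  by rewrite -[leLHS](powRr0 (cos phi)); apply: ger_powR; [rewrite c0|lra].
have -> : (sin theta)^-1 * (pi^-1 * cos phi `^ (al - 1) * Gam) =
    Gam / pi * ((sin theta)^-1 * cos phi `^ (al - 1)) by ring.
rewrite ler_peMr ?divr_ge0// ?(ltW G0) ?(ltW pi0)//.
by rewrite -[leLHS]mul1r ler_pM// invf_ge1.
Qed.

End constants.
(** The difference of the tested equations, once the coercive term is
    dropped, leaves minus the three residuals [x1], [x2], [x3]. *)
Lemma tested_error_bound (R : realFieldType)
    (Du DR au aR eR lf x1 x2 x3 n1 n2 n3 n4 n : R) :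
  Du + au = lf -> 0 <= au - aR -> aR = eR -> x1 + x2 + x3 = DR + eR - lf ->
  `|x1| <= n1 * n -> `|x2| <= n2 * n -> `|x3| <= n3 * n -> 0 <= n4 * n ->
  Du - DR <= (n1 + n2 + n3 + n4) * n.
Proof.
move=> e1 a0 eq sum h1 h2 h3 h4.
have := ler_norm (- x1); have := ler_norm (- x2); have := ler_norm (- x3).
rewrite !normrN !mulrDl; lra.
Qed.

Theorem theorem4p4 (R : realType) (d r N : nat)
    (alpha T eta beta theta : R)
    (Omega : set 'rV[R]_d) (A : 'rV[R]_d -> 'M[R]_d)
    (f u : R -> 'rV[R]_d -> R) (u0 : 'rV[R]_d -> R)
    (t : nat -> R) (Th : nat -> seq (@simplex R d))
    (P0 Ah Rc : nat -> ('rV[R]_d -> R) -> ('rV[R]_d -> R))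
    (Pi : nat -> nat -> ('rV[R]_d -> R) -> ('rV[R]_d -> R))
    (U : nat -> 'rV[R]_d -> R) :
  let V n := fe_space Omega r (Th n) in
  let fh n := P0 n (f (t n)) in
  let UR s := space_time_reconstruction N t U Rc s in
  let rho s := u s - UR s in
  let phi := Num.max 0 (pi - (pi - theta) / alpha) in
  let C := pi^-1 * cos phi `^ (alpha - 1) * Gamma (1 - alpha) in
  (0 < d)%N -> (1 <= r)%N -> (1 <= N)%N ->
  0 < alpha < 1 -> 0 < T ->
  convex_polytopal_domain Omega ->
  (exists W, [/\ open W, closure Omega `<=` W
     & forall i j, smooth_on W (fun x => A x i j)]) ->
  elliptic_spd Omega A ->
  0 < eta -> 0 < beta ->
  (forall v, H10 Omega v ->
     eta * H1norm Omega v ^+ 2 <= aform Omega A v v) ->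
  (forall v w, H10 Omega v -> H10 Omega w ->
     `|aform Omega A v w| <= beta * H1norm Omega v * H1norm Omega w) ->
  C0_L2 Omega T f ->
  fractional_solution alpha T Omega A f u0 u ->
  mesh T N t ->
  (forall n, (n <= N)%N -> conforming_triangulation Omega (Th n)) ->
  (exists sigma, forall n, (n <= N)%N ->
     forall K, K \in Th n -> shape_regular sigma K) ->
  (forall n, (n <= N)%N -> L2_projection Omega (V n) (P0 n)) ->
  (forall j n, (j <= N)%N -> (n <= N)%N ->
     forall v, V j v -> V n (Pi j n v)) ->
  (forall n, (n <= N)%N -> discrete_elliptic Omega A (V n) (Ah n)) ->
  (forall n, (n <= N)%N ->
     elliptic_reconstruction Omega A (V n) (Ah n) (Rc n)) ->
  L1_scheme alpha N t Pi U Ah fh V ->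
  elliptic_dom Omega A (rho 0) ->
  0 < theta < pi / 2 ->
  forall n s, (1 <= n <= N)%N -> t n.-1 < s <= t n ->
  ((L2norm Omega (rho s))%:E <=
   (L2norm Omega (rho 0%R))%:E +
   ((sin theta)^-1 * C)%R%:E *
   \int[@lebesgue_measure R]_(tau in `]0%R, s[)
     ((s - tau) `^ (alpha - 1) *
      (let m := mesh_index N t tau in
       L2norm Omega (caputo alpha Omega UR tau - L1_derive alpha t Pi U m) +
       L2norm Omega (elliptic_op Omega A (UR tau) - Ah m (U m)) +
       L2norm Omega (fh m - f tau) +
       L2norm Omega (elliptic_op Omega A (rho 0))))%R%:E)%E.
Proof.
move=> V fh UR rho phi C d0 r1 N1 al01 T0 pO smA spd eta0 beta0 coer contA Cf sol tM cT sr
  P0p PiV Ahp Rcp L1 dom thI n s nN ns.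
have cA := smooth_bounded_coefficients pO smA.
have [VU L1eq] := L1.
have V_H10 j v : (j <= N)%N -> V j v -> H10 Omega v.
  by move=> jN; exact: fe_space_H10 pO (cT j jN).
have HW j : (j <= N)%N -> H10 Omega (Rc j (U j)).
  by move=> jN; have [] := Rcp j jN (U j) (VU j jN).
have aW j f' : (j <= N)%N -> H10 Omega f' ->
    aform Omega A (Rc j (U j)) f' = L2dot Omega (Ah j (U j)) f'.
  by move=> jN Hf; have [_] := Rcp j jN (U j) (VU j jN); exact.
have VAh j : (j <= N)%N -> V j (Ah j (U j)).
  by move=> jN; have [] := Ahp j jN (U j) (V_H10 j _ jN (VU j jN)).
have LAh j : (j <= N)%N -> L2 Omega (Ah j (U j)).
  by move=> jN; exact: H10_L2 (V_H10 j _ jN (VAh j jN)).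
have LW j : (j <= N)%N -> L2 Omega (Rc j (U j)) by move=> jN; exact: H10_L2 (HW j jN).
have [t0 tN _] := tM.
have /andP[n1 nN'] := nN; have /andP[tns stn] := ns.
have s0 : 0 < s.
  by apply: le_lt_trans tns; rewrite -t0; apply: (mesh_le tM) => //; exact: leq_trans (leq_pred n) nN'.
have sT : s <= T by rewrite -tN; apply: le_trans stn _; exact: (mesh_le tM).
have [[Hu cu [u' [Hu' du' cu']]] _ eqn] := sol.
have HUR tau : 0 <= tau <= T -> H10 Omega (UR tau).
  move=> tauI; have [m mN mI] := reconstruction_cell_exists tM N1 tauI.
  rewrite /UR (reconstruction_cell tM N1 Rc U mN mI); have /andP[_ mN'] := mN.
  by apply: H10_comb; apply: HW => //; exact: leq_trans (leq_pred m) mN'.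
(* On a cell, the elliptic operator maps the reconstruction to the interpolant of the
   functions [Ah j (U j)]. *)
have ellUR tau : 0 <= tau <= T -> is_elliptic Omega A (UR tau) (elliptic_op Omega A (UR tau)).
  move=> tauI; have [m mN mI] := reconstruction_cell_exists tM N1 tauI.
  have /andP[_ mN'] := mN; have mN'' := leq_trans (leq_pred m) mN'.
  pose a := (t m - tau) / kstep t m; pose b := (tau - t m.-1) / kstep t m.
  have E : UR tau = a *: Rc m.-1 (U m.-1) + b *: Rc m (U m).
    by rewrite /UR (reconstruction_cell tM N1 Rc U mN mI).
  have Lm := LAh m mN'; have Lm' := LAh _ mN''.
  apply: (elliptic_opP (w := a *: Ah m.-1 (U m.-1) + b *: Ah m (U m))).
  apply: (aform_is_elliptic cA); [exact: HUR|by []|].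
  move=> f' Hf; rewrite E (aform_comb cA)//; try exact: HW.
  rewrite !aW// L2dot_lincombl//; last exact: H10_L2 Hf.
  by rewrite L2dotZl//; exact: H10_L2 Hf.
have Hrho tau : 0 <= tau <= T -> H10 Omega (rho tau).
  by move=> tauI; apply: H10B; [exact: Hu|exact: HUR].
have Lu tau : 0 <= tau <= T -> L2 Omega (u tau) by move=> tauI; exact: H10_L2 (Hu _ tauI).
have LUR tau : 0 <= tau <= T -> L2 Omega (UR tau) by move=> tauI; exact: H10_L2 (HUR _ tauI).
have Lu' tau : 0 < tau < T -> L2 Omega (u' tau) by move=> tauI; exact: H10_L2 (Hu' _ tauI).
pose dr := drift N t Rc U.
have Ldr tau : L2 Omega (dr tau) by exact: (drift_L2 t LW).
pose drho tau : 'rV[R]_d -> R := u' tau - dr tau.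
have Ldrho tau : 0 < tau < T -> L2 Omega (drho tau).
  by move=> tauI; have := Lu' tau tauI; have := Ldr tau.
pose E := mesh_points N t.
have du2 tau : 0 < tau < T -> norm_derive (L2norm Omega) u tau (u' tau).
  by move=> tauI; apply: norm_derive_H1_L2; exact: du'.
have dUR tau : 0 < tau < T -> tau \notin E ->
    norm_derive (L2norm Omega) UR tau (dr tau) /\
    L2norm Omega (dr r0 - dr tau) @[r0 --> tau] --> (0 : R).
  by move=> tauI tauE; exact: (reconstruction_derive tM N1).
have le_T tau : 0 < tau < s -> 0 < tau < T.
  by move=> /andP[-> h] /=; exact: lt_le_trans sT.
have itvW tau : 0 < tau < T -> 0 <= tau <= T.
  by move=> /andP[h1 h2]; rewrite !ltW.
have drho_derive tau : 0 < tau < T -> tau \notin E ->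
    norm_derive (L2norm Omega) rho tau (drho tau).
  move=> tauI tauE; have [dU _] := dUR tau tauI tauE.
  apply: norm_deriveB (du2 tau tauI) dU => //.
  - exact: Lu'.
  - by apply: filterS (near_shift_itv tauI) => h hI; split; [exact: Lu|exact: LUR].
  - exact: Lu (itvW tau tauI).
  - exact: LUR (itvW tau tauI).
have drho_cont tau : 0 < tau < T -> tau \notin E ->
    L2norm Omega (drho r0 - drho tau) @[r0 --> tau] --> (0 : R).
  move=> tauI tauE; have [_ cU] := dUR tau tauI tauE.
  have nI : \forall r0 \near tau, 0 < r0 < T.
    have : nbhs tau `]0, T[%classic by apply: near_in_itvoo; rewrite in_itv.
    by apply: filterS => x /=; rewrite in_itv.
  have Et r0 : drho r0 - drho tau = (u' r0 - u' tau) - (dr r0 - dr tau).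
    apply/funext => x; rewrite -[LHS]/(u' r0 x - dr r0 x - (u' tau x - dr tau x)).
    by rewrite -[RHS]/((u' r0 x - u' tau x) - (dr r0 x - dr tau x)); ring.
  under eq_fun do rewrite Et.
  have Lt := Lu' tau tauI; have Ldt := Ldr tau.
  apply: cvg_normB cU.
  - by apply: filterS nI => x xI; have := Lu' x xI.
  - by apply: nearW => x; have := Ldr x.
  - apply: L2_cvg_H1.
    have tauI' : `]0, T[%classic tau by rewrite /= in_itv.
    have := cu' tau tauI'; apply: cvg_trans; apply: cvg_app => P.
    rewrite /within /= => PP.
    by apply: filterS2 nI PP => x xI; apply; rewrite in_itv.
have cap_u tau : 0 < tau <= T -> is_caputo alpha Omega u tau (caputo alpha Omega u tau).
  by move=> tauI; apply: caputoP; have [] := eqn tau tauI.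
have cap_UR tau : 0 < tau <= T -> is_caputo alpha Omega UR tau (caputo alpha Omega UR tau).
  by move=> tauI; apply: caputoP; exact: (reconstruction_caputo al01 tM N1 LW tauI).
have sub tau sg : 0 < tau <= T -> 0 < sg < tau -> 0 < sg < T.
  by move=> /andP[_ h] /andP[-> h'] /=; exact: lt_le_trans h.
have der_u tau (tauI : 0 < tau <= T) := is_caputo_any_derivative (dv := u') (E := [::])
  (cap_u tau tauI) (fun sg sgI => Lu' sg (sub tau sg tauI sgI))
  (fun sg sgI _ => du2 sg (sub tau sg tauI sgI)).
have der_UR tau (tauI : 0 < tau <= T) := is_caputo_any_derivative (dv := dr) (E := E)
  (cap_UR tau tauI) (fun sg _ => Ldr sg)
  (fun sg sgI sgE => (dUR sg (sub tau sg tauI sgI) sgE).1).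
pose Gam : R := Gamma (1 - alpha).
have Gam0 : 0 < Gam by exact: Gamma_gt0.
have omE (x : R) : x `^ (- alpha) = Gam * omega (1 - alpha) x.
  by rewrite omegaE mulrC divfK// gt_eqF.
have kern tau : 0 < tau <= T -> (@lebesgue_measure R).-integrable `]0, tau[
    (fun sg => ((tau - sg) `^ (- alpha) * L2norm Omega (drho sg))%:E).
  move=> tauI; have [i1 _] := der_u tau tauI; have [i2 _] := der_UR tau tauI.
  have mI : measurable (`]0, tau[ : set R)%classic by exact: measurable_itv.
  apply: (@le_integrableR _ _ _ (@lebesgue_measure R) _ mI _ (fun sg => Gam *
    (omega (1 - alpha) (tau - sg) * L2norm Omega (u' sg) +
     omega (1 - alpha) (tau - sg) * L2norm Omega (dr sg)))).
  - apply: measurable_funM; first by apply: measurable_funTS; exact: measurable_powR_sub.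
    apply: (measurable_norm_path (E := E)) => sg sgI.
      by apply: Ldrho; exact: sub tauI sgI.
    by move=> sgE; apply: drho_cont => //; exact: sub tauI sgI.
  - move=> sg; rewrite /= in_itv/= => sgI.
    have om0 := omega_ge0 al01 (tau - sg).
    have Ls := Lu' sg (sub tau sg tauI sgI); have Ls' := Ldr sg.
    have h : L2norm Omega (drho sg) <= L2norm Omega (u' sg) + L2norm Omega (dr sg).
      by rewrite -[X in _ + X]L2normN//; exact: L2norm_triangle.
    have nu0 := L2norm_ge0 (Omega := Omega) (u' sg); have nd0 := L2norm_ge0 (Omega := Omega) (dr sg).
    rewrite -mulrDr [leLHS]ger0_norm; last by rewrite mulr_ge0 ?powR_ge0 ?L2norm_ge0.
    rewrite [leRHS]ger0_norm; last first.
      by apply: mulr_ge0 (ltW Gam0) (mulr_ge0 om0 (addr_ge0 nu0 nd0)).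
    by rewrite omE -mulrA !ler_wpM2l ?(ltW Gam0).
  - apply: (@integrableRZl _ _ _ (@lebesgue_measure R) _ mI).
    exact: (@integrableRD _ _ _ (@lebesgue_measure R) _ mI).
pose G tau : R := (let m := mesh_index N t tau in
  L2norm Omega (caputo alpha Omega UR tau - L1_derive alpha t Pi U m) +
  L2norm Omega (elliptic_op Omega A (UR tau) - Ah m (U m)) +
  L2norm Omega (fh m - f tau) +
  L2norm Omega (elliptic_op Omega A (rho 0))).
have G0 tau : 0 <= G tau by rewrite /G !addr_ge0// L2norm_ge0.
(* The error equation tested with [rho tau], without its nonnegative elliptic term. *)
have key tau : 0 < tau < T -> Gam^-1 * \int[@lebesgue_measure R]_(sg in `]0, tau[)
      ((tau - sg) `^ (- alpha) * L2dot Omega (drho sg) (rho tau)) <=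
    G tau * L2norm Omega (rho tau).
  move=> tauI; have tauW := itvW tau tauI.
  have tauI' : 0 < tau <= T by case/andP: tauI => -> /ltW.
  have Hr := Hrho tau tauW; have Lr := H10_L2 Hr.
  have [_ /(_ _ Lr)[j1 e1]] := der_u tau tauI'.
  have [_ /(_ _ Lr)[j2 e2]] := der_UR tau tauI'.
  have mI : measurable (`]0, tau[ : set R)%classic by exact: measurable_itv.
  have [LcU _ _ _] := cap_u tau tauI'; have [LcR _ _ _] := cap_UR tau tauI'.
  have eI : Gam^-1 * \int[@lebesgue_measure R]_(sg in `]0, tau[)
      ((tau - sg) `^ (- alpha) * L2dot Omega (drho sg) (rho tau)) =
      L2dot Omega (caputo alpha Omega u tau) (rho tau) -
      L2dot Omega (caputo alpha Omega UR tau) (rho tau).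
    rewrite e1 e2 -(@RintegralB _ _ _ (@lebesgue_measure R) _ _ _ mI j1 j2).
    rewrite (_ : \int[_]_(sg in _) _ = \int[@lebesgue_measure R]_(sg in `]0, tau[)
      (Gam * (omega (1 - alpha) (tau - sg) * L2dot Omega (u' sg) (rho tau) -
              omega (1 - alpha) (tau - sg) * L2dot Omega (dr sg) (rho tau)))); last first.
      apply: eq_Rintegral => sg; rewrite inE/= in_itv/= => sgI.
      have Ls := Lu' sg (sub tau sg tauI' sgI); have Ls' := Ldr sg.
      by rewrite omE /drho L2dotBl//; ring.
    rewrite RintegralZl//; first by rewrite mulKf// gt_eqF.
    exact: (@integrableRB _ _ _ (@lebesgue_measure R) _ mI).
  have [_ weak] := eqn tau tauI'.
  have {}weak := weak _ Hr.
  have Lf : L2 Omega (f tau) by have [Lf _] := Cf; exact: Lf.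
  have ell := is_elliptic_aform cA (HUR tau tauW) (ellUR tau tauW) Hr.
  have [Lell _] := ellUR tau tauW.
  have coer' : 0 <= aform Omega A (u tau) (rho tau) - aform Omega A (UR tau) (rho tau).
    rewrite -(aformB cA (Hu tau tauW) (HUR tau tauW) Hr).
    by apply: le_trans (coer _ Hr); rewrite mulr_ge0 ?sqr_ge0// ltW.
  have [m mN mI'] := mesh_cell tM tauI'.
  have Em : mesh_index N t tau = m := mesh_index_cell tM mN mI'.
  have /andP[_ mN'] := mN.
  have LAm := LAh m mN'.
  have Lfh : L2 Omega (fh m).
    apply: H10_L2 (V_H10 m _ mN' _).
    have Lft : L2 Omega (f (t m)).
      have [Lft _] := Cf; apply: Lft; rewrite -t0 -tN.
      by rewrite !(mesh_le tM).
    by have [] := P0p m mN' _ Lft.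
  have EL1 : L1_derive alpha t Pi U m = fh m - Ah m (U m).
    by rewrite -(L1eq m mN) addrK.
  have LL1 : L2 Omega (L1_derive alpha t Pi U m) by rewrite EL1.
  (* By the scheme, the three residuals add up to the defect of [UR] in the equation of [u]. *)
  rewrite eI /G /= Em.
  set a1 := caputo alpha Omega UR tau - _; set a2 := elliptic_op _ _ (UR tau) - _.
  set a3 := fh m - f tau.
  have La1 : L2 Omega a1 by []. have La2 : L2 Omega a2 by []. have La3 : L2 Omega a3 by [].
  have c1 := L2_cauchy_schwarz La1 Lr; have c2 := L2_cauchy_schwarz La2 Lr.
  have c3 := L2_cauchy_schwarz La3 Lr.
  have sum : L2dot Omega a1 (rho tau) + L2dot Omega a2 (rho tau) + L2dot Omega a3 (rho tau) =
      L2dot Omega (caputo alpha Omega UR tau) (rho tau) +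
      L2dot Omega (elliptic_op Omega A (UR tau)) (rho tau) - L2dot Omega (f tau) (rho tau).
    by rewrite /a1 /a2 /a3 !L2dotBl// EL1 L2dotBl//; ring.
  have p4 : 0 <= L2norm Omega (elliptic_op Omega A (rho 0)) * L2norm Omega (rho tau).
    by rewrite mulr_ge0// L2norm_ge0.
  by apply: tested_error_bound weak coer' ell sum c1 c2 c3 p4.
have crho : Defs.norm_continuous (L2norm Omega) `[0, s] rho.
  have inT x : `[0, s]%classic x -> `[0, T]%classic x.
    by rewrite /= !in_itv/= => /andP[-> h]; exact: le_trans sT.
  apply: (norm_continuousB (I := `[0, s]%classic)).
  - by move=> x /inT; rewrite /= in_itv; exact: Lu.
  - by move=> x /inT; rewrite /= in_itv; exact: LUR.
  - exact: norm_continuousS inT cu.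
  - exact: norm_continuousS inT (reconstruction_continuous tM N1 LW).
have le0T x : 0 <= x <= s -> 0 <= x <= T by move=> /andP[-> h]; exact: le_trans sT.
have lt0T x : 0 < x <= s -> 0 < x <= T by move=> /andP[-> h]; exact: le_trans sT.
have est := fractional_energy_estimate (rho := rho) (drho := drho) (E := E) (G := G)
  al01 Gam0 s0 (fun x xI => H10_L2 (Hrho x (le0T x xI))) crho
  (fun x xI => Ldrho x (le_T x xI)) (fun x xI => drho_derive x (le_T x xI))
  (fun x xI => drho_cont x (le_T x xI)) (fun x xI => kern x (lt0T x xI))
  (fun x _ => G0 x) (fun x xI => key x (le_T x xI)).
apply: le_trans est _.
apply: leeD => //; apply: lee_pmul => //.
- by rewrite lee_fin divr_ge0 ?(ltW Gam0) ?(ltW (pi_gt0 R)).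
- by apply: integral_ge0 => x _; rewrite lee_fin mulr_ge0 ?powR_ge0.
- by rewrite lee_fin; exact: sector_constant_ge.
Qed.
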